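(* Let $H,U$ be Hilbert spaces and let $(A,B)$ satisfy: (1) $A:D(A)\subset H\to H$ generates a $C_0$-group $S(\cdot)$ on $H$; (2) $B\in\mathcal{L}(U;D(A^* )')$; (3) for every $T>0$ there is $C(T)>0$ with $\int_0^T\|B^*S^*(t)\varphi\|_{U'}^2dt\le C(T)\|\varphi\|_{H'}^2$ for all $\varphi\in D(A^* )$; (4) there are constants $\alpha>0$, $C_1(\alpha)\ge 0$, $C_2(\alpha)\ge 1$ (fixed from now on) such that $$\|S^*(t)\varphi\|^2_{H'}\le C_1(\alpha)\int_0^t\|B^*S^*(s)\varphi\|_{U'}^2ds+C_2(\alpha)e^{-\alpha t}\|\varphi\|^2_{H'}\quad\text{for all } t>0,\ \varphi\in D(A^* ).$$ Then for each pair $(\varepsilon,T)\in[0,\alpha)\times(0,+\infty)$ verifying $$\begin{cases}\varepsilon\in(0,\alpha)\ \text{and}\ T\ge\varepsilon^{-1}\ln[C_2(\alpha)], & \text{if } C_2(\alpha)>1,\\ \varepsilon\in[0,\alpha)\ \text{and}\ T>0, & \text{if } C_2(\alpha)=1,\end{cases}$$ the operator $$K_{\varepsilon,T}:=-TC_1(\alpha)e^{\alpha T}J_1B^*\Pi_{\alpha,\varepsilon,T}^{-1}:\ \Pi_{\alpha,\varepsilon,T}[D(A^* )]\to U$$ is a feedback law stabilizing the system $x'(t)=Ax(t)+Bu(t)$, $t>0$, with the decay rate $\frac12(\alpha-\varepsilon)$.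
   Context: Notation. For a Hilbert space $X$, $X'$ is its dual, $\langle\cdot,\cdot\rangle_{X,X'}$ the (bilinear) dual pairing, and $X''$ is identified with $X$; $H$ and $U$ are not identified with their duals. For a densely defined closed operator $L$ on $X$, $D(L)$ carries the graph norm $(\|x\|_X^2+\|Lx\|_X^2)^{1/2}$, and the adjoint $L^*$ on $X'$ is defined by $\langle Lx,y\rangle_{X,X'}=\langle x,L^*y\rangle_{X,X'}$. $S^*(t):=S(t)^*$ is the adjoint group on $H'$, generated by $A^*$. $D(A^* )''$ is identified with $D(A^* )$, so $B^*\in\mathcal{L}(D(A^* );U')$. $\mathbb{R}^+=[0,\infty)$. $J_1:U'\to U$ and $J_2:H'\to H$ are the canonical conjugate-linear Riesz isomorphisms; in particular $\langle J_1 f,f\rangle_{U,U'}=\|f\|_{U'}^2$ and $\langle J_2\varphi,\varphi\rangle_{H,H'}=\|\varphi\|_{H'}^2$. $\widetilde{A}\in\mathcal{L}(H;D(A^* )')$ is the unique extension of $A$ given by $\langle \widetilde{A}\varphi,\psi\rangle_{D(A^* )',D(A^* )}=\langle\varphi,A^*\psi\rangle_{H,H'}$ for $\varphi\in H$, $\psi\in D(A^* )$; $H$ is embedded in $D(A^* )'$ through $\langle\cdot,\cdot\rangle_{H,H'}$. Under (1)-(3), for every $T>0$ the map $\varphi\mapsto B^*S^*(\cdot)\varphi$ is bounded from $(D(A^* ),\|\cdot\|_{H'})$ to $L^2(-T,T;U')$, so it extends uniquely to a continuous operator $\varphi\mapsto \widetilde{B^*S^*}(\cdot)\varphi$ from $H'$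 to $L^2_{loc}(\mathbb{R};U')$. Operators. For $\varepsilon\in[0,\alpha)$, $T>0$, $t\in[0,T]$, define $\Lambda_{\alpha,\varepsilon,T}(t):H'\to H$ and $\Pi_{\alpha,\varepsilon,T}:H'\to H$ by $$\langle \Lambda_{\alpha,\varepsilon,T}(t)\varphi,\psi\rangle_{H,H'}=C_1(\alpha)e^{\alpha T}\int_0^t e^{-(\alpha-\varepsilon)s}\langle J_1\widetilde{B^*S^*}(-s)\varphi,\widetilde{B^*S^*}(-s)\psi\rangle_{U,U'}ds+C_2(\alpha)e^{-(\alpha-\varepsilon)t}\langle J_2S^*(-t)\varphi,S^*(-t)\psi\rangle_{H,H'},$$ $$\langle \Pi_{\alpha,\varepsilon,T}\varphi,\psi\rangle_{H,H'}=\int_0^T\langle\Lambda_{\alpha,\varepsilon,T}(t)\varphi,\psi\rangle_{H,H'}dt,\qquad \varphi,\psi\in H'.$$ These are conjugate-linear and bounded, and $\Pi_{\alpha,\varepsilon,T}$ is invertible under (1)-(4). Feedback law. An operator $K$ is a feedback law stabilizing $x'=Ax+Bu$ with decay rate $\omega>0$ if there is a $C_0$-semigroup $\mathcal{S}(\cdot)$ on $H$ with generator $\mathcal{A}:D(\mathcal{A})\subset H\to H$ such that $K\in\mathcal{L}(D(\mathcal{A});U)$ (in particular $K$ has domain $D(\mathcal{A})$, with the graph norm) and: (i) there is $C\ge1$ with $\|\mathcal{S}(t)\|_{\mathcal{L}(H)}\le Ce^{-\omega t}$ for all $t\in\mathbb{R}^+$; (ii) $\mathcal{A}x=(\widetilde{A}+BK)x$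 for all $x\in D(\mathcal{A})$; (iii) there is $C'\ge0$ with $\|K\mathcal{S}(\cdot)x\|_{L^2(\mathbb{R}^+;U)}\le C'\|x\|_H$ for all $x\in D(\mathcal{A})$. *)

(* Defs.v *)
From HB Require Import structures.
Set Warnings "-notation-overridden,-notation-incompatible-prefix,-ambiguous-paths,-redundant-canonical-projection,-projection-no-head-constant".
From mathcomp Require Import all_boot all_order all_algebra.
From mathcomp Require Import sesquilinear complex ring lra.
From mathcomp Require Import all_classical all_reals all_analysis.

Set Implicit Arguments.
Unset Strict Implicit.
Unset Printing Implicit Defensive.

Import Order.TTheory GRing.Theory Num.Theory.
Import numFieldTopology.Exports numFieldNormedType.Exports.

Local Open Scope classical_set_scope.
Local Open Scope complex_scope.
Local Open Scope ring_scope.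

(* The norm of a normedModType over R[i] takes its values in R[i]; nrm is the
   same norm as an element of R. *)
Definition nrm (R : realType) (X : normedModType R[i]) (x : X) : R :=
  complex.Re `|x|.

Section NrmTheory.
Context {R : realType} {X : normedModType R[i]}.
Implicit Types x y : X.

Lemma nrmE x : (nrm x)%:C = `|x|.
Proof. by rewrite /nrm RRe_real// normr_real. Qed.

Lemma nrm_ge0 x : 0 <= nrm x.
Proof. by rewrite -lecR nrmE normr_ge0. Qed.

Lemma nrmD x y : nrm (x + y) <= nrm x + nrm y.
Proof. by rewrite -lecR rmorphD/= !nrmE ler_normD. Qed.

Lemma nrm0_eq0 x : nrm x = 0 -> x = 0.
Proof. by move=> x0; apply/normr0_eq0; rewrite -nrmE x0. Qed.

Lemma nrm0 : nrm (0 : X) = 0.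
Proof. by rewrite /nrm normr0. Qed.

Lemma nrmZ (a : R[i]) x : nrm (a *: x) = complex.Re `|a| * nrm x.
Proof.
apply: (@complexI R); rewrite rmorphM/= !nrmE normrZ; congr (_ * _).
Qed.

End NrmTheory.

HB.mixin Record isHilbert (R : realType) H & CompleteNormedModule R[i] H := {
  hdot : {dot H for (@Num.conj R[i])};
  hdot_norm : forall x : H, `|x| ^+ 2 = hdot x x
}.

#[short(type="hilbertType")]
HB.structure Definition Hilbert (R : realType) :=
  {H of CompleteNormedModule R[i] H & isHilbert R H}.

Definition is_bounded_linear (R : realType) (X Y : normedModType R[i])
    (f : X -> Y) : Prop :=
  linear f /\ exists M : R, forall x, nrm (f x) <= M * nrm x.

Definition bounded_linear (R : realType) (X Y : normedModType R[i]) :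
  {pred X -> Y} := fun f => `[< is_bounded_linear f >].

Section BoundedOperators.
Context {R : realType} {X Y : normedModType R[i]}.

Lemma bounded_linear_submod_closed : submod_closed (@bounded_linear R X Y).
Proof.
split.
  apply/asboolP; split=> [a x y|]; first by rewrite /= scaler0 addr0.
  by exists 0 => x; rewrite mul0r nrm0.
move=> a f g /asboolP[lf [M hM]] /asboolP[lg [N hN]].
apply/asboolP; split=> [b x y|].
  rewrite /= !fctE lf lg !scalerDr !scalerA [a * b]mulrC.
  by rewrite addrACA.
exists (complex.Re `|a| * M + N) => x.
rewrite (le_trans (nrmD _ _))// nrmZ mulrDl lerD// -mulrA ler_wpM2l//.
by rewrite -lecR RRe_real ?normr_ge0// normr_real.
Qed.

HB.instance Definition _ := GRing.isSubmodClosed.Build R[i] (X -> Y)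
  (@bounded_linear R X Y) bounded_linear_submod_closed.

End BoundedOperators.

(* bop X Y is the normed space of bounded linear operators from X to Y, with
   the operator norm *)
Record bop (R : realType) (X Y : normedModType R[i]) := Bop {
  bop_fun :> X -> Y;
  bop_subproof : bop_fun \in @bounded_linear R X Y
}.

HB.instance Definition _ (R : realType) (X Y : normedModType R[i]) :=
  [isSub of bop X Y for @bop_fun R X Y].
HB.instance Definition _ (R : realType) (X Y : normedModType R[i]) :=
  [Choice of bop X Y by <:].
HB.instance Definition _ (R : realType) (X Y : normedModType R[i]) :=
  [SubChoice_isSubZmodule of bop X Y by <:].
HB.instance Definition _ (R : realType) (X Y : normedModType R[i]) :=
  [SubZmodule_isSubLmodule of bop X Y by <:].

Section OperatorNorm.
Context {R : realType} {X Y : normedModType R[i]}.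
Implicit Types f g : bop X Y.

Lemma bop_linear f : linear f.
Proof. by case: f => f /= /asboolP[]. Qed.

Lemma bop_bounded f : exists M : R, forall x, nrm (f x) <= M * nrm x.
Proof. by case: f => f /= /asboolP[]. Qed.

HB.instance Definition _ f :=
  GRing.isLinear.Build R[i] X Y *:%R (bop_fun f) (bop_linear f).

Lemma bopDE f g x : (f + g) x = f x + g x. Proof. by []. Qed.

Lemma bopZE a f x : (a *: f) x = a *: f x. Proof. by []. Qed.

Lemma bop_ext f g : (forall x, f x = g x) -> f = g.
Proof. by move=> fg; apply/val_inj/funext. Qed.

Definition opnorm f : R := sup [set nrm (f x) | x in [set x | nrm x <= 1]].

Lemma has_sup_opnorm f : has_sup [set nrm (f x) | x in [set x | nrm x <= 1]].
Proof.
split; first by exists (nrm (f 0)), 0 => //=; rewrite nrm0.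
have [M fM] := bop_bounded f; exists `|M| => _ [x /= x1 <-].
rewrite (le_trans (fM x))// (le_trans (ler_wpM2r (nrm_ge0 _) (ler_norm M)))//.
by rewrite ler_piMr.
Qed.

Lemma opnorm_ge0 f : 0 <= opnorm f.
Proof.
apply: (@le_trans _ _ (nrm (f 0))); first exact: nrm_ge0.
by apply: (sup_upper_bound (has_sup_opnorm f)); exists 0; rewrite //= nrm0.
Qed.

Lemma opnormP f x : nrm (f x) <= opnorm f * nrm x.
Proof.
have [->|x0] := eqVneq x 0; first by rewrite linear0 !nrm0 mulr0.
have nx0 : 0 < nrm x.
  by rewrite lt_neqAle nrm_ge0 andbT eq_sym; apply: contra_neq x0 => /nrm0_eq0.
have normV : complex.Re `|((nrm x)^-1)%:C| = (nrm x)^-1.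
  by rewrite ger0_norm// lecR invr_ge0 nrm_ge0.
have /(sup_upper_bound (has_sup_opnorm f)) :
    [set nrm (f y) | y in [set y | nrm y <= 1]] (nrm (f (((nrm x)^-1)%:C *: x))).
  by eexists; last reflexivity; rewrite /= nrmZ normV mulVf ?gt_eqF.
by rewrite linearZ/= nrmZ normV ler_pdivrMl// mulrC.
Qed.

Lemma opnorm_le f M : 0 <= M -> (forall x, nrm (f x) <= M * nrm x) ->
  opnorm f <= M.
Proof.
move=> M0 fM; apply: ge_sup; first by have [] := has_sup_opnorm f.
by move=> _ [x /= x1 <-]; rewrite (le_trans (fM x))// ler_piMr.
Qed.

Let norm f : R[i] := (opnorm f)%:C.

Let normD f g : norm (f + g) <= norm f + norm g.
Proof.
rewrite /norm -rmorphD/= lecR opnorm_le ?addr_ge0 ?opnorm_ge0// => x.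
by rewrite bopDE (le_trans (nrmD _ _))// mulrDl lerD// opnormP.
Qed.

Let Re_norm_ge0 (a : R[i]) : 0 <= complex.Re `|a|.
Proof. by rewrite -lecR RRe_real ?normr_ge0// normr_real. Qed.

Let opnormZ_le a f : opnorm (a *: f) <= complex.Re `|a| * opnorm f.
Proof.
apply: opnorm_le => [|x]; first by rewrite mulr_ge0 ?opnorm_ge0.
by rewrite bopZE nrmZ -mulrA ler_wpM2l// opnormP.
Qed.

Let opnorm0 : opnorm 0 = 0.
Proof.
apply/eqP; rewrite eq_le opnorm_ge0 andbT; apply: opnorm_le => // x.
by rewrite mul0r nrm0.
Qed.

Let normZ a f : norm (a *: f) = `|a| * norm f.
Proof.
rewrite /norm -[`|a|]RRe_real ?normr_real// -rmorphM; congr (_ %:C).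
apply/eqP; rewrite eq_le opnormZ_le andTb.
have [->|a0] := eqVneq a 0; first by rewrite normr0 mul0r opnorm_ge0.
have Ra0 : 0 < complex.Re `|a|.
  by rewrite -ltcR RRe_real ?normr_gt0// normr_real.
rewrite -ler_pdivlMl//; have := opnormZ_le a^-1 (a *: f).
rewrite scalerA mulVf// scale1r => /le_trans; apply.
suff -> : complex.Re `|a^-1| = (complex.Re `|a|)^-1 by [].
by rewrite normfV -[in LHS](RRe_real (normr_real a)) -fmorphV.
Qed.

Let norm0_eq0 f : norm f = 0 -> f = 0.
Proof.
move=> /(@complexI R) f0; apply: bop_ext => x; apply: nrm0_eq0.
by apply/eqP; rewrite eq_le nrm_ge0 andbT (le_trans (opnormP f x))// f0 mul0r.
Qed.

HB.instance Definition _ := @Lmodule_isNormed.Build R[i] (bop X Y)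
  norm normD normZ norm0_eq0.

Lemma nrm_opnorm f : nrm f = opnorm f. Proof. by []. Qed.

Lemma nrm_bop f x : nrm (f x) <= nrm f * nrm x. Proof. exact: opnormP. Qed.

End OperatorNorm.

Notation dual X := (bop X (complex _)^o).

(* Unbounded linear operators: lfun is only meaningful on the subspace ldom. *)
Record lop (R : realType) (X : normedModType R[i]) := Lop {
  ldom : set X;
  lfun : X -> X;
  ldom0 : ldom 0;
  ldom_lin : forall (a : R[i]) x y, ldom x -> ldom y -> ldom (a *: x + y);
  lfun_lin : forall (a : R[i]) x y, ldom x -> ldom y ->
    lfun (a *: x + y) = a *: lfun x + lfun y
}.

Definition ldom_pred (R : realType) (X : normedModType R[i]) (L : lop X) :
  {pred X} := mem (ldom L).

Section DomainPred.
Context {R : realType} {X : normedModType R[i]} (L : lop X).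

Lemma ldom_submod_closed : submod_closed (ldom_pred L).
Proof.
split; first by rewrite mem_set//; exact: ldom0.
by move=> a x y /set_mem Lx /set_mem Ly; apply/mem_set/ldom_lin.
Qed.

HB.instance Definition _ :=
  GRing.isSubmodClosed.Build R[i] X (ldom_pred L) ldom_submod_closed.

End DomainPred.

(* D(L) as a space of its own, with the graph norm *)
Record dom (R : realType) (X : normedModType R[i]) (L : lop X) := Dom {
  dval :> X;
  dom_subproof : dval \in ldom_pred L
}.

HB.instance Definition _ (R : realType) (X : normedModType R[i]) (L : lop X) :=
  [isSub of dom L for @dval R X L].
HB.instance Definition _ (R : realType) (X : normedModType R[i]) (L : lop X) :=
  [Choice of dom L by <:].
HB.instance Definition _ (R : realType) (X : normedModType R[i]) (L : lop X) :=
  [SubChoice_isSubZmodule of dom L by <:].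
HB.instance Definition _ (R : realType) (X : normedModType R[i]) (L : lop X) :=
  [SubZmodule_isSubLmodule of dom L by <:].

Section GraphNorm.
Context {R : realType} {X : normedModType R[i]} (L : lop X).
Implicit Types u v : dom L.

Lemma domP u : ldom L u.
Proof. exact/set_mem/dom_subproof. Qed.

Lemma dvalD u v : dval (u + v) = dval u + dval v. Proof. by []. Qed.

Lemma dvalZ a u : dval (a *: u) = a *: dval u. Proof. by []. Qed.

Lemma dom_funD u v : lfun L (dval (u + v)) = lfun L u + lfun L v.
Proof.
by have := lfun_lin 1 (domP u) (domP v); rewrite !scale1r -dvalD.
Qed.

Lemma lfun0 : lfun L 0 = 0.
Proof.
have := lfun_lin 1 (ldom0 L) (ldom0 L).
by rewrite !scale1r addr0 => /eqP; rewrite -subr_eq subrr eq_sym => /eqP.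
Qed.

Lemma dom_funZ a u : lfun L (dval (a *: u)) = a *: lfun L u.
Proof.
by have := lfun_lin a (domP u) (ldom0 L); rewrite lfun0 !addr0 -dvalZ.
Qed.

Definition graph_norm u : R :=
  Num.sqrt (nrm (dval u) ^+ 2 + nrm (lfun L u) ^+ 2).

Lemma graph_normE u :
  graph_norm u = Normc.normc (nrm (dval u) +i* nrm (lfun L u)).
Proof. by []. Qed.

Let norm u : R[i] := (graph_norm u)%:C.

Let normD u v : norm (u + v) <= norm u + norm v.
Proof.
rewrite /norm -rmorphD lecR.
apply: le_trans (le_normcD (nrm (dval u) +i* nrm (lfun L u))
                           (nrm (dval v) +i* nrm (lfun L v))).
rewrite ler_sqrt ?addr_ge0 ?sqr_ge0// lerD//; apply: lerXn2r;
  rewrite ?nnegrE ?addr_ge0 ?nrm_ge0//.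
- by rewrite dvalD nrmD.
- by rewrite dom_funD nrmD.
Qed.

Let normZ a u : norm (a *: u) = `|a| * norm u.
Proof.
rewrite /norm -[`|a|]RRe_real ?normr_real// -rmorphM; congr (_ %:C).
rewrite /graph_norm dvalZ dom_funZ !nrmZ !exprMn -mulrDr sqrtrM ?sqr_ge0//.
by rewrite sqrtr_sqr ger0_norm// -lecR RRe_real ?normr_ge0// normr_real.
Qed.

Let norm0_eq0 u : norm u = 0 -> u = 0.
Proof.
move=> /(@complexI R) /eqP; rewrite sqrtr_eq0 => u0; apply/val_inj/nrm0_eq0/eqP.
rewrite -sqrf_eq0 eq_le sqr_ge0 andbT (le_trans _ u0)//.
by rewrite lerDl sqr_ge0.
Qed.

HB.instance Definition _ := @Lmodule_isNormed.Build R[i] (dom L)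
  norm normD normZ norm0_eq0.

Lemma nrm_dom u : nrm u = graph_norm u. Proof. by []. Qed.

Lemma nrm_dval_le u : nrm (dval u) <= nrm u.
Proof.
rewrite nrm_dom -[leLHS]ger0_norm ?nrm_ge0// -sqrtr_sqr.
by rewrite ler_sqrt ?addr_ge0 ?sqr_ge0// lerDl sqr_ge0.
Qed.

Lemma nrm_lfun_le u : nrm (lfun L u) <= nrm u.
Proof.
rewrite nrm_dom -[leLHS]ger0_norm ?nrm_ge0// -sqrtr_sqr.
by rewrite ler_sqrt ?addr_ge0 ?sqr_ge0// lerDr sqr_ge0.
Qed.

End GraphNorm.

(* f x for x in D(L), and 0 outside D(L) *)
Definition dapp (R : realType) (X : normedModType R[i]) (L : lop X)
    (Y : zmodType) (f : dom L -> Y) (x : X) : Y :=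
  if insub x is Some u then f u else 0.

(* densely defined closed operators *)
Record dcop (R : realType) (X : normedModType R[i]) := Dcop {
  dcop_lop :> lop X;
  dcop_dense : dense (ldom dcop_lop);
  dcop_closed : closed [set p : X * X | ldom dcop_lop p.1 /\
                                        lfun dcop_lop p.1 = p.2]
}.

Section Adjoint.
Context {R : realType} {X : normedModType R[i]} (L : dcop X).
Implicit Types y z : dual X.

Definition adj_rel y z : Prop := forall x : dom L, y (lfun L x) = z (dval x).

Lemma adj_rel_lin a y1 y2 z1 z2 : adj_rel y1 z1 -> adj_rel y2 z2 ->
  adj_rel (a *: y1 + y2) (a *: z1 + z2).
Proof. by move=> h1 h2 x; rewrite !bopDE !bopZE h1 h2. Qed.

Lemma adj_rel_fun y z1 z2 : adj_rel y z1 -> adj_rel y z2 -> z1 = z2.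
Proof.
move=> h1 h2; apply/eqP; rewrite -subr_eq0; apply/eqP; set w := z1 - z2.
have w0 (x : X) : ldom L x -> w x = 0.
  move=> Lx; have := h1 (Dom (mem_set Lx)); rewrite (h2 (Dom (mem_set Lx)))/=.
  by move=> e; apply/eqP; rewrite subr_eq0 e.
clearbody w; apply: bop_ext => x; apply/nrm0_eq0/eqP.
rewrite eq_le nrm_ge0 andbT.
apply/ler_addgt0Pl => e e0; rewrite addr0.
have M0 : 0 < nrm w + 1 by rewrite ltr_wpDl// nrm_ge0.
have [||d [xd Ld]] := dcop_dense (O := ball x (e / (nrm w + 1))%:C) L.
- by exists x; apply: ballxx; rewrite ltcR divr_gt0.
- exact: ball_open.
move: xd; rewrite -ball_normE/= -nrmE ltcR => xd.
have -> : w x = w (x - d).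
  have -> : w (x - d) = w x - w d by exact: linearB.
  by rewrite (w0 _ Ld) subr0.
rewrite (le_trans (nrm_bop _ _))//.
rewrite (@le_trans _ _ ((nrm w + 1) * nrm (x - d)))//.
  by rewrite ler_wpM2r ?nrm_ge0// lerDl.
by rewrite mulrC -ler_pdivlMr// ltW.
Qed.

Definition adj_fun y : dual X := xget 0 (adj_rel y).

Lemma adj_funP y z : adj_rel y z -> adj_fun y = z.
Proof. by move=> h; apply: xget_unique => // z' h'; exact: adj_rel_fun h' h. Qed.

Let adj_dom0 : exists z, adj_rel 0 z.
Proof. by exists 0 => x. Qed.

Let adj_dom_lin (a : R[i]) y1 y2 : (exists z, adj_rel y1 z) ->
  (exists z, adj_rel y2 z) -> exists z, adj_rel (a *: y1 + y2) z.
Proof.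
by move=> [z1 h1] [z2 h2]; exists (a *: z1 + z2); exact: adj_rel_lin.
Qed.

Let adj_fun_lin (a : R[i]) y1 y2 : (exists z, adj_rel y1 z) ->
  (exists z, adj_rel y2 z) ->
  adj_fun (a *: y1 + y2) = a *: adj_fun y1 + adj_fun y2.
Proof.
move=> [z1 h1] [z2 h2]; rewrite (adj_funP h1) (adj_funP h2).
by apply: adj_funP; exact: adj_rel_lin.
Qed.

Definition adjoint : lop (dual X) :=
  @Lop R (dual X) [set y | exists z, adj_rel y z] adj_fun
    adj_dom0 adj_dom_lin adj_fun_lin.

Lemma adjointP (y : dom adjoint) (x : dom L) :
  dval y (lfun L x) = lfun adjoint (dval y) (dval x).
Proof. by have [z h] := domP y; rewrite /= (adj_funP h) h. Qed.

End Adjoint.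

Section Duality.
Context {R : realType}.

Lemma is_bounded_linear_bop (X Y : normedModType R[i]) (f : X -> Y) :
  is_bounded_linear f -> f \in @bounded_linear R X Y.
Proof. by move=> h; apply/asboolP. Qed.

(* the adjoint of a bounded operator *)
Lemma badj_subproof (X Y : normedModType R[i]) (F : bop X Y) (y : dual Y) :
  (fun x => y (F x)) \in @bounded_linear R X R[i]^o.
Proof.
apply: is_bounded_linear_bop; split=> [a u v|]; first by rewrite !linearP.
exists (nrm y * nrm F) => x.
by rewrite (le_trans (nrm_bop _ _))// -mulrA ler_wpM2l ?nrm_ge0 ?nrm_bop.
Qed.

Definition badj (X Y : normedModType R[i]) (F : bop X Y) (y : dual Y) :
  dual X := Bop (badj_subproof F y).

(* the adjoint V -> U' of B in L(U; V'), V'' being identified with V *)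
Lemma predual_adj_subproof (U V : normedModType R[i]) (B : bop U (dual V))
  (v : V) : (fun u => B u v) \in @bounded_linear R U R[i]^o.
Proof.
apply: is_bounded_linear_bop; split=> [a u w|]; first by rewrite linearP.
exists (nrm B * nrm v) => u; rewrite (le_trans (nrm_bop _ _))//.
by rewrite mulrAC ler_wpM2r ?nrm_ge0 ?nrm_bop.
Qed.

Definition predual_adj (U V : normedModType R[i]) (B : bop U (dual V))
  (v : V) : dual U := Bop (predual_adj_subproof B v).

(* the embedding of X in D(L^* )' *)
Lemma dom_embed_subproof (X : normedModType R[i]) (L : dcop X) (x : X) :
  (fun y : dom (adjoint L) => dval y x) \in
    @bounded_linear R (dom (adjoint L)) R[i]^o.
Proof.
apply: is_bounded_linear_bop; split=> [//|]; exists (nrm x) => y.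
rewrite (le_trans (nrm_bop _ _))// mulrC ler_wpM2l ?nrm_ge0//.
exact: nrm_dval_le.
Qed.

Definition dom_embed (X : normedModType R[i]) (L : dcop X) (x : X) :
  dual (dom (adjoint L)) := Bop (dom_embed_subproof L x).

(* the extension of L to an operator from X to D(L^* )' *)
Lemma lop_ext_subproof (X : normedModType R[i]) (L : dcop X) (x : X) :
  (fun y : dom (adjoint L) => lfun (adjoint L) (dval y) x) \in
    @bounded_linear R (dom (adjoint L)) R[i]^o.
Proof.
apply: is_bounded_linear_bop; split=> [a y z|].
  by rewrite dom_funD dom_funZ.
exists (nrm x) => y.
rewrite (le_trans (nrm_bop _ _))// mulrC ler_wpM2l ?nrm_ge0//.
exact: nrm_lfun_le.
Qed.

Definition lop_ext (X : normedModType R[i]) (L : dcop X) (x : X) :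
  dual (dom (adjoint L)) := Bop (lop_ext_subproof L x).

(* the canonical conjugate-linear isomorphism X' -> X *)
Definition riesz (X : hilbertType R) (f : dual X) : X :=
  xget 0 [set u | forall v, f v = hdot v u].

(* the vector of X that represents an element F of X'' *)
Definition of_bidual (X : normedModType R[i]) (F : dual X -> R[i]) : X :=
  xget 0 [set x | forall f : dual X, f x = F f].

End Duality.

Section Semigroups.
Context {R : realType} {X : normedModType R[i]}.

Definition C0_semigroup (S : R -> bop X X) : Prop :=
  [/\ forall x, S 0 x = x,
      forall s t, 0 <= s -> 0 <= t -> forall x, S (s + t) x = S s (S t x) &
      forall x, S t x @[t --> 0^'+] --> x].

Definition semigroup_generator (S : R -> bop X X) (L : lop X) : Prop :=
  forall x y, (ldom L x /\ lfun L x = y) <->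
    (h^-1)%:C *: (S h x - x) @[h --> 0^'+] --> y.

Definition C0_group (S : R -> bop X X) : Prop :=
  [/\ forall x, S 0 x = x,
      forall s t x, S (s + t) x = S s (S t x) &
      forall x, S t x @[t --> 0] --> x].

Definition group_generator (S : R -> bop X X) (L : lop X) : Prop :=
  forall x y, (ldom L x /\ lfun L x = y) <->
    (h^-1)%:C *: (S h x - x) @[h --> 0^'] --> y.

End Semigroups.

Section L2.
Context {R : realType} {V : normedModType R[i]}.

Definition strongly_measurable (f : R -> V) : Prop :=
  exists s : nat -> R -> V,
    (forall n, finite_set (range (s n)) /\
               forall v, measurable (s n @^-1` [set v])) /\
    forall t, s n t @[n --> \oo] --> f t.

(* the square of the norm of f in L^2(D; V) *)
Definition sqL2norm (D : set R) (f : R -> V) : \bar R :=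
  \int[lebesgue_measure]_(t in D) (nrm (f t) ^+ 2)%:E.

Definition L2loc (f : R -> V) : Prop :=
  strongly_measurable f /\
  forall T : R, 0 < T -> (sqL2norm `[(- T)%R, T] f < +oo)%E.

End L2.

Definition Cintegral (R : realType) (a b : R) (f : R -> R[i]) : R[i] :=
  Complex (\int[lebesgue_measure]_(t in `[a, b]) complex.Re (f t))
          (\int[lebesgue_measure]_(t in `[a, b]) complex.Im (f t)).

Section Control.
Context {R : realType} {H U : hilbertType R}.
Variables (A : dcop H) (S : R -> bop H H) (B : bop U (dual (dom (adjoint A)))).

(* B^* S^*(t) phi for phi in D(A^* ), a subspace that S^*(t) leaves invariant *)
Definition BS (phi : dom (adjoint A)) (t : R) : dual U :=
  dapp (predual_adj B) (badj (S t) (dval phi)).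

(* E chooses a representative of the image of each phi in H' under the
   continuous extension of phi |-> B^* S^*(.) phi to an operator from H' to
   L^2_loc(R; U') *)
Definition is_BS_ext (E : dual H -> R -> dual U) : Prop :=
  [/\ forall phi, L2loc (E phi),
      forall (a : R[i]) phi psi, {ae lebesgue_measure, forall t : R,
        E (a *: phi + psi) t = a *: E phi t + E psi t},
      forall T : R, 0 < T -> exists M : R, forall phi,
        (sqL2norm `[(- T)%R, T] (E phi) <= (M * nrm phi ^+ 2)%:E)%E &
      forall phi : dom (adjoint A), {ae lebesgue_measure, forall t : R,
        E (dval phi) t = BS phi t}].

Definition BS_ext : dual H -> R -> dual U := xget (fun _ _ => 0) is_BS_ext.

Section Gramian.
Variables (alpha C1 C2 eps T : R).

Definition Lambda_form (t : R) (phi psi : dual H) : R[i] :=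
  (C1 * expR (alpha * T))%:C *
    Cintegral 0 t (fun s => (expR (- ((alpha - eps) * s)))%:C *
      BS_ext psi (- s) (riesz (BS_ext phi (- s)))) +
  (C2 * expR (- ((alpha - eps) * t)))%:C *
    badj (S (- t)) psi (riesz (badj (S (- t)) phi)).

Definition Lambda_op (t : R) (phi : dual H) : H :=
  of_bidual (Lambda_form t phi).

Definition Pi_op (phi : dual H) : H :=
  of_bidual (fun psi => Cintegral 0 T (fun t => psi (Lambda_op t phi))).

Definition Kdom : set H := Pi_op @` ldom (adjoint A).

(* The partial inverse of Pi_op is its inverse, Pi_op being bijective in the
   situations of interest. *)
Definition Kfun (x : H) : U :=
  - ((T * C1 * expR (alpha * T))%:C *:
     riesz (dapp (predual_adj B) ('pinv_(fun=> 0) setT Pi_op x))).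

End Gramian.

(* K is only considered on its domain D *)
Definition stabilizing_feedback (D : set H) (K : H -> U) (omega : R) : Prop :=
  0 < omega /\
  exists (SS : R -> bop H H) (AA : lop H) (KK : bop (dom AA) U),
    [/\ C0_semigroup SS, semigroup_generator SS AA, ldom AA = D &
        forall x : dom AA, KK x = K (dval x)] /\
    [/\ exists2 C : R, 1 <= C &
          forall t : R, 0 <= t -> nrm (SS t) <= C * expR (- (omega * t)),
        forall x : dom AA, dom_embed A (lfun AA (dval x)) =
          lop_ext A (dval x) + B (KK x) &
        exists2 C' : R, 0 <= C' & forall x : dom AA,
          (sqL2norm `[0%R, +oo[ (fun t => dapp KK (SS t (dval x)))
             <= ((C' * nrm (dval x)) ^+ 2)%:E)%E].

End Control.

(* Main.v *)
Require Import Defs.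
Set Warnings "-notation-overridden,-notation-incompatible-prefix,-ambiguous-paths,-redundant-canonical-projection,-projection-no-head-constant".
From mathcomp Require Import all_boot all_order all_algebra.
From mathcomp Require Import sesquilinear complex ring lra.
From mathcomp Require Import all_classical all_reals all_analysis.
From mathcomp Require Import measurable_realfun.
Set Implicit Arguments.
Unset Strict Implicit.
Unset Printing Implicit Defensive.
Import Order.TTheory GRing.Theory Num.Theory.
Import numFieldTopology.Exports numFieldNormedType.Exports.
Local Open Scope classical_set_scope.
Local Open Scope complex_scope.
Local Open Scope ring_scope.

(** The proof follows a weighted Gramian. Put [beta = alpha - eps] and
    [c = C1 * expR (alpha * T)], and let [q t] be the hermitian form of the
    operator of index [t], so that the form of [Pi] is the integral of [q] over
    [0, T].

    Coercivity. The observability inequality for the state [S^* (- t) phi],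
    multiplied by [expR (eps * t)], says that [q t phi phi] is at least
    [expR (eps * t) * |phi|^2] ([Lambda_ge]). Integrating, [Pi] is coercive
    ([Pi_ge]), and a minimisation argument ([variational], [form_op_surj]) makes
    it a conjugate-linear isomorphism of the dual onto [H].

    Riccati equation. For [phi], [psi] in the domain of [A^*], the substitution
    of [r - t] for the time variable writes
    [expR (beta * r) * Pi (S^* r phi, S^* r psi)] with primitives of continuous
    functions of [r]. Its derivative at [r = 0] is, on the one hand, given by the
    generator and, on the other hand, computed from the primitives; hence
    ([riccati])

      [Pi (A^* phi, psi) + Pi (phi, A^* psi) + beta * Pi (phi, psi)
         = c * T * <B^* phi, B^* psi> + C2 * <phi, psi> - q T phi psi].

    Closed loop. By the Riccati equation, [A + B K] is, on the image by [Pi] of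
    the domain of [A^*], the conjugate by [Pi] of [- A^* - beta] plus the bounded
    operator [(C2 J2 - Lambda T) Pi^-1] ([closed_equation]). The conjugate by [Pi] of
    [expR (- beta * t) * S^* (- t)] is a group, and adding a bounded operator to
    its generator gives a semigroup whose generator keeps the domain
    ([perturbed_generator], [closed_generator]).

    Decay. Along an orbit [x = Pi phi] the energy [E = Pi (phi, phi)] has the
    derivative
    [- beta * E - c * T * |B^* phi|^2 + C2 * |phi|^2 - q T phi phi], and the
    condition on [T] says that [C2 <= expR (eps * T)], so that the last two terms
    together are nonpositive ([dissipation]). The term [- beta * E] gives the
    decay rate [beta / 2] of the norm ([lyapunov_decay]), and integrating the term
    [- c * T * |B^* phi|^2] bounds the control in [L^2] ([lyapunov_L2]).

    The rest is what these steps presuppose: the adjoint group is strongly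
    continuous and generated by [A^*] ([adj_group_generator]), strongly
    continuous groups have bounded perturbations, and the observation
    [B^* S^*] extends to all states ([BS_extP]). *)

(** * Minimisation, duality and uniform boundedness in Hilbert spaces *)

Section ComplexNorm.
Context {R : realType}.
Implicit Types z w : R[i].

Lemma nrmCE z : nrm (z : R[i]^o) = Num.sqrt (complex.Re z ^+ 2 + complex.Im z ^+ 2).
Proof. by rewrite /nrm -[`|_|]/(`|z|) normc_def. Qed.

Lemma nrmCM z w : nrm (z * w : R[i]^o) = nrm (z : R[i]^o) * nrm (w : R[i]^o).
Proof. by rewrite (nrmZ z (w : R[i]^o)). Qed.

Lemma nrmC_real (a : R) : nrm (a%:C : R[i]^o) = `|a|.
Proof. by rewrite nrmCE /= expr0n addr0 sqrtr_sqr. Qed.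

Lemma nrmC_conj z : nrm (Num.conj z : R[i]^o) = nrm (z : R[i]^o).
Proof. by case: z => a b; rewrite !nrmCE /= sqrrN. Qed.

Lemma Re_le_nrm z : `|complex.Re z| <= nrm (z : R[i]^o).
Proof.
by rewrite nrmCE -sqrtr_sqr ler_sqrt ?addr_ge0 ?sqr_ge0// lerDl sqr_ge0.
Qed.

Lemma Im_le_nrm z : `|complex.Im z| <= nrm (z : R[i]^o).
Proof.
by rewrite nrmCE -sqrtr_sqr ler_sqrt ?addr_ge0 ?sqr_ge0// lerDr sqr_ge0.
Qed.

Lemma Re_add z w : complex.Re (z + w) = complex.Re z + complex.Re w.
Proof. by case: z; case: w. Qed.

Lemma Im_add z w : complex.Im (z + w) = complex.Im z + complex.Im w.
Proof. by case: z; case: w. Qed.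

Lemma Re_opp z : complex.Re (- z) = - complex.Re z.
Proof. by case: z. Qed.

Lemma Re_mul z w : complex.Re (z * w) =
  complex.Re z * complex.Re w - complex.Im z * complex.Im w.
Proof. by case: z; case: w. Qed.

Lemma Re_scale (a : R) z : complex.Re (a%:C * z) = a * complex.Re z.
Proof. by rewrite Re_mul /= mul0r subr0. Qed.

Lemma Re_conj z : complex.Re (Num.conj z) = complex.Re z.
Proof. by case: z. Qed.

Lemma Re_mulI z : complex.Re ('i * z) = - complex.Im z.
Proof. by rewrite Re_mul /= mul0r mul1r sub0r. Qed.

(** Rotating a complex number onto the real axis turns a bound on its modulus
    into bounds on real parts, for which integrals are monotone. *)
Lemma nrmC_le z (C : R) :
  (forall w, nrm (w : R[i]^o) = 1 -> complex.Re (w * z) <= C) ->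
  nrm (z : R[i]^o) <= C.
Proof.
move=> h; have [z0|z0] := eqVneq z 0.
  by have := h 1; rewrite z0 mulr0 (nrmC_real 1) normr1 nrm0 => /(_ erefl).
have nz : 0 < nrm (z : R[i]^o).
  by rewrite lt_neqAle nrm_ge0 andbT eq_sym; apply: contra_neq z0 => /nrm0_eq0.
have := h ((nrm (z : R[i]^o))^-1%:C * Num.conj z).
rewrite nrmCM nrmC_real nrmC_conj gtr0_norm ?invr_gt0// mulVf ?gt_eqF//.
move=> /(_ erefl); rewrite -mulrA Re_scale => hz; apply: le_trans hz.
rewrite ler_pdivlMl// nrmCE -expr2 sqr_sqrtr ?addr_ge0 ?sqr_ge0//.
by case: (z) => a b; rewrite /= mulNr opprK !expr2.
Qed.

Lemma complex_eq_Re z w :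
  complex.Re z = complex.Re w -> complex.Re ('i * z) = complex.Re ('i * w) ->
  z = w.
Proof.
by rewrite !Re_mulI; case: z; case: w => a b c d /= -> /oppr_inj ->.
Qed.

End ComplexNorm.

Section NrmConvergence.
Context {R : realType} {X : normedModType R[i]}.
Implicit Types x y : X.

Lemma nrmN x : nrm (- x) = nrm x. Proof. by rewrite /nrm normrN. Qed.

Lemma nrmB x y : nrm (x - y) <= nrm x + nrm y.
Proof. by rewrite -(nrmN y) nrmD. Qed.

Lemma nrm_sub x y : nrm (x - y) = nrm (y - x).
Proof. by rewrite -nrmN opprB. Qed.

Lemma nrmBD z x y : nrm (x - y) <= nrm (x - z) + nrm (z - y).
Proof. by rewrite -[x - y](subrKA z) nrmD. Qed.

Lemma nrm_dist x y : `|nrm x - nrm y| <= nrm (x - y).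
Proof.
rewrite ler_norml; apply/andP; split.
  rewrite lerNl opprB lerBlDr nrm_sub; have := nrmD (y - x) x.
  by rewrite subrK.
by rewrite lerBlDr; have := nrmD (x - y) y; rewrite subrK.
Qed.

Lemma nrmRZ (a : R) x : nrm (a%:C *: x) = `|a| * nrm x.
Proof. by rewrite nrmZ -(nrmC_real a). Qed.

Lemma nrm_small x : (forall e : R, 0 < e -> nrm x <= e) -> x = 0.
Proof.
move=> h; apply/nrm0_eq0/eqP; rewrite eq_le nrm_ge0 andbT.
by apply/ler_addgt0Pl => e e0; rewrite addr0 h.
Qed.

Lemma cvg_nrmP {T : Type} {F : set_system T} {FF : Filter F}
    (f : T -> X) (l : X) :
  f @ F --> l <-> forall e : R, 0 < e -> \forall t \near F, nrm (f t - l) < e.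
Proof.
rewrite cvgrPdist_lt; split=> h e e0.
  have : (0 : R[i]) < e%:C by rewrite ltcR.
  move/h; apply: filterS => t; rewrite -nrmE ltcR.
  by rewrite nrm_sub.
case: e e0 => a b; rewrite ltcE /= => /andP[/eqP-> a0].
have := h _ a0; apply: filterS => t; rewrite nrm_sub => ta.
by rewrite -nrmE (_ : a +i* 0 = a%:C)// ltcR.
Qed.

End NrmConvergence.

Section Completeness.
Context {R : realType}.

(** Completeness in the only form used below: increments dominated by a
    geometric sequence force convergence, at a geometric rate.  A dual inherits it
    from the space through the isometry [riesz]. *)
Definition geo_complete (X : normedModType R[i]) : Prop :=
  forall (u : nat -> X) (C : R), (forall n, nrm (u n.+1 - u n) <= C * 2^-1 ^+ n) ->
  exists l, forall n, nrm (u n - l) <= 2 * C * 2^-1 ^+ n.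

Lemma halfpow_cvg (C : R) : C * 2^-1 ^+ n @[n --> \oo] --> (0 : R).
Proof.
rewrite -[0](mulr0 C); apply: cvgM; first exact: cvg_cst.
by apply: cvg_expr; rewrite ger0_norm ?invr_ge0// invf_lt1// ltr1n.
Qed.

Lemma halfpow_lt (C e : R) : 0 < e -> \forall n \near \oo, C * 2^-1 ^+ n < e.
Proof.
move=> e0; have /cvgrPdist_lt/(_ e e0) := halfpow_cvg C.
apply: filterS => n; rewrite sub0r normrN; exact: le_lt_trans (ler_norm _).
Qed.

Lemma geo_sum (X : normedModType R[i]) (u : nat -> X) (C : R) :
  (forall n, nrm (u n.+1 - u n) <= C * 2^-1 ^+ n) ->
  forall n k, nrm (u (n + k)%N - u n) <= 2 * C * 2^-1 ^+ n * (1 - 2^-1 ^+ k).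
Proof.
move=> h n; elim=> [|k IH]; first by rewrite addn0 subrr nrm0 expr0 subrr mulr0.
rewrite addnS (le_trans (nrmBD (u (n + k)%N) _ _))//.
rewrite (le_trans (lerD (h _) IH))// exprD exprS.
set p := _ ^+ n; set q := _ ^+ k.
by rewrite le_eqVlt; apply/orP; left; apply/eqP; field.
Qed.

Lemma hilbert_geo_complete (X : completeNormedModType R[i]) : geo_complete X.
Proof.
move=> u C h.
have C0 : 0 <= C.
  by have := h 0%N; rewrite expr0 mulr1; apply: le_trans; exact: nrm_ge0.
have hs n k : nrm (u (n + k)%N - u n) <= 2 * C * 2^-1 ^+ n.
  rewrite (le_trans (geo_sum h n k))// ler_piMr ?mulr_ge0 ?exprn_ge0//.
have : cvg (u @ \oo).
  apply/cauchy_cvgP/cauchy_exP => e.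
  case: e => a b; rewrite ltcE /= => /andP[/eqP-> a0].
  have [N _ hN] := halfpow_lt (2 * C) a0.
  exists (u N), N => // n /= Nn; rewrite -ball_normE /= -nrmE.
  rewrite (_ : a +i* 0 = a%:C)// ltcR nrm_sub.
  by rewrite -(subnKC Nn) (le_lt_trans (hs _ _))// hN /=.
move=> /cvg_ex[l ul]; exists l => n.
apply/ler_addgt0Pr => e e0.
have /cvg_nrmP/(_ e e0)[N _ hN] := ul.
rewrite (le_trans (nrmBD (u (n + N)%N) _ _))// lerD//.
  by rewrite nrm_sub hs.
by rewrite ltW// hN //= leq_addl.
Qed.

End Completeness.

Section Variational.
Context {R : realType} {X : normedModType R[i]}.
Variables (M : set X) (b : X -> X -> R) (l : X -> R) (c C K : R).
Hypothesis cX : geo_complete X.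
Hypothesis M0 : M 0.
Hypothesis Mlin : forall (a : R) x y, M x -> M y -> M (a%:C *: x + y).
Hypothesis bC : forall x y, b x y = b y x.
Hypothesis blin : forall (a : R) x y z, b (a%:C *: x + y) z = a * b x z + b y z.
Hypothesis llin : forall (a : R) x y, l (a%:C *: x + y) = a * l x + l y.
Hypothesis c0 : 0 < c.
Hypothesis bge : forall x, c * nrm x ^+ 2 <= b x x.
Hypothesis ble : forall x y, `|b x y| <= C * nrm x * nrm y.
Hypothesis lle : forall x, `|l x| <= K * nrm x.

Let J x := b x x - 2 * l x.

Let Jshift s d y : J (s%:C *: d + y) = J y + 2 * s * (b d y - l d) + s ^+ 2 * b d d.
Proof.
rewrite /J blin llin (bC d) (bC y) !blin (bC y d); ring.
Qed.

Let Jbound x : - (K ^+ 2 / c) <= J x.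
Proof.
have h1 := bge x; have h2 := le_trans (ler_norm _) (lle x).
have : 0 <= (c * nrm x - K) ^+ 2 by exact: sqr_ge0.
rewrite -mulNr ler_pdivrMr// /J => h3.
have : c * (c * nrm x ^+ 2) <= c * b x x by rewrite ler_pM2l.
have : c * l x <= c * (K * nrm x) by rewrite ler_pM2l.
nra.
Qed.

(** Minimising the quadratic functional [b x x - 2 * l x] over a subspace:
    the parallelogram identity makes a minimising sequence Cauchy, and the
    first variation at the limit is the equation sought.  Taking for [b] the
    inner product gives the Riesz theorem and orthogonal projections; taking
    for [b] a coercive form gives its invertibility. *)
Lemma variational : exists u,
  (forall e : R, 0 < e -> exists m, M m /\ nrm (u - m) < e) /\
  forall v, M v -> l v = b v u.
Proof.
have hJ : has_inf [set J x | x in M].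
  split; first by exists (J 0), 0.
  by exists (- (K ^+ 2 / c)) => _ [x _ <-].
pose m := inf [set J x | x in M]; pose h n : R := 2^-1 ^+ n.
have h0 n : 0 < h n by rewrite exprn_gt0.
have mJ x : M x -> m <= J x by move=> Mx; apply: ge_inf hJ.2 _ _; exists x.
(* Two terms within [c / 4 * 2^(-2n)] of the infimum are at distance at most
   [2^-n], by comparing the infimum with the value at their midpoint. *)
have ex n : exists x, M x /\ J x <= m + c / 4 * h n ^+ 2.
  have e0 : 0 < c / 4 * h n ^+ 2 by rewrite mulr_gt0 ?exprn_gt0// divr_gt0.
  by have [_ [x Mx <-] Jx] := inf_adherent e0 hJ; exists x; split=> //; rewrite ltW.
pose x n := projT1 (cid (ex n)).
have Mx n : M (x n) by rewrite /x; case: cid => ? [].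
have Jx n : J (x n) <= m + c / 4 * h n ^+ 2 by rewrite /x; case: cid => ? [].
have xS n : nrm (x n.+1 - x n) <= 1 * 2^-1 ^+ n.
  rewrite mul1r -[leLHS]ger0_norm ?nrm_ge0// -[leRHS]ger0_norm ?exprn_ge0//.
  rewrite -ler_sqr ?nnegrE ?normr_ge0//.
  set d := x n.+1 - x n.
  have Md : M d.
    by have := Mlin (-1) (Mx n) (Mx n.+1); rewrite rmorphN1 scaleN1r addrC.
  have e1 := Jshift 1 d (x n); have e2 := Jshift 2^-1 d (x n).
  have h1 := mJ _ (Mlin 2^-1 Md (Mx n)).
  rewrite rmorph1 scale1r subrK in e1.
  have h2 := Jx n; have h3 := Jx n.+1; have h4 := bge d.
  have h5 : h n.+1 = h n / 2 by rewrite /h exprS mulrC.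
  rewrite h5 in h3; rewrite -/(h n).
  have h6 : c * nrm d ^+ 2 <= c * h n ^+ 2.
    have h7 : 0 <= c * h n ^+ 2 by rewrite mulr_ge0 ?sqr_ge0// ltW.
    by lra.
  by rewrite !ger0_norm ?nrm_ge0 ?(ltW (h0 n))// -(ler_pM2l c0).
have [u ux] := cX xS; exists u; split.
  move=> e e0; have [N _ hN] := halfpow_lt (2 * 1) e0.
  by exists (x N); split=> //; rewrite nrm_sub (le_lt_trans (ux N))// hN /=.
move=> v Mv; apply/eqP; rewrite -subr_eq0 -normr_eq0 eq_le normr_ge0 andbT.
have C0 : `|C| >= 0 by [].
pose L := 2 * `|C| * nrm v + (`|b v v| + c).
suff key n : `|l v - b v u| <= L * 2^-1 ^+ n.
  apply/ler_addgt0Pl => e e0; rewrite addr0.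
  have [N _ hN] := halfpow_lt L e0.
  by rewrite (le_trans (key N))// ltW// hN /=.
rewrite -/(h n).
have d1 : `|b v (x n) - b v u| <= 2 * `|C| * nrm v * h n.
  have -> : b v (x n) - b v u = b v (x n - u).
    have := blin (-1) u (x n) v; rewrite rmorphN1 scaleN1r addrC mulN1r.
    by rewrite [LHS]bC => ->; rewrite (bC u) (bC (x n)) addrC.
  rewrite (le_trans (ble _ _))//.
  have := ux n; rewrite mulr1 -/(h n) => hu.
  rewrite (@le_trans _ _ (`|C| * nrm v * nrm (x n - u)))//.
    by rewrite !ler_wpM2r ?nrm_ge0// ler_norm.
  rewrite (le_trans (ler_wpM2l _ hu)) ?mulr_ge0 ?nrm_ge0//.
  by rewrite le_eqVlt; apply/orP; left; apply/eqP; ring.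
(* Moving from [x n] by [h n] or by [- h n] in the direction [v] cannot go below
   the infimum, which bounds the first variation by a multiple of [h n]. *)
have d2 : `|b v (x n) - l v| <= (`|b v v| + c) * h n.
  have var s : 0 <= 2 * s * (b v (x n) - l v) + s ^+ 2 * b v v + c / 4 * h n ^+ 2.
    have := mJ _ (Mlin s Mv (Mx n)); rewrite Jshift => h1.
    by have := Jx n; lra.
  have v1 := var (h n); have v2 := var (- h n).
  have h1 : h n ^+ 2 * b v v <= h n ^+ 2 * `|b v v|.
    by rewrite ler_wpM2l ?sqr_ge0// ler_norm.
  have ch : 0 <= c * h n ^+ 2 by rewrite mulr_ge0 ?sqr_ge0// ltW.
  have vv : 0 <= h n ^+ 2 * `|b v v| by rewrite mulr_ge0 ?sqr_ge0.
  rewrite -(ler_pM2l (h0 n)) -{1}(gtr0_norm (h0 n)) -normrM ler_norml.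
  by apply/andP; split; nra.
have -> : l v - b v u = (b v (x n) - b v u) - (b v (x n) - l v) by ring.
by rewrite (le_trans (ler_normB _ _))// mulrDl lerD.
Qed.

End Variational.

Section HilbertSpace.
Context {R : realType} {H : hilbertType R}.
Implicit Types (x y z : H) (f g : dual H).

Lemma hdotC x y : hdot x y = Num.conj (hdot y x).
Proof. by rewrite hermC expr0 mul1r. Qed.

Lemma hdotPl (a : R[i]) x y z : hdot (a *: x + y) z = a * hdot x z + hdot y z.
Proof. by rewrite linearPl. Qed.

Lemma hdotDr x y z : hdot x (y + z) = hdot x y + hdot x z.
Proof. by rewrite linearDr. Qed.

Lemma hdotZr (a : R[i]) x y : hdot x (a *: y) = Num.conj a * hdot x y.
Proof. by rewrite linearZr. Qed.

Definition rdot x y : R := complex.Re (hdot x y).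

Lemma rdotC x y : rdot x y = rdot y x.
Proof. by rewrite /rdot hdotC Re_conj. Qed.

Lemma rdotPl (a : R) x y z : rdot (a%:C *: x + y) z = a * rdot x z + rdot y z.
Proof. by rewrite /rdot hdotPl Re_add Re_scale. Qed.

Lemma rdotxx x : rdot x x = nrm x ^+ 2.
Proof. by rewrite /rdot -hdot_norm -nrmE -rmorphXn. Qed.

Lemma nrm_sqrD (a : R) x y :
  nrm (a%:C *: x + y) ^+ 2 = a ^+ 2 * nrm x ^+ 2 + 2 * a * rdot x y + nrm y ^+ 2.
Proof.
by rewrite -!rdotxx rdotPl (rdotC x) (rdotC y) !rdotPl (rdotC y x); ring.
Qed.

Lemma rdot_le x y : rdot x y <= nrm x * nrm y.
Proof.
have [->|x0] := eqVneq x 0; first by rewrite /rdot linear0l nrm0 mul0r.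
have nx : 0 < nrm x.
  by rewrite lt_neqAle nrm_ge0 andbT eq_sym; apply: contra_neq x0 => /nrm0_eq0.
have := sqr_ge0 (nrm ((- (nrm y / nrm x))%:C *: x + y)).
rewrite nrm_sqrD sqrrN => h.
have : 0 <= 2 * (nrm y ^+ 2) - 2 * (nrm y / nrm x) * rdot x y.
  have e : (nrm y / nrm x) ^+ 2 * nrm x ^+ 2 = nrm y ^+ 2.
    by field; rewrite gt_eqF.
  by rewrite e in h; lra.
have [->|y0] := eqVneq y 0; first by move=> _; rewrite rdotC /rdot linear0l nrm0 mulr0.
have ny : 0 < nrm y.
  by rewrite lt_neqAle nrm_ge0 andbT eq_sym; apply: contra_neq y0 => /nrm0_eq0.
have -> : 2 * nrm y ^+ 2 - 2 * (nrm y / nrm x) * rdot x y =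
   (2 * nrm y / nrm x) * (nrm x * nrm y - rdot x y) by field; rewrite gt_eqF.
by rewrite pmulr_rge0 ?subr_ge0// divr_gt0// mulr_gt0.
Qed.

Lemma nrm_hdot x y : nrm (hdot x y : R[i]^o) <= nrm x * nrm y.
Proof.
apply: nrmC_le => w w1; have := rdot_le (w *: x) y.
by rewrite /rdot linearZl_LR nrmZ -/(nrm (w : R[i]^o)) w1 mul1r.
Qed.

Lemma hdot_inj x y : (forall z, hdot z x = hdot z y) -> x = y.
Proof.
move=> xy; apply/eqP; rewrite -subr_eq0; apply/eqP/nrm0_eq0/eqP.
rewrite -sqrf_eq0 -rdotxx /rdot.
suff -> : hdot (x - y) (x - y) = 0 by [].
by rewrite -{2}(scaleN1r y) hdotDr hdotZr xy rmorphN1 mulN1r subrr.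
Qed.

Lemma dual_flat_subproof y : (fun x => hdot x y) \in @bounded_linear R H R[i]^o.
Proof.
apply: is_bounded_linear_bop; split=> [a u v|]; first exact: hdotPl.
by exists (nrm y) => x; rewrite mulrC nrm_hdot.
Qed.

(** The antilinear isometry from a Hilbert space onto its dual, inverse to
    [riesz]. *)
Definition flat y : dual H := Bop (dual_flat_subproof y).

Lemma rieszP f x : f x = hdot x (riesz f).
Proof.
suff [u hu] : exists u, forall v, f v = hdot v u.
  have h : [set u | forall v, f v = hdot v u] (riesz f).
    by apply: (@xgetPex _ 0 [set u | forall v, f v = hdot v u]); exists u.
  exact: h.
have [||||||||u [_ hu]] := @variational R H setT rdot (fun x => complex.Re (f x))
    1 1 (nrm f) (@hilbert_geo_complete _ _) I.
- by [].
- exact: rdotC.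
- exact: rdotPl.
- by move=> a v w; rewrite linearP Re_add Re_scale.
- exact: ltr01.
- by move=> v; rewrite mul1r rdotxx.
- by move=> v w; rewrite mul1r (le_trans (Re_le_nrm _))// nrm_hdot.
- by move=> v; rewrite (le_trans (Re_le_nrm _))// nrm_bop.
exists u => v; apply: complex_eq_Re; first exact: hu.
have := hu ('i *: v) I.
by rewrite linearZ /rdot linearZl_LR.
Qed.

Lemma flatK y : riesz (flat y) = y.
Proof. by apply: hdot_inj => z; rewrite -rieszP. Qed.

Lemma rieszK f : flat (riesz f) = f.
Proof. by apply: bop_ext => x; rewrite /= -rieszP. Qed.

Lemma riesz_lin (a : R[i]) f g :
  riesz (a *: f + g) = Num.conj a *: riesz f + riesz g.
Proof.
apply: hdot_inj => z.
by rewrite -rieszP bopDE bopZE hdotDr hdotZr conjCK !rieszP.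
Qed.

Lemma nrm_riesz f : nrm (riesz f) = nrm f.
Proof.
apply/eqP; rewrite eq_le; apply/andP; split.
  have [->|x0] := eqVneq (riesz f) 0; first by rewrite nrm0 nrm_ge0.
  have nx : 0 < nrm (riesz f).
    by rewrite lt_neqAle nrm_ge0 andbT eq_sym; apply: contra_neq x0 => /nrm0_eq0.
  rewrite -(ler_pM2r nx) -expr2 -rdotxx /rdot -rieszP.
  by rewrite (le_trans (ler_norm _))// (le_trans (Re_le_nrm _))// nrm_bop.
rewrite nrm_opnorm opnorm_le ?nrm_ge0// => x.
by rewrite rieszP mulrC nrm_hdot.
Qed.

Lemma rieszB f g : riesz (f - g) = riesz f - riesz g.
Proof.
by have := riesz_lin (-1) g f; rewrite rmorphN1 !scaleN1r addrC => ->; rewrite addrC.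
Qed.

(** The inner product of the dual space, linear in its second argument. *)
Definition ddot f g : R[i] := g (riesz f).

Lemma ddotE f g : ddot f g = hdot (riesz f) (riesz g).
Proof. by rewrite /ddot rieszP. Qed.

Lemma ddotC f g : ddot f g = Num.conj (ddot g f).
Proof. by rewrite !ddotE hdotC. Qed.

Lemma ddotxx f : complex.Re (ddot f f) = nrm f ^+ 2.
Proof. by rewrite ddotE -/(rdot _ _) rdotxx nrm_riesz. Qed.

Lemma ddotPr (a : R[i]) f g h : ddot f (a *: g + h) = a * ddot f g + ddot f h.
Proof. by []. Qed.

Lemma nrm_ddot f g : nrm (ddot f g : R[i]^o) <= nrm f * nrm g.
Proof. by rewrite ddotE (le_trans (nrm_hdot _ _))// !nrm_riesz. Qed.

Lemma flat_lin (a : R[i]) x y : flat (a *: x + y) = Num.conj a *: flat x + flat y.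
Proof. by apply: bop_ext => z; rewrite bopDE bopZE /= hdotDr hdotZr. Qed.

Lemma nrm_flat x : nrm (flat x) = nrm x.
Proof. by rewrite -nrm_riesz flatK. Qed.

Lemma dual_geo_complete : geo_complete (dual H).
Proof.
move=> u C h.
have [n|l hl] := @hilbert_geo_complete R H (fun n => riesz (u n)) C.
  by rewrite -rieszB nrm_riesz h.
by exists (flat l) => n; rewrite -nrm_riesz rieszB flatK hl.
Qed.

(** A Hilbert space is reflexive: representing [x |-> conj (F (flat x))]. *)
Lemma of_bidualP (F : dual H -> R[i]) :
  (forall (a : R[i]) f g, F (a *: f + g) = a * F f + F g) ->
  (exists M : R, forall f, nrm (F f : R[i]^o) <= M * nrm f) ->
  forall f, f (of_bidual F) = F f.
Proof.
move=> Flin [M FM].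
have FB : (fun x => Num.conj (F (flat x))) \in @bounded_linear R H R[i]^o.
  apply: is_bounded_linear_bop; split=> [a u v|].
    by rewrite flat_lin Flin rmorphD rmorphM /= conjCK.
  by exists M => x; rewrite nrmC_conj -(nrm_flat x).
suff ex : exists x, forall f : dual H, f x = F f.
  exact: (@xgetPex _ 0 [set x | forall f : dual H, f x = F f] ex).
exists (riesz (Bop FB)) => f.
rewrite -{1}(rieszK f) /= hdotC -rieszP /= conjCK rieszK //.
Qed.

Lemma dual_sep x y : (forall f : dual H, f x = f y) -> x = y.
Proof.
by move=> h; apply: hdot_inj => z; rewrite hdotC [RHS]hdotC; have /= -> := h (flat z).
Qed.

Lemma nrm_dual_le x (C : R) : 0 <= C ->
  (forall f : dual H, nrm (f x) <= C * nrm f) -> nrm x <= C.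
Proof.
move=> C0 h; have [->|x0] := eqVneq x 0; first by rewrite nrm0.
have nx : 0 < nrm x.
  by rewrite lt_neqAle nrm_ge0 andbT eq_sym; apply: contra_neq x0 => /nrm0_eq0.
rewrite -(ler_pM2r nx) -expr2 -rdotxx -(nrm_flat x).
by rewrite (le_trans _ (h _))//= (le_trans (ler_norm _))// Re_le_nrm.
Qed.

(** Minimising the distance to [f] gives a limit of elements of [M] whose
    difference from [f] is orthogonal to [M]; read as a vector of [H] through
    [riesz], this difference is annihilated by [M]. *)
Lemma dual_dense (M : set (dual H)) :
  M 0 -> (forall (a : R[i]) f g, M f -> M g -> M (a *: f + g)) ->
  (forall x, (forall f, M f -> f x = 0) -> x = 0) ->
  forall f (e : R), 0 < e -> exists g, M g /\ nrm (f - g) < e.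
Proof.
move=> M0 Mlin Msep f.
have [||||||||u [uM hu]] := @variational R (dual H) M
    (fun g h => complex.Re (ddot g h)) (fun g => complex.Re (ddot f g)) 1 1
    (nrm f) dual_geo_complete M0.
- by move=> a x y; exact: Mlin.
- by move=> x y; rewrite ddotC Re_conj.
- by move=> a x y z; rewrite ddotC Re_conj ddotPr Re_add Re_scale (ddotC x) (ddotC y) !Re_conj.
- by move=> a x y; rewrite ddotPr Re_add Re_scale.
- exact: ltr01.
- by move=> x; rewrite mul1r ddotxx.
- by move=> x y; rewrite mul1r (le_trans (Re_le_nrm _))// nrm_ddot.
- by move=> x; rewrite (le_trans (Re_le_nrm _))// nrm_ddot.
suff -> : f = u by [].
suff : riesz f - riesz u = 0.
  by move=> /subr0_eq h; rewrite -(rieszK f) h rieszK.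
apply: Msep => g Mg; rewrite linearB /=.
have e0 h : M h -> complex.Re (h (riesz f)) = complex.Re (h (riesz u)).
  by move=> Mh; have := hu _ Mh; rewrite [in RHS]ddotC Re_conj /ddot.
apply/eqP; rewrite subr_eq0; apply/eqP.
apply: complex_eq_Re; first exact: e0.
have := e0 ('i *: g); rewrite !bopZE; apply.
by rewrite -[_ *: _]addr0; apply: Mlin.
Qed.

End HilbertSpace.

Section UniformBoundedness.
Context {R : realType} {X : completeNormedModType R[i]} {Y : normedModType R[i]}.

(** Either [x + r *: v] or [x - r *: v] will do, for [v] in the unit ball with
    [T v] of nearly maximal norm: the difference of their images is
    [2 * r *: T v]. *)
Let big_vector (T : bop X Y) (x : X) (r : R) : 0 < r ->
  exists y, nrm (y - x) <= r /\ r * opnorm T / 2 <= nrm (T y).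
Proof.
move=> r0.
have [v [v1 Tv]] : exists v, nrm v <= 1 /\ opnorm T / 2 <= nrm (T v).
  have [T0|T0] := eqVneq (opnorm T) 0.
    by exists 0; rewrite nrm0 T0 mul0r nrm_ge0.
  have T20 : 0 < opnorm T / 2.
    by rewrite divr_gt0// lt_neqAle eq_sym T0 opnorm_ge0.
  have [_ [v /= v1 <-] hv] := sup_adherent T20 (has_sup_opnorm T).
  exists v; split=> //; apply: ltW; apply: le_lt_trans hv.
  by rewrite -/(opnorm T); lra.
have rv : nrm (r%:C *: v) <= r by rewrite nrmRZ gtr0_norm// ger_pMr.
have Trv : r * opnorm T / 2 <= nrm (T (r%:C *: v)).
  by rewrite linearZ nrmRZ gtr0_norm// -mulrA ler_pM2l.
have h : 2 * nrm (T (r%:C *: v)) <= nrm (T (x + r%:C *: v)) + nrm (T (x - r%:C *: v)).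
  rewrite linearB linearD /=.
  set a := T x; set d := T (r%:C *: v).
  have e : (a + d) - (a - d) = (2 : R)%:C *: d.
    by rewrite opprB addrC addrA subrK rmorph_nat scaler_nat mulr2n.
  by have := nrmB (a + d) (a - d); rewrite e nrmRZ gtr0_norm.
have [h1|h1] := leP (r * opnorm T / 2) (nrm (T (x + r%:C *: v))).
  by exists (x + r%:C *: v); rewrite addrC addKr.
exists (x - r%:C *: v); rewrite addrC addKr nrmN; split=> //; lra.
Qed.

(** The uniform boundedness principle, by the gliding hump: walk from one
    vector to the next by steps [4^-n], each step making the value of the next
    operator large, while all later steps together are too short to undo it. *)
Lemma gliding_hump (T : nat -> bop X Y) :
  (forall n, 16 ^+ n < opnorm (T n)) ->
  exists x, forall n, 4 ^+ n / 6 <= nrm (T n x).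
Proof.
move=> Tn; pose r n : R := 4^-1 ^+ n.
have r0 n : 0 < r n by rewrite exprn_gt0.
pose next n x := projT1 (cid (@big_vector (T n) x (r n) (r0 n))).
have next1 n x : nrm (next n x - x) <= r n by rewrite /next; case: cid => ? [].
have next2 n x : r n * opnorm (T n) / 2 <= nrm (T n (next n x)).
  by rewrite /next; case: cid => ? [].
pose x := fix x n := if n is m.+1 then next m (x m) else 0.
have xS n : nrm (x n.+1 - x n) <= 1 * 2^-1 ^+ n.
  rewrite mul1r (le_trans (next1 _ _))// /r lerXn2r ?nnegrE//.
  by rewrite lef_pV2 ?posrE// ler_nat.
have [l hl] := hilbert_geo_complete xS; exists l => n.
have tail k : nrm (x (n.+1 + k)%N - x n.+1) <= r n / 3 * (1 - 4^-1 ^+ k).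
  elim: k => [|k IH]; first by rewrite addn0 subrr nrm0 expr0 subrr mulr0.
  rewrite addnS (le_trans (nrmBD (x (n.+1 + k)%N) _ _))//.
  rewrite (le_trans (lerD (next1 _ _) IH))// /r exprD !exprS.
  set p := _ ^+ n; set q := _ ^+ k.
  by rewrite le_eqVlt; apply/orP; left; apply/eqP; field.
have lx : nrm (l - x n.+1) <= r n / 3.
  apply/ler_addgt0Pr => e e0.
  have [N _ hN] := halfpow_lt (2 * 1) e0.
  rewrite (le_trans (nrmBD (x (n.+1 + N)%N) _ _))// addrC lerD//.
    rewrite (le_trans (tail N))// ler_piMr ?divr_ge0 ?(ltW (r0 n))//.
  by rewrite nrm_sub (le_trans (hl _))// ltW// hN //= leq_addl.
have h1 : nrm (T n (x n.+1)) <= nrm (T n l) + opnorm (T n) * (r n / 3).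
  rewrite -[x n.+1](subKr l) linearB /= (le_trans (nrmB _ _))// lerD2l.
  by rewrite (le_trans (opnormP _ _))// ler_wpM2l ?opnorm_ge0.
have h2 := next2 n (x n).
have h3 : r n * 16 ^+ n = 4 ^+ n :> R.
  by rewrite /r -exprMn; congr (_ ^+ _); field.
have h4 : r n * 16 ^+ n <= r n * opnorm (T n) by rewrite ler_pM2l ?ltW.
have h5 : nrm (T n (next n (x n))) <= nrm (T n l) + opnorm (T n) * (r n / 3) by [].
by rewrite h3 in h4; lra.
Qed.

End UniformBoundedness.

(** * Integration of continuous curves *)

Section RealIntegral.
Context {R : realType}.
Implicit Types f g F : R -> R.
Notation mu := (@lebesgue_measure R).

Lemma continuous_integrable f (a b : R) : continuous f ->
  mu.-integrable `[a, b] (EFin \o f).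
Proof.
move=> cf; apply: continuous_compact_integrable; first exact: segment_compact.
exact: continuous_subspaceT.
Qed.

Lemma int_primitive F f (a b : R) : a <= b -> continuous f ->
  (forall x : R, is_derive x 1 F (f x)) ->
  \int[mu]_(t in `[a, b]) f t = F b - F a.
Proof.
move=> ab cf dF.
move: ab; rewrite le_eqVlt => /predU1P[<-|ab].
  by rewrite set_itv1 Rintegral_set1 subrr.
rewrite /Rintegral (@continuous_FTC2 _ f F)//.
- exact: continuous_subspaceT.
- have cF : continuous F.
    by move=> x; apply/differentiable_continuous/derivable1_diffP; have [] := dF x.
  split; first by move=> x _; have [] := dF x.
    by apply: cvg_at_right_filter; exact: cF.
  by apply: cvg_at_left_filter; exact: cF.
- by move=> x _; rewrite derive1E; have [_ ->] := dF x.
Qed.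

Lemma int_split f (a b c : R) : continuous f -> a <= b -> b <= c ->
  \int[mu]_(t in `[a, c]) f t =
  \int[mu]_(t in `[a, b]) f t + \int[mu]_(t in `[b, c]) f t.
Proof.
move=> cf ab bc.
have := @Rintegral_itvB R f (BLeft a) (BRight c) b (continuous_integrable a c cf).
rewrite !bnd_simp => /(_ ab bc) h.
have h' := @Rintegral_itv_obnd_cbnd R b (BRight c) f.
rewrite -h' -?h; first by rewrite addrC subrK.
by apply: integrableS (continuous_integrable b c cf) => //; exact: subset_itv_oc_cc.
Qed.

(** Integrals exist only over intervals oriented to the right; subtracting the
    integral over [[x, 0]] covers negative [x], and near a given point the
    result differs by a constant from an integral with a lower bound [N] far to
    the left. *)
Lemma continuous_primitive f : continuous f ->
  exists F, forall x : R, is_derive x 1 F (f x).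
Proof.
move=> cf.
pose F x := \int[mu]_(t in `[0, x]) f t - \int[mu]_(t in `[x, 0]) f t.
have FE (N x : R) : N < 0 -> N < x ->
    F x = \int[mu]_(t in `[N, x]) f t - \int[mu]_(t in `[N, 0]) f t.
  move=> N0 Nx; rewrite /F; have [x0|x0] := leP 0 x.
    rewrite (int_split cf (ltW N0) x0).
    have -> : \int[mu]_(t in `[x, 0]) f t = 0.
      move: x0; rewrite le_eqVlt => /predU1P[<-|x0]; last by rewrite set_itv_ge ?Rintegral_set0// bnd_simp -ltNge.
      by rewrite set_itv1 Rintegral_set1.
    by ring.
  rewrite (int_split cf (ltW Nx) (ltW x0)).
  by rewrite set_itv_ge ?Rintegral_set0 ?bnd_simp -?ltNge//; ring.
exists F => x; pose N : R := - `|x| - 1.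
have N0 : N < 0 by rewrite /N; have := normr_ge0 x; lra.
have Nx : N < x by rewrite /N; have := ler_norm (- x); rewrite normrN; lra.
have [d1 d2] := @continuous_FTC1_closed R f N x (x + 1) (ltr_pwDr ltr01 (lexx x))
  (continuous_integrable N (x + 1) cf) Nx (cf x).
pose G (y : R) : R := \int[mu]_(t in `[N, y]) f t.
pose k : R := \int[mu]_(t in `[N, 0]) f t.
have dG : is_derive x 1 G (f x) by rewrite derive1E in d2; exact: (DeriveDef d1 d2).
have dGk : is_derive x 1 (G - cst k) (f x).
  by have := @is_deriveB _ _ _ _ (cst k) x 1 _ 0 dG (is_derive_cst k x 1); rewrite subr0.
apply: (near_eq_is_derive _ dGk).
near=> y; rewrite (FE N)//; near: y; exact: lt_nbhsr.
Unshelve. all: by end_near. Qed.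

Lemma int_shift f (a b c : R) : continuous f -> a <= b ->
  \int[mu]_(t in `[(a + c), (b + c)]) f t = \int[mu]_(t in `[a, b]) f (t + c).
Proof.
move=> cf ab; have [F dF] := continuous_primitive cf.
have cfc : continuous (fun t => f (t + c)).
  move=> x; apply: (@continuous_comp _ _ _ (fun t => t + c) f); last exact: cf.
  by apply: cvgD => //; exact: cvg_cst.
have dFc (x : R) : is_derive x 1 (fun t => F (t + c)) (f (x + c)).
  have dc : is_derive x 1 (fun t : R => t + c) 1.
    by have := @is_deriveD _ _ _ id (cst c) x 1 1 0 _ _; rewrite addr0; apply.
  by have := @is_derive1_comp R F (fun t => t + c) x _ _ (dF (x + c)) dc; rewrite mulr1.
by rewrite (int_primitive ab cfc dFc) (int_primitive _ cf dF) ?lerD2r.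
Qed.

Lemma int_opp f (a b : R) : continuous f -> a <= b ->
  \int[mu]_(t in `[(- b), (- a)]) f t = \int[mu]_(t in `[a, b]) f (- t).
Proof.
move=> cf ab; rewrite /Rintegral integration_by_substitution_oppr//.
exact: continuous_subspaceT.
Qed.

Lemma int_le f g (a b : R) : continuous f -> continuous g ->
  (forall t, a <= t <= b -> f t <= g t) ->
  \int[mu]_(t in `[a, b]) f t <= \int[mu]_(t in `[a, b]) g t.
Proof.
move=> cf cg fg; apply: le_Rintegral => //; try exact: continuous_integrable.
Qed.

Lemma int_cst (a b k : R) : a <= b -> \int[mu]_(t in `[a, b]) k = k * (b - a).
Proof.
move=> ab; rewrite Rintegral_cst//; congr (_ * _).
apply: etrans (congr1 fine (lebesgue_measure_itv `[a, b])) _ => /=.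
by move: ab; rewrite lte_fin le_eqVlt => /predU1P[->|->//]; rewrite ltxx subrr.
Qed.

Lemma intD f g (a b : R) : continuous f -> continuous g ->
  \int[mu]_(t in `[a, b]) (f t + g t) =
  \int[mu]_(t in `[a, b]) f t + \int[mu]_(t in `[a, b]) g t.
Proof. by move=> cf cg; rewrite RintegralD//; exact: continuous_integrable. Qed.

Lemma intZ f (k a b : R) : continuous f ->
  \int[mu]_(t in `[a, b]) (k * f t) = k * \int[mu]_(t in `[a, b]) f t.
Proof. by move=> cf; rewrite RintegralZl//; exact: continuous_integrable. Qed.

Lemma int_empty f (a b : R) : b <= a -> \int[mu]_(t in `[a, b]) f t = 0.
Proof.
rewrite le_eqVlt => /predU1P[->|ba]; first by rewrite set_itv1 Rintegral_set1.
by rewrite set_itv_ge ?Rintegral_set0// bnd_simp -ltNge.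
Qed.

Lemma int_continuous f (a : R) : continuous f ->
  continuous (fun t => \int[mu]_(s in `[a, t]) f s).
Proof.
move=> cf; have [F dF] := continuous_primitive cf.
have cF : continuous F.
  by move=> x; apply/differentiable_continuous/derivable1_diffP; have [] := dF x.
have -> : (fun t => \int[mu]_(s in `[a, t]) f s) = (fun t => F (Num.max a t) - F a).
  apply/funext => t; have [ta|ta] := leP a t; first by rewrite (int_primitive ta cf dF).
  by rewrite int_empty ?subrr// ltW.
move=> t; apply: cvgB; last exact: cvg_cst.
apply: (@continuous_comp _ _ _ (fun t => Num.max a t) F); last exact: cF.
by apply: continuous_max; [exact: cst_continuous|exact: id].
Qed.

End RealIntegral.

Section ComplexIntegral.
Context {R : realType}.
Implicit Types f g : R -> R[i].
Notation mu := (@lebesgue_measure R).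

Let integrableD_real (a b : R) (f g : R -> R) :
  mu.-integrable `[a, b] (EFin \o f) -> mu.-integrable `[a, b] (EFin \o g) ->
  mu.-integrable `[a, b] (EFin \o (fun t => f t + g t)).
Proof.
move=> fi gi; have -> : EFin \o (fun t => f t + g t) = ((EFin \o f) \+ (EFin \o g))%E.
  by apply/funext => t; rewrite /= EFinD.
exact: integrableD.
Qed.

Let integrableZ_real (a b k : R) (f : R -> R) :
  mu.-integrable `[a, b] (EFin \o f) ->
  mu.-integrable `[a, b] (EFin \o (fun t => k * f t)).
Proof.
move=> fi; have -> : EFin \o (fun t => k * f t) = (fun t => k%:E * (EFin \o f) t)%E.
  by apply/funext => t; rewrite /= EFinM.
exact: integrableZl.
Qed.

Let ReMD (w z u : R[i]) : complex.Re (w * z + u) =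
  complex.Re w * complex.Re z + ((- complex.Im w) * complex.Im z + complex.Re u).
Proof. by rewrite Re_add Re_mul addrA mulNr. Qed.

Let ImMD (w z u : R[i]) : complex.Im (w * z + u) =
  complex.Re w * complex.Im z + (complex.Im w * complex.Re z + complex.Im u).
Proof. by case: w z u => ? ? [? ?] [? ?]; rewrite /= -addrA. Qed.

Definition cintegrable (a b : R) g : Prop :=
  mu.-integrable `[a, b] (EFin \o (fun t => complex.Re (g t))) /\
  mu.-integrable `[a, b] (EFin \o (fun t => complex.Im (g t))).

Definition ccont g : Prop :=
  continuous (fun t => complex.Re (g t)) /\ continuous (fun t => complex.Im (g t)).

Lemma ccont_integrable (a b : R) g : ccont g -> cintegrable a b g.
Proof. by case=> ? ?; split; exact: continuous_integrable. Qed.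

Lemma cintegrable_lin (a b : R) (w : R[i]) f g :
  cintegrable a b f -> cintegrable a b g ->
  cintegrable a b (fun t => w * f t + g t).
Proof.
move=> [f1 f2] [g1 g2]; split.
  under [X in EFin \o X]funext do rewrite ReMD.
  by do 2 (apply: integrableD_real; first exact: integrableZ_real).
under [X in EFin \o X]funext do rewrite ImMD.
by do 2 (apply: integrableD_real; first exact: integrableZ_real).
Qed.

Lemma Cintegral_lin (a b : R) (w : R[i]) f g :
  cintegrable a b f -> cintegrable a b g ->
  Cintegral a b (fun t => w * f t + g t) = w * Cintegral a b f + Cintegral a b g.
Proof.
move=> [f1 f2] [g1 g2].
apply/eqP; rewrite eq_complex ReMD ImMD /Cintegral /=; apply/andP; split; apply/eqP.
  under eq_Rintegral do rewrite ReMD.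
  rewrite RintegralD ?RintegralZl//; last 2 first.
  - exact: integrableZ_real.
  - by apply: integrableD_real => //; exact: integrableZ_real.
  by rewrite RintegralD ?RintegralZl//; exact: integrableZ_real.
under eq_Rintegral do rewrite ImMD.
rewrite RintegralD ?RintegralZl//; last 2 first.
- exact: integrableZ_real.
- by apply: integrableD_real => //; exact: integrableZ_real.
by rewrite RintegralD ?RintegralZl//; exact: integrableZ_real.
Qed.

Lemma cintegrable0 (a b : R) : cintegrable a b (fun=> 0).
Proof. by split; exact: integrable0. Qed.

Lemma Cintegral0 (a b : R) : Cintegral a b (fun=> 0) = 0.
Proof.
rewrite /Cintegral /= (_ : \int[mu]_(t in `[a, b]) 0 = 0)//.
by rewrite /Rintegral integral0.
Qed.

Lemma CintegralZ (a b : R) (w : R[i]) f : cintegrable a b f ->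
  Cintegral a b (fun t => w * f t) = w * Cintegral a b f.
Proof.
move=> cf; have := Cintegral_lin w cf (cintegrable0 a b).
by rewrite Cintegral0 addr0 => <-; congr Cintegral; apply/funext => t; rewrite addr0.
Qed.

Lemma cintegrableZ (a b : R) (w : R[i]) f : cintegrable a b f ->
  cintegrable a b (fun t => w * f t).
Proof.
move=> cf; have := cintegrable_lin w cf (cintegrable0 a b).
by under [X in cintegrable a b X -> _]funext do rewrite addr0.
Qed.

Lemma nrm_Cintegral_le (a b : R) g (h : R -> R) :
  cintegrable a b g -> mu.-integrable `[a, b] (EFin \o h) ->
  (forall t, a <= t <= b -> nrm (g t : R[i]^o) <= h t) ->
  nrm (Cintegral a b g : R[i]^o) <= \int[mu]_(t in `[a, b]) h t.
Proof.
move=> ig ih gh; apply: nrmC_le => w w1; rewrite -CintegralZ//=.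
apply: le_Rintegral => //; first by case: (cintegrableZ w ig).
move=> t /=; rewrite in_itv/= => /gh; apply: le_trans.
by rewrite (le_trans (ler_norm _))// (le_trans (Re_le_nrm _))// nrmCM w1 mul1r.
Qed.

Lemma Cintegral_split g (a b c : R) : ccont g -> a <= b -> b <= c ->
  Cintegral a c g = Cintegral a b g + Cintegral b c g.
Proof.
move=> [g1 g2] ab bc; rewrite /Cintegral (int_split g1 ab bc) (int_split g2 ab bc).
by [].
Qed.

Lemma Cintegral_shift g (a b c : R) : ccont g -> a <= b ->
  Cintegral (a + c) (b + c) g = Cintegral a b (fun t => g (t + c)).
Proof. by move=> [g1 g2] ab; rewrite /Cintegral !int_shift. Qed.

Lemma Cintegral_empty g (a b : R) : b <= a -> Cintegral a b g = 0.
Proof. by move=> ab; rewrite /Cintegral !int_empty. Qed.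

End ComplexIntegral.

Section ContinuousCurves.
Context {R : realType} {X Y : normedModType R[i]}.
Implicit Types f g : R -> X.

Lemma continuous_nrmP f : continuous f <->
  forall (t e : R), 0 < e -> \forall s \near t, nrm (f s - f t) < e.
Proof.
split=> [h t e e0|h t]; first by have /cvg_nrmP := h t; apply.
by apply/cvg_nrmP => e e0; exact: h.
Qed.

Lemma cvg_bop {T : Type} {F : set_system T} {FF : Filter F} (K : bop X Y)
  (u : T -> X) x : u @ F --> x -> (fun t => K (u t)) @ F --> K x.
Proof.
move=> /cvg_nrmP ux; apply/cvg_nrmP => e e0.
have K1 : 0 < nrm K + 1 by rewrite ltr_wpDl// nrm_ge0.
have := ux (e / (nrm K + 1)); rewrite divr_gt0// => /(_ isT).
apply: filterS => t; rewrite ltr_pdivlMr// -linearB => h.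
rewrite (le_lt_trans (nrm_bop _ _))//; apply: le_lt_trans h.
by rewrite mulrC ler_wpM2l ?nrm_ge0// lerDl.
Qed.

Lemma cvg_nrm {T : Type} {F : set_system T} {FF : Filter F}
  (u : T -> X) x : u @ F --> x -> (fun t => nrm (u t)) @ F --> nrm x.
Proof.
move=> /cvg_nrmP ux; apply/cvgrPdist_lt => e e0.
have := ux e e0; apply: filterS => t; apply: le_lt_trans.
by rewrite distrC; exact: nrm_dist.
Qed.

Lemma continuous_bop (K : bop X Y) f : continuous f -> continuous (fun t => K (f t)).
Proof. by move=> cf t; apply: cvg_bop; exact: cf. Qed.

Lemma continuous_nrm f : continuous f -> continuous (fun t => nrm (f t)).
Proof. by move=> cf t; apply: cvg_nrm; exact: cf. Qed.

Lemma cvg_Re {T : Type} {F : set_system T} {FF : Filter F}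
  (u : T -> R[i]^o) (x : R[i]^o) : u @ F --> x ->
  (fun t => complex.Re (u t)) @ F --> complex.Re x.
Proof.
move=> /cvg_nrmP ux; apply/cvgrPdist_lt => e e0.
have := ux e e0; apply: filterS => t; apply: le_lt_trans.
by rewrite distrC -Re_opp -Re_add Re_le_nrm.
Qed.

Lemma cvg_Im {T : Type} {F : set_system T} {FF : Filter F}
  (u : T -> R[i]^o) (x : R[i]^o) : u @ F --> x ->
  (fun t => complex.Im (u t)) @ F --> complex.Im x.
Proof.
move=> /cvg_nrmP ux; apply/cvgrPdist_lt => e e0.
have := ux e e0; apply: filterS => t; apply: le_lt_trans.
rewrite distrC; set a := u t; rewrite (_ : complex.Im a - complex.Im x = complex.Im (a - x)).
  exact: Im_le_nrm.
by rewrite Im_add; case: (x).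
Qed.

Lemma continuous_ccont (g : R -> R[i]^o) : continuous g -> ccont g.
Proof. by move=> cg; split=> t; [apply: cvg_Re|apply: cvg_Im]; exact: cg. Qed.

End ContinuousCurves.

Arguments cvg_bop {R X Y T F FF} K [u x] _.

Lemma ccont_dual (R : realType) (X : normedModType R[i]) (psi : dual X) (f : R -> X) :
  continuous f -> ccont (fun t => psi (f t)).
Proof. by move=> cf; apply: continuous_ccont; exact: continuous_bop. Qed.

Lemma dual_lin (R : realType) (X : normedModType R[i]) (psi : dual X) (w : R[i]) (x y : X) :
  psi (w *: x + y) = w * psi x + psi y.
Proof. exact: (linearP psi). Qed.

Section WeakIntegral.
Context {R : realType} {H : hilbertType R}.
Implicit Types (f : R -> H) (psi : dual H).
Notation mu := (@lebesgue_measure R).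

(** The integral of a continuous curve in a Hilbert space, obtained from the
    scalar integrals by reflexivity. *)
Definition wint (a b : R) f : H := of_bidual (fun psi => Cintegral a b (fun t => psi (f t))).

Lemma wintP (a b : R) f psi : continuous f ->
  psi (wint a b f) = Cintegral a b (fun t => psi (f t)).
Proof.
move=> cf; apply: of_bidualP => [w p q|].
  under [in LHS]eq_fun do rewrite bopDE bopZE.
  by apply: Cintegral_lin; apply: ccont_integrable; exact: ccont_dual.
exists (\int[mu]_(t in `[a, b]) nrm (f t)) => p.
rewrite mulrC -intZ; last exact: continuous_nrm.
apply: nrm_Cintegral_le => [||t _].
- by apply: ccont_integrable; exact: ccont_dual.
- apply: continuous_integrable => t; apply: cvgM; first exact: cvg_cst.
  exact: continuous_nrm.
- exact: nrm_bop.
Qed.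

Lemma nrm_wint_le (a b : R) f (g : R -> R) : continuous f -> continuous g ->
  (forall t, a <= t <= b -> nrm (f t) <= g t) ->
  nrm (wint a b f) <= \int[mu]_(t in `[a, b]) g t.
Proof.
move=> cf cg fg; apply: nrm_dual_le => [|psi].
  apply: Rintegral_ge0 => t /=; rewrite in_itv/= => /fg; apply: le_trans.
  exact: nrm_ge0.
rewrite wintP// mulrC -intZ//; apply: nrm_Cintegral_le => [||t tab].
- by apply: ccont_integrable; exact: ccont_dual.
- by apply: continuous_integrable => t; apply: cvgM; [exact: cvg_cst|exact: cg].
- by rewrite (le_trans (nrm_bop _ _))// ler_wpM2l ?nrm_ge0 ?fg.
Qed.

Lemma wint_split f (a b c : R) : continuous f -> a <= b -> b <= c ->
  wint a c f = wint a b f + wint b c f.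
Proof.
move=> cf ab bc; apply: dual_sep => psi.
rewrite -[X in psi (X + _)]scale1r dual_lin mul1r !wintP//.
by rewrite (Cintegral_split (ccont_dual psi cf) ab bc).
Qed.

Lemma wint_shift f (a b c : R) : continuous f -> a <= b ->
  wint (a + c) (b + c) f = wint a b (fun t => f (t + c)).
Proof.
move=> cf ab; apply: dual_sep => psi; rewrite !wintP//; last first.
  move=> x; apply: (@continuous_comp _ _ _ (fun t => t + c) f); last exact: cf.
  by apply: cvgD => //; exact: cvg_cst.
by rewrite (Cintegral_shift _ (ccont_dual psi cf)).
Qed.

Lemma wint_empty f (a b : R) : b <= a -> wint a b f = 0.
Proof.
move=> ba; apply: dual_sep => psi; rewrite linear0.
rewrite /wint of_bidualP ?Cintegral_empty// => [w p q|].
  by rewrite !Cintegral_empty// mulr0 addr0.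
by exists 0 => p; rewrite Cintegral_empty// mul0r nrm0.
Qed.

Lemma wint_bop (K : bop H H) f (a b : R) : continuous f ->
  K (wint a b f) = wint a b (fun t => K (f t)).
Proof.
move=> cf; apply: dual_sep => psi.
rewrite -[LHS]/(badj K psi (wint a b f)) !wintP//.
exact: continuous_bop.
Qed.

Lemma wint_lin (w : R[i]) f g (a b : R) : continuous f -> continuous g ->
  wint a b (fun t => w *: f t + g t) = w *: wint a b f + wint a b g.
Proof.
move=> cf cg; apply: dual_sep => psi.
have cfg : continuous (fun t => w *: f t + g t).
  by move=> t; apply: cvgD; [apply: cvgZl_tmp; exact: cf|exact: cg].
rewrite dual_lin !wintP//.
under [in LHS]eq_fun do rewrite dual_lin.
have := @Cintegral_lin R a b w (fun t => psi (f t)) (fun t => psi (g t)).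
by apply; apply: ccont_integrable; exact: ccont_dual.
Qed.

Lemma wint_cst (x : H) (a b : R) : a <= b -> wint a b (fun=> x) = (b - a)%:C *: x.
Proof.
move=> ab; apply: dual_sep => psi; rewrite linearZ wintP; last exact: cst_continuous.
rewrite /Cintegral !int_cst//=; case: (psi x) => u v /=.
by apply/eqP; rewrite eq_complex /= !mul0r subr0 addr0 ![_ * (b - a)]mulrC !eqxx.
Qed.

Lemma wint_dist f (a s t : R) : continuous f ->
  nrm (wint a t f - wint a s f) <=
  `|\int[mu]_(r in `[a, t]) nrm (f r) - \int[mu]_(r in `[a, s]) nrm (f r)|.
Proof.
move=> cf; wlog st : s t / s <= t.
  move=> h; have [|/ltW] := leP s t; first exact: h.
  by move=> /h; rewrite nrm_sub distrC.
have cn := continuous_nrm cf.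
have [as_|sa] := leP a s.
  rewrite (wint_split cf as_ st) (int_split cn as_ st).
  rewrite addrAC subrr add0r [X in `|X|]addrAC subrr add0r.
  by rewrite (le_trans _ (ler_norm _))// nrm_wint_le.
rewrite (wint_empty f (ltW sa)) (int_empty _ (ltW sa)) !subr0.
by rewrite (le_trans _ (ler_norm _))// nrm_wint_le.
Qed.

Lemma wint_continuous f (a : R) : continuous f -> continuous (fun t => wint a t f).
Proof.
move=> cf; apply/continuous_nrmP => t e e0.
have /cvgrPdist_lt/(_ e e0) := @int_continuous R _ a (continuous_nrm cf) t.
apply: filterS => s; apply: le_lt_trans.
by rewrite distrC; exact: wint_dist.
Qed.

(** The mean of a continuous curve over a short interval is near its initial
    value, which is all the differentiation that the semigroups need. *)
Lemma wint_mean f (a h e : R) : continuous f -> 0 <= h ->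
  (forall t, a <= t <= a + h -> nrm (f t - f a) <= e) ->
  nrm (wint a (a + h) f - h%:C *: f a) <= h * e.
Proof.
move=> cf h0 fe.
have -> : wint a (a + h) f - h%:C *: f a = wint a (a + h) (fun t => f t - f a).
  have ah : a <= a + h by rewrite lerDl.
  have /(_ (@cst_continuous _ _ _) cf) e1 := @wint_lin (-1) (fun=> f a) f a (a + h).
  have -> : (fun t => f t - f a) = (fun t => -1 *: f a + f t).
    by apply/funext => t; rewrite scaleN1r addrC.
  by rewrite e1 wint_cst// scaleN1r addrC [a + h - a]addrAC subrr add0r.
have cfa : continuous (fun t => f t - f a).
  by move=> t; apply: cvgB; [exact: cf|exact: cvg_cst].
rewrite (le_trans (nrm_wint_le cfa _ fe))//; first exact: cst_continuous.
by rewrite int_cst ?lerDl// addrAC subrr add0r mulrC.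
Qed.

End WeakIntegral.

(** * Groups of operators and their bounded perturbations *)

Section BoundedOperators.
Context {R : realType} {X Y Z : normedModType R[i]}.

Lemma bop_lin (F : bop X Y) (a : R[i]) (x y : X) :
  F (a *: x + y) = a *: F x + F y.
Proof. exact: (linearP F). Qed.

Lemma bop_scale (F : bop X Y) (a : R[i]) (x : X) : F (a *: x) = a *: F x.
Proof. by rewrite -[a *: x]addr0 bop_lin linear0 addr0. Qed.

Lemma bop_add (F : bop X Y) (x y : X) : F (x + y) = F x + F y.
Proof. by rewrite -[x]scale1r bop_lin !scale1r. Qed.

Lemma bop_sub (F : bop X Y) (x y : X) :
  F (x - y) = F x - F y.
Proof. exact: (linearB F). Qed.

Lemma bop_comp_subproof (F : bop Y Z) (G : bop X Y) :
  (fun x => F (G x)) \in @bounded_linear R X Z.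
Proof.
apply: is_bounded_linear_bop; split=> [a u v|]; first by rewrite (linearP G) (linearP F).
exists (nrm F * nrm G) => x.
by rewrite (le_trans (nrm_bop _ _))// -mulrA ler_wpM2l ?nrm_ge0 ?nrm_bop.
Qed.

Definition bop_comp (F : bop Y Z) (G : bop X Y) :
  bop X Z := Bop (bop_comp_subproof F G).

End BoundedOperators.

Section StrongContinuity.
Context {R : realType} {H : normedModType R[i]}.
Implicit Types (T : R -> bop H H) (x : H).

Definition locally_bounded T : Prop :=
  forall tau : R, exists M : R, forall t x, `|t| <= tau -> nrm (T t x) <= M * nrm x.

Definition strongly_continuous T : Prop :=
  (forall x, continuous (fun t => T t x)) /\ locally_bounded T.

Lemma locally_bounded_gt0 T (tau : R) : locally_bounded T ->
  exists M : R, 0 < M /\ forall t x, `|t| <= tau -> nrm (T t x) <= M * nrm x.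
Proof.
move=> /(_ tau)[M hM]; exists (`|M| + 1); split; first by rewrite ltr_wpDl.
move=> t x /hM h; rewrite (le_trans (h x))// ler_wpM2r ?nrm_ge0//.
by rewrite (le_trans (ler_norm M))// lerDl.
Qed.

Lemma strongly_continuous_app T (f : R -> H) :
  strongly_continuous T -> continuous f -> continuous (fun t => T t (f t)).
Proof.
move=> [cT bT] cf; apply/continuous_nrmP => t e e0.
have [M [M0 hM]] := locally_bounded_gt0 (`|t| + 1) bT.
have e2 : 0 < e / 2 by rewrite divr_gt0.
have eM : 0 < e / 2 / M by rewrite divr_gt0.
have /continuous_nrmP/(_ t _ eM) h1 := cf.
have /continuous_nrmP/(_ t _ e2) h2 := cT (f t).
have h3 : \forall s \near t, `|s| <= `|t| + 1.
  have /cvgrPdist_lt/(_ 1 ltr01) : (@id R) s @[s --> t] --> t by [].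
  apply: filterS => s; rewrite distrC => h.
  by rewrite -[s](subrK t) (le_trans (ler_normD _ _))// addrC lerD2l ltW.
near=> s.
rewrite (le_lt_trans (nrmBD (T s (f t)) _ _))// [ltRHS]splitr.
rewrite ltr_leD//; last by apply: ltW; near: s.
rewrite -bop_sub (le_lt_trans (hM _ _ _))//; first by near: s.
by rewrite mulrC -ltr_pdivlMr//; near: s.
Unshelve. all: by end_near. Qed.

Lemma strongly_continuous_comp T1 T2 :
  strongly_continuous T1 -> strongly_continuous T2 ->
  strongly_continuous (fun t => bop_comp (T1 t) (T2 t)).
Proof.
move=> s1 s2; split=> [x|tau].
  exact: (@strongly_continuous_app T1 (fun t => T2 t x) s1 (s2.1 x)).
have [M1 [M10 h1]] := locally_bounded_gt0 tau s1.2.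
have [M2 [M20 h2]] := locally_bounded_gt0 tau s2.2.
exists (M1 * M2) => t x tt /=.
by rewrite (le_trans (h1 _ _ tt))// -mulrA ler_pM2l// h2.
Qed.

Lemma strongly_continuous_cst (P : bop H H) : strongly_continuous (fun=> P).
Proof.
split=> [x|tau]; first exact: cst_continuous.
by exists (nrm P) => t x _; exact: nrm_bop.
Qed.

Lemma strongly_continuous_opp T : strongly_continuous T ->
  strongly_continuous (fun t => T (- t)).
Proof.
move=> [cT bT]; split=> [x t|tau].
  apply: (@continuous_comp _ _ _ (fun t => - t) (fun t => T t x)); last exact: cT.
  exact: opp_continuous.
by have [M hM] := bT tau; exists M => t x ht; apply: hM; rewrite normrN.
Qed.

Lemma strongly_continuous_shift T (s : R) : strongly_continuous T ->
  strongly_continuous (fun t => T (t + s)).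
Proof.
move=> [cT bT]; split=> [x t|tau].
  apply: (@continuous_comp _ _ _ (fun t => t + s) (fun t => T t x)); last exact: cT.
  by apply: cvgD => //; exact: cvg_cst.
have [M hM] := bT (tau + `|s|); exists M => t x ht; apply: hM.
by rewrite (le_trans (ler_normD _ _))// lerD2r.
Qed.

Lemma bounded_group_strongly_continuous T :
  C0_group T -> locally_bounded T -> strongly_continuous T.
Proof.
move=> [T0 TD Tc] bT; split=> // x; apply/continuous_nrmP => t e e0.
have [M [M0 hM]] := locally_bounded_gt0 `|t| bT.
have eM : 0 < e / M by rewrite divr_gt0.
have /cvg_nrmP/(_ _ eM)/nbhs_ballP[r /= r0 hr] := Tc x.
apply/nbhs_ballP; exists r => //= s; rewrite -ball_normE /= => ts.
have -> : T s x = T t (T (s - t) x) by rewrite -TD addrC subrK.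
rewrite -bop_sub (le_lt_trans (hM _ _ _))// mulrC -ltr_pdivlMr//.
by apply: hr; rewrite -ball_normE /= sub0r opprB.
Qed.

End StrongContinuity.

Section GroupContinuity.
Context {R : realType} {H : completeNormedModType R[i]}.

(** Near [0] the uniform boundedness principle applies, since otherwise norms
    above [16^n] would occur at times [2^-n]; the group law does the rest. *)
Lemma group_locally_bounded (S : R -> bop H H) : C0_group S -> locally_bounded S.
Proof.
move=> [S0 SD Sc].
have [d [M [d0 hd]]] : exists d M : R, 0 < d /\
    forall t x, `|t| <= d -> nrm (S t x) <= M * nrm x.
  apply: contrapT => hN.
  have bad n : exists t, `|t| <= 2^-1 ^+ n /\ 16 ^+ n < opnorm (S t).
    apply: contrapT => hn; apply: hN; exists (2^-1 ^+ n), (16 ^+ n).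
    split=> [|t x ht]; first by rewrite exprn_gt0.
    rewrite (le_trans (opnormP _ _))// ler_wpM2r ?nrm_ge0// leNgt.
    by apply/negP => hlt; apply: hn; exists t.
  pose t n := projT1 (cid (bad n)).
  have t1 n : `|t n| <= 2^-1 ^+ n by rewrite /t; case: cid => ? [].
  have t2 n : 16 ^+ n < opnorm (S (t n)) by rewrite /t; case: cid => ? [].
  (* The values at [x] grow like [4^n] along times tending to [0], where they
     should tend to [x]. *)
  have [x hx] := gliding_hump t2.
  have /cvg_nrmP/(_ 1 ltr01)/nbhs_ballP[r /= r0 hr] := Sc x.
  have [N1 _ h1] := halfpow_lt 1 r0.
  have [N2 _ h2] := halfpow_lt (6 * (nrm x + 1)) (@ltr01 R).
  pose n := (N1 + N2)%N.
  have h3 : nrm (S (t n) x - x) < 1.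
    apply: hr; rewrite -ball_normE /= sub0r normrN (le_lt_trans (t1 n))//.
    by rewrite -[X in X < _]mul1r h1 //= leq_addr.
  have h4 : nrm (S (t n) x) <= nrm x + 1.
    rewrite -[S (t n) x](subrK x) (le_trans (nrmD _ _))// addrC lerD2l.
    exact: ltW.
  have h5 : 6 * (nrm x + 1) < 2 ^+ n.
    have /= := h2 n (leq_addl _ _).
    by rewrite -ltr_pdivlMr ?exprn_gt0// div1r exprVn invrK.
  have h6 : (2 : R) ^+ n <= 4 ^+ n by rewrite lerXn2r ?nnegrE// ler_nat.
  by have := hx n; lra.
move=> tau.
have [n hn] : exists n : nat, tau <= n%:R * d.
  exists (Num.bound `|tau / d|); rewrite -ler_pdivrMr//.
  by rewrite (le_trans (ler_norm _))// ltW// archi_boundP.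
suff [K hK] : exists K : R, forall t x, `|t| <= n%:R * d -> nrm (S t x) <= K * nrm x.
  by exists K => t x ht; apply: hK; exact: le_trans hn.
elim: n {hn} => [|n [K hK]].
  exists 1 => t x; rewrite mul0r normr_le0 => /eqP->.
  by rewrite S0 mul1r.
(* Split off the last of [n.+1] equal steps. *)
exists (`|K| * M) => t x ht; pose s := t * (n%:R / n.+1%:R).
have n0 : 0 < n.+1%:R :> R by [].
have e1 : t = s + t / n.+1%:R.
  by rewrite /s mulrA -mulrDl -[X in _ + X]mulr1 -mulrDr natr1 mulfK// gt_eqF.
have ht1 : `|t| / n.+1%:R <= d by rewrite ler_pdivrMr// mulrC.
rewrite e1 SD (le_trans (hK _ _ _))//.
  rewrite /s normrM [X in _ * X]ger0_norm ?divr_ge0//.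
  by rewrite mulrCA ler_wpM2l.
rewrite (@le_trans _ _ (`|K| * nrm (S (t / n.+1%:R) x)))//.
  by rewrite ler_wpM2r ?nrm_ge0// ler_norm.
by rewrite -mulrA ler_wpM2l// hd// normrM normfV (ger0_norm (ltW n0)).
Qed.

Lemma group_strongly_continuous (S : R -> bop H H) :
  C0_group S -> strongly_continuous S.
Proof.
move=> gS; apply: bounded_group_strongly_continuous => //.
exact: group_locally_bounded.
Qed.

End GroupContinuity.

Section LinearEquation.
Context {R : realType} {H : hilbertType R}.
Variable Q : R -> bop H H.
Hypothesis cQ : strongly_continuous Q.
Implicit Types x : H.
Notation mu := (@lebesgue_measure R).

Let Qf (f : R -> H) : continuous f -> continuous (fun s => Q s (f s)).
Proof. exact: strongly_continuous_app. Qed.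

(** The terms of the Dyson series of [y' = Q y], [y 0 = x]. For negative times
    the integral is over an empty interval, hence [0]: the curves are continuous
    on the whole line, but solve the equation on the right half only. *)
Fixpoint dyson n x : R -> H :=
  if n is m.+1 then fun t => wint 0 t (fun s => Q s (dyson m x s)) else fun=> x.

Let dyson_continuous n x : continuous (dyson n x).
Proof.
elim: n => [|n IH] /=; first exact: cst_continuous.
by apply: wint_continuous; exact: Qf.
Qed.

(** Weighting by [expR (2 * k * t)] makes the integral operator halve the size
    of a curve, whatever the length of the time interval. *)
Let halving (tau k N : R) (f g : R -> H) : 0 < k -> 0 <= N ->
  (forall t x, `|t| <= tau -> nrm (Q t x) <= k * nrm x) -> continuous f ->
  (forall t, 0 <= t <= tau -> nrm (f t) <= N * expR (2 * k * t)) ->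
  (forall t, 0 <= t <= tau -> g t = wint 0 t (fun s => Q s (f s))) ->
  forall t, 0 <= t <= tau -> nrm (g t) <= N / 2 * expR (2 * k * t).
Proof.
move=> k0 N0 Qk cf fN gE t t0; rewrite gE//; have /andP[t1 t2] := t0.
pose F (s : R) := N / 2 * expR (2 * k * s).
have ce : continuous (fun s => k * (N * expR (2 * k * s))).
  move=> s; apply: cvgMl_tmp; apply: cvgMl_tmp.
  apply: (@continuous_comp _ _ _ (fun s => 2 * k * s) expR); last exact: continuous_expR.
  by apply: cvgMl_tmp.
have dF (s : R) : is_derive s 1 F (k * (N * expR (2 * k * s))).
  have d1 : is_derive s 1 (fun s : R => 2 * k * s) (2 * k).
    have := @is_deriveZ _ _ _ id (2 * k) s 1 1 (is_derive_id s 1).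
    by rewrite -[_ *: 1]/(2 * k * 1) mulr1.
  have d2 := @is_derive1_comp R expR (fun s => 2 * k * s) s _ _ (is_derive_expR _) d1.
  have := @is_deriveZ _ _ _ _ (N / 2) s 1 _ d2.
  suff -> : k * (N * expR (2 * k * s)) = (N / 2) *: (expR (2 * k * s) * (2 * k)) by [].
  by rewrite -[_ *: _]/(_ * _); field.
have h : nrm (wint 0 t (fun s => Q s (f s))) <= F t - F 0.
  rewrite -(int_primitive t1 ce dF); apply: nrm_wint_le => //; first exact: Qf.
  move=> s /andP[s0 st]; rewrite (le_trans (Qk _ _ _))//.
    by rewrite ger0_norm// (le_trans st).
  by rewrite ler_pM2l// fN// s0 (le_trans st).
rewrite (le_trans h)// gerBl /F mulr_ge0 ?expR_ge0// divr_ge0//.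
Qed.

Let dyson_le (tau k : R) n x : 0 < k ->
  (forall t x, `|t| <= tau -> nrm (Q t x) <= k * nrm x) ->
  forall t, 0 <= t <= tau ->
  nrm (dyson n x t) <= nrm x * 2^-1 ^+ n * expR (2 * k * t).
Proof.
move=> k0 Qk; elim: n => [|n IH] t t0.
  rewrite expr0 mulr1 /= ler_peMr ?nrm_ge0// -expR0 ler_expR.
  by rewrite mulr_ge0 ?mulr_ge0 ?(ltW k0)//; case/andP: t0.
rewrite exprSr mulrA.
apply: (halving k0 _ Qk (@dyson_continuous n x) IH) => //.
by rewrite mulr_ge0 ?nrm_ge0 ?exprn_ge0.
Qed.

Let dyson_neg n x t : t <= 0 -> dyson n.+1 x t = 0.
Proof. by move=> t0 /=; rewrite wint_empty. Qed.

Let dyson_bound (tau : R) : exists B : R, 0 < B /\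
  forall n x t, t <= tau -> nrm (dyson n x t) <= B * nrm x * 2^-1 ^+ n.
Proof.
have [k [k0 Qk]] := locally_bounded_gt0 tau cQ.2.
exists (expR (2 * k * `|tau|)); split; first exact: expR_gt0.
move=> n x t ttau.
have B1 : 1 <= expR (2 * k * `|tau|).
  by rewrite -expR0 ler_expR mulr_ge0// mulr_ge0// ltW.
have [t0|t0] := leP 0 t; last first.
  case: n => [|n]; first by rewrite /= expr0 mulr1 ler_peMl ?nrm_ge0.
  rewrite (dyson_neg _ _ (ltW t0)) nrm0; apply: mulr_ge0; last exact: exprn_ge0.
  by rewrite mulr_ge0 ?expR_ge0 ?nrm_ge0.
have tt : 0 <= t <= tau by rewrite t0.
rewrite (le_trans (dyson_le n x k0 Qk tt))// mulrC mulrA ler_wpM2r ?exprn_ge0//.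
rewrite ler_wpM2r ?nrm_ge0// ler_expR ler_pM2l ?mulr_gt0//.
by rewrite (le_trans ttau)// ler_norm.
Qed.

Let dyson_lin n (a : R[i]) x y t :
  dyson n (a *: x + y) t = a *: dyson n x t + dyson n y t.
Proof.
elim: n t => [//|n IH] t /=.
rewrite -wint_lin; last 2 first.
- exact/Qf/dyson_continuous.
- exact/Qf/dyson_continuous.
by congr wint; apply/funext => s; rewrite IH bop_lin.
Qed.

Fixpoint dyson_sum n x (t : R) : H :=
  if n is m.+1 then dyson_sum m x t + dyson m x t else 0.

Definition linear_flow x (t : R) : H :=
  xget 0 [set l | (fun n => dyson_sum n x t) @ \oo --> l].

Let flow_approx (tau : R) : exists B : R, 0 < B /\ forall n x t, t <= tau ->
  nrm (dyson_sum n x t - linear_flow x t) <= B * nrm x * 2^-1 ^+ n.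
Proof.
have [B [B0 hB]] := dyson_bound tau.
exists (2 * B); split; first by rewrite mulr_gt0.
move=> n x t ttau.
have [m|l hl] := @hilbert_geo_complete R H (fun m => dyson_sum m x t) (B * nrm x).
  by rewrite /= addrC addKr hB.
have cl : (fun n => dyson_sum n x t) @ \oo --> l.
  apply/cvg_nrmP => e e0; have := halfpow_lt (2 * (B * nrm x)) e0.
  by apply: filterS => m; apply: le_lt_trans; exact: hl.
suff -> : linear_flow x t = l by rewrite -(mulrA 2) hl.
by apply: xget_unique => // l' cl'; exact: (cvg_unique _ cl' cl).
Qed.

Let dyson_sum_continuous n x : continuous (dyson_sum n x).
Proof.
elim: n => [|n IH] /=; first exact: cst_continuous.
by move=> t; apply: cvgD; [exact: IH|exact: dyson_continuous].
Qed.

Let dyson_sum_lin n (a : R[i]) x y t :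
  dyson_sum n (a *: x + y) t = a *: dyson_sum n x t + dyson_sum n y t.
Proof.
elim: n => [|n IH] /=; first by rewrite scaler0 addr0.
by rewrite IH dyson_lin scalerDr !addrA; congr (_ + _); rewrite addrAC.
Qed.

Let dyson_sum_eq n x t :
  dyson_sum n.+1 x t = x + wint 0 t (fun s => Q s (dyson_sum n x s)).
Proof.
elim: n => [|n IH].
  rewrite /= add0r; under [in RHS]eq_fun do rewrite linear0.
  have [t0|t0] := leP 0 t; last by rewrite wint_empty ?addr0// ltW.
  by rewrite wint_cst// scaler0 addr0.
rewrite [LHS]/= -/(dyson_sum n.+1 x t) IH -addrA; congr (_ + _).
have cf : continuous (fun s => Q s (dyson_sum n x s)) by exact/Qf/dyson_sum_continuous.
have cg : continuous (fun s => Q s (dyson n x s)) by exact/Qf/dyson_continuous.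
have := wint_lin 1 0 t cf cg; rewrite scale1r => <-.
by congr wint; apply/funext => s; rewrite -bop_lin !scale1r.
Qed.

Let flow_cvg x (t : R) : (fun n => dyson_sum n x t) @ \oo --> linear_flow x t.
Proof.
have [B [B0 hB]] := flow_approx t.
apply/cvg_nrmP => e e0; have := halfpow_lt (B * nrm x) e0.
by apply: filterS => m; apply: le_lt_trans; exact: hB.
Qed.

Lemma linear_flow_lin (a : R[i]) x y (t : R) :
  linear_flow (a *: x + y) t = a *: linear_flow x t + linear_flow y t.
Proof.
apply: (cvg_unique _ (@flow_cvg (a *: x + y) t)) => //.
rewrite /= (_ : (fun n => _) = fun n => a *: dyson_sum n x t + dyson_sum n y t); last first.
  by apply/funext => n; rewrite dyson_sum_lin.
by apply: cvgD; [apply: cvgZl_tmp|]; exact: flow_cvg.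
Qed.

Lemma linear_flow_bounded (tau : R) : exists B : R, 0 < B /\
  forall x t, t <= tau -> nrm (linear_flow x t) <= B * nrm x.
Proof.
have [B [B0 hB]] := flow_approx tau; exists B; split=> // x t ttau.
by have := hB 0%N x t ttau; rewrite /= sub0r nrmN expr0 mulr1.
Qed.

Lemma linear_flow_continuous x : continuous (linear_flow x).
Proof.
apply/continuous_nrmP => t e e0.
have [B [B0 hB]] := flow_approx (t + 1).
have e3 : 0 < e / 3 by rewrite divr_gt0.
have [n _ hn] := halfpow_lt (B * nrm x) e3.
have hn' := hn n (leqnn n).
have /continuous_nrmP/(_ t _ e3) h2 := @dyson_sum_continuous n x.
have h3 : \forall s \near t, s <= t + 1.
  by apply: filterS (lt_nbhsl (ltr_pwDr ltr01 (lexx t))) => s /ltW.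
near=> s.
have st : s <= t + 1 by near: s.
have h4 : nrm (dyson_sum n x s - dyson_sum n x t) < e / 3 by near: s.
have h5 := le_lt_trans (hB n x s st) hn'.
have tt : t <= t + 1 by rewrite lerDl.
have h6 := le_lt_trans (hB n x t tt) hn'.
have := nrmBD (dyson_sum n x s) (linear_flow x s) (linear_flow x t).
have := nrmBD (dyson_sum n x t) (dyson_sum n x s) (linear_flow x t).
rewrite (nrm_sub (linear_flow x s) (dyson_sum n x s)); lra.
Unshelve. all: by end_near. Qed.

Lemma linear_flow_eq x (t : R) :
  linear_flow x t = x + wint 0 t (fun s => Q s (linear_flow x s)).
Proof.
have [t0|t0] := leP t 0.
  have e n : dyson_sum n.+1 x t = x by rewrite dyson_sum_eq wint_empty// addr0.
  have := @flow_cvg x t; rewrite -(cvg_shiftS (fun n => dyson_sum n x t)) (funext e).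
  move=> /(cvg_unique _)/(_ (cvg_cst _)) ->//.
  by rewrite wint_empty// addr0.
have [B [B0 hB]] := flow_approx t.
have [k [k0 Qk]] := locally_bounded_gt0 t cQ.2.
apply/eqP; rewrite -subr_eq0; apply/eqP/nrm_small => e e0.
pose C := B * nrm x + k * (B * nrm x) * t.
have [n _ hn] := halfpow_lt C e0.
have h1 := hB n.+1 x t (lexx t).
rewrite dyson_sum_eq in h1.
have cf : continuous (fun s => Q s (linear_flow x s)).
  by apply: Qf; exact: linear_flow_continuous.
have cg : continuous (fun s => Q s (dyson_sum n x s)).
  by apply: Qf; exact: dyson_sum_continuous.
have h2 : nrm (wint 0 t (fun s => Q s (dyson_sum n x s)) -
    wint 0 t (fun s => Q s (linear_flow x s))) <= k * (B * nrm x * 2^-1 ^+ n) * t.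
  rewrite addrC -scaleN1r -wint_lin//.
  rewrite -[X in _ * X]subr0 -(int_cst _ (ltW t0)).
  apply: nrm_wint_le; last 2 first.
  - exact: cst_continuous.
  - move=> s /andP[s0 st]; rewrite scaleN1r addrC -bop_sub.
    by rewrite (le_trans (Qk _ _ _)) ?ger0_norm// ler_pM2l// hB.
  by move=> s; apply: cvgD; [apply: cvgZl_tmp; exact: cf|exact: cg].
rewrite (le_trans (nrmBD (x + wint 0 t (fun s => Q s (dyson_sum n x s))) _ _))//.
rewrite (_ : x + _ - (x + _) = wint 0 t (fun s => Q s (dyson_sum n x s)) -
    wint 0 t (fun s => Q s (linear_flow x s))); last by rewrite opprD addrACA subrr add0r.
rewrite nrm_sub (le_trans (lerD h1 h2))//.
have /= := hn n (leqnn n); move/ltW; apply: le_trans.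
rewrite /C mulrDl exprS lerD//; last by rewrite le_eqVlt; apply/orP; left; apply/eqP; ring.
rewrite ler_wpM2l ?mulr_ge0 ?nrm_ge0 ?(ltW B0)//.
by rewrite ler_piMl ?exprn_ge0// invf_le1// ler1n.
Qed.

(** Each use of [halving] on a solution of the homogeneous equation halves its
    bound, so the bound is [0]. *)
Lemma linear_equation_unique (D : R -> H) : continuous D ->
  (forall t, 0 <= t -> D t = wint 0 t (fun s => Q s (D s))) ->
  forall t, 0 <= t -> D t = 0.
Proof.
move=> cD eD tau tau0.
have [k [k0 Qk]] := locally_bounded_gt0 tau cQ.2.
have [c _ hc] := @EVT_max R (fun t => nrm (D t)) 0 tau tau0
  (@continuous_subspaceT _ _ _ _ (continuous_nrm cD)).
have key n t : 0 <= t <= tau -> nrm (D t) <= nrm (D c) * 2^-1 ^+ n * expR (2 * k * t).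
  elim: n t => [|n IH] t t0.
    rewrite expr0 mulr1 (le_trans (hc t _))// ler_peMr ?nrm_ge0//.
    by rewrite -expR0 ler_expR !mulr_ge0 ?(ltW k0)//; case/andP: t0.
  rewrite exprSr mulrA; apply: (halving k0 _ Qk cD IH) => //.
    by rewrite mulr_ge0 ?nrm_ge0 ?exprn_ge0.
  by move=> s /andP[s0 _]; exact: eD.
apply: nrm_small => e e0.
have [n _ hn] := halfpow_lt (nrm (D c) * expR (2 * k * tau)) e0.
have /= := hn n (leqnn n); rewrite mulrAC => /ltW; apply: le_trans.
by apply: key; rewrite tau0 lexx.
Qed.

End LinearEquation.

Section BoundedPerturbation.
Context {R : realType} {H : hilbertType R}.
Variables (W : R -> bop H H) (P : bop H H).
Hypothesis gW : C0_group W.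

Let cW : strongly_continuous W := group_strongly_continuous gW.
Let W0 x : W 0 x = x. Proof. by have [] := gW. Qed.
Let WD s t x : W (s + t) x = W s (W t x). Proof. by have [] := gW. Qed.

Let Q (s : R) : bop H H := bop_comp (W (- s)) (bop_comp P (W s)).

Let cQ : strongly_continuous Q.
Proof.
apply: strongly_continuous_comp; first exact: strongly_continuous_opp.
by apply: strongly_continuous_comp => //; exact: strongly_continuous_cst.
Qed.

Let flow_subproof (t : R) : (fun x => linear_flow Q x t) \in @bounded_linear R H H.
Proof.
apply: is_bounded_linear_bop; split=> [a x y|]; first exact: linear_flow_lin.
have [B [B0 hB]] := linear_flow_bounded cQ t.
by exists B => x; exact: hB.
Qed.

Let Y (t : R) : bop H H := Bop (flow_subproof t).

(** The interaction picture: [W] carries the unbounded part of the generator,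
    and [Y] solves the linear equation [Y' = W (-s) P W s Y] with bounded
    coefficients. *)
Definition perturbed_semigroup (t : R) : bop H H := bop_comp (W t) (Y t).
Local Notation V := perturbed_semigroup.

Let YE x t : Y t x = x + wint 0 t (fun s => Q s (Y s x)).
Proof. exact: linear_flow_eq. Qed.

Let cY x : continuous (fun t => Y t x).
Proof. exact: linear_flow_continuous. Qed.

Let Y0 x : Y 0 x = x.
Proof. by rewrite YE wint_empty// addr0. Qed.

(** As functions of [s], the two sides solve the same linear equation, with the
    coefficients [Q] shifted by [t]. *)
Let Ycocycle s t x : 0 <= s -> 0 <= t -> Y (s + t) x = W (- t) (Y s (W t (Y t x))).
Proof.
move=> s0 t0; pose u := W t (Y t x).
pose D r := Y (r + t) x - W (- t) (Y r u).
have cYt : continuous (fun r => Y (r + t) x).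
  move=> r; apply: (@continuous_comp _ _ _ (fun r => r + t) (fun r => Y r x)).
    by apply: cvgD => //; exact: cvg_cst.
  exact: cY.
have cD : continuous D.
  by move=> r; apply: cvgB; [exact: cYt|apply: continuous_bop; exact: cY].
have cQt := strongly_continuous_shift t cQ.
suff /(_ s s0) /eqP : forall r, 0 <= r -> D r = 0 by rewrite subr_eq0 => /eqP.
apply: (linear_equation_unique cQt cD) => r r0.
have cQY := strongly_continuous_app cQ (@cY x).
have cQu := strongly_continuous_app cQ (@cY u).
have e1 : Y (r + t) x = Y t x + wint 0 r (fun s => Q (s + t) (Y (s + t) x)).
  have tr : t <= r + t by rewrite lerDr.
  have es := wint_split cQY t0 tr.
  have eh := wint_shift t cQY r0; rewrite add0r in eh.
  by rewrite (YE x t) -addrA -eh -es; exact: YE.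
have e2 : W (- t) (Y r u) = Y t x + wint 0 r (fun s => W (- t) (Q s (Y s u))).
  rewrite YE -[X in W _ (X + _)]scale1r bop_lin scale1r wint_bop//.
  by rewrite -WD addNr W0.
rewrite /D e1 e2 opprD addrACA subrr add0r [LHS]addrC -scaleN1r -wint_lin; last 2 first.
- exact: continuous_bop.
- exact: (strongly_continuous_app cQt cYt).
congr wint; apply/funext => a; rewrite scaleN1r addrC bop_sub; congr (_ - _).
move: (Y a u) => v.
rewrite -[LHS]/(W (- t) (W (- a) (P (W a v)))).
rewrite -[RHS]/(W (- (a + t)) (P (W (a + t) (W (- t) v)))).
by rewrite -(WD (a + t)) addrK -(WD (- t)) opprD addrC.
Qed.

Lemma perturbed_continuous x : continuous (fun t => V t x).
Proof. exact: strongly_continuous_app cW (@cY x). Qed.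

Lemma perturbed_C0 : C0_semigroup V.
Proof.
split=> [x|s t s0 t0 x|x]; first by rewrite -[LHS]/(W 0 (Y 0 x)) Y0 W0.
  rewrite -[LHS]/(W (s + t) (Y (s + t) x)) Ycocycle// -WD addrK.
  by [].
have cV := strongly_continuous_app cW (@cY x).
have := cV 0; rewrite /continuous_at Y0 W0 => h.
exact: cvg_at_right_filter h.
Qed.

(** The quotients of [Y] tend to [P x] for every [x], by continuity of the
    integrand; hence the quotients of [V] converge exactly when those of [W] do,
    and the perturbed generator has the domain of the original one. *)
Lemma perturbed_generator x y :
  (h^-1)%:C *: (V h x - x) @[h --> 0^'+] --> y <->
  (h^-1)%:C *: (W h x - x) @[h --> 0^'+] --> y - P x.
Proof.
have key : W h ((h^-1)%:C *: (Y h x - x)) @[h --> 0^'+] --> P x.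
  apply/cvg_nrmP => e e0.
  have [M [M0 hM]] := locally_bounded_gt0 1 cW.2.
  have eM : 0 < e / 2 / M by rewrite !divr_gt0.
  have e2 : 0 < e / 2 by rewrite divr_gt0.
  have cQY := strongly_continuous_app cQ (@cY x).
  have /continuous_nrmP/(_ 0 _ eM)/nbhs_ballP[r /= r0 hr] := cQY.
  have QY0 : Q 0 (Y 0 x) = P x by rewrite Y0 /Q /= oppr0 !W0.
  have c1 : W h (P x) @[h --> 0^'+] --> P x.
    have := (cW.1 (P x)) 0; rewrite /continuous_at W0; exact: cvg_at_right_filter.
  have /cvg_nrmP/(_ _ e2) h2 := c1.
  near=> h.
  have h0 : 0 < h by near: h; exact: nbhs_right_gt.
  have hr' : h < r by near: h; exact: nbhs_right_lt.
  have h1 : h <= 1 by near: h; exact: nbhs_right_le.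
  rewrite (le_lt_trans (nrmBD (W h (P x)) _ _))// [ltRHS]splitr ler_ltD//; last by near: h.
  rewrite -bop_sub (le_trans (hM _ _ _)) ?ger0_norm ?(ltW h0)//.
  rewrite mulrC -ler_pdivlMr//.
  have -> : (h^-1)%:C *: (Y h x - x) - P x =
      (h^-1)%:C *: (wint 0 h (fun s => Q s (Y s x)) - h%:C *: P x).
    rewrite [in RHS]scalerBr scalerA -rmorphM mulVf ?gt_eqF// rmorph1 scale1r.
    by rewrite (YE x h) (addrC x) addrK.
  rewrite nrmRZ ger0_norm ?invr_ge0 ?(ltW h0)// ler_pdivrMl//.
  have := @wint_mean _ _ _ 0 h (e / 2 / M) cQY (ltW h0); rewrite add0r QY0; apply.
  move=> t /andP[t0 th]; apply: ltW; rewrite -QY0; apply: hr.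
  by rewrite -ball_normE /= sub0r normrN ger0_norm// (le_lt_trans th).
have e h : (h^-1)%:C *: (V h x - x) =
    W h ((h^-1)%:C *: (Y h x - x)) + (h^-1)%:C *: (W h x - x).
  rewrite bop_scale bop_sub -scalerDr; congr (_ *: _).
  by rewrite addrA subrK.
split=> hc.
  have -> : (fun h => (h^-1)%:C *: (W h x - x)) = (fun h =>
      (h^-1)%:C *: (V h x - x) - W h ((h^-1)%:C *: (Y h x - x))).
    by apply/funext => h; rewrite e [RHS]addrAC subrr add0r.
  exact: cvgB hc key.
rewrite (funext e) (_ : y = P x + (y - P x)); last by rewrite addrC subrK.
exact: cvgD key hc.
Unshelve. all: by end_near. Qed.

End BoundedPerturbation.

(** * The adjoint group *)

Lemma cvg_eq_fun {T : Type} {V : topologicalType} {F : set_system T}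
  (f g : T -> V) (l : V) : f =1 g -> f @ F --> l -> g @ F --> l.
Proof. by move=> /funext ->. Qed.

Section Quotients.
Context {R : realType}.

Lemma is_derive_quotient (f : R -> R) (t d : R) :
  h^-1 * (f (h + t) - f t) @[h --> 0^'] --> d -> is_derive t 1 f d.
Proof.
move=> hd; have hd' : h^-1 *: ((f \o shift t) (h *: 1) - f t) @[h --> 0^'] --> d.
  have -> : (fun h : R => h^-1 *: ((f \o shift t) (h *: 1) - f t)) =
      (fun h : R => h^-1 * (f (h + t) - f t)).
    by apply/funext => h; rewrite /= -[h *: 1]/(h * 1) mulr1.
  exact: hd.
by apply: DeriveDef; [apply: cvgP hd'|apply: cvg_lim hd'].
Qed.

Lemma cvg_at0_opp {T : topologicalType} (f : R -> T) (l : T) :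
  f h @[h --> 0^'] --> l -> f (- h) @[h --> 0^'+] --> l.
Proof.
move=> hf; apply: cvg_trans hf => V /= hV.
have [r /= r0 hr] := (iffLR (nbhs_ballP _ _)) hV.
suff : \forall h \near (0 : R)^'+, V (f (- h)) by [].
near=> h.
have h0 : 0 < h by near: h; exact: nbhs_right_gt.
have hr' : h < r by near: h; exact: nbhs_right_lt.
apply: hr; last by rewrite oppr_eq0 gt_eqF.
by rewrite -ball_normE /= sub0r opprK gtr0_norm.
Unshelve. all: by end_near. Qed.

End Quotients.

Section AdjointBounds.
Context {R : realType} {X Y : normedModType R[i]}.

Lemma bopNE (F : bop X Y) x : (- F) x = - F x.
Proof. by rewrite -[- F]scaleN1r bopZE scaleN1r. Qed.

Lemma bopBE (F G : bop X Y) x : (F - G) x = F x - G x.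
Proof. by rewrite bopDE bopNE. Qed.

Lemma badjE (F : bop X Y) (y : dual Y) x : badj F y x = y (F x).
Proof. by []. Qed.

Lemma badj_subproof2 (F : bop X Y) : @badj R X Y F \in @bounded_linear R (dual Y) (dual X).
Proof.
apply: is_bounded_linear_bop; split=> [a u v|]; first by apply: bop_ext.
exists (nrm F) => f; rewrite nrm_opnorm opnorm_le ?mulr_ge0 ?nrm_ge0// => x.
rewrite /= (le_trans (nrm_bop _ _))// mulrC [leRHS]mulrAC.
by rewrite ler_wpM2r ?nrm_ge0// nrm_bop.
Qed.

Definition adj_op (F : bop X Y) : bop (dual Y) (dual X) := Bop (badj_subproof2 F).

Lemma nrm_dual_fun_le (f : dual X) (C : R) : 0 <= C ->
  (forall x, nrm (f x) <= C * nrm x) -> nrm f <= C.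
Proof. by move=> C0 h; rewrite nrm_opnorm opnorm_le. Qed.

Lemma cvg_eval {T : Type} {F : set_system T} {FF : Filter F} (u : T -> dual X)
  (f : dual X) (x : X) : u @ F --> f ->
  (fun t => u t x : R[i]^o) @ F --> (f x : R[i]^o).
Proof.
move=> /cvg_nrmP uf; apply/cvg_nrmP => e e0.
have x1 : 0 < nrm x + 1 by rewrite ltr_wpDl// nrm_ge0.
have := uf (e / (nrm x + 1)); rewrite divr_gt0// => /(_ isT).
apply: filterS => t; rewrite ltr_pdivlMr// => h.
rewrite (le_lt_trans (nrm_bop (u t - f) x))//; apply: le_lt_trans h.
by rewrite ler_wpM2l ?nrm_ge0// lerDl.
Qed.

Lemma nrm_badj_le (F : bop X Y) (M : R) (f : dual Y) : 0 <= M ->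
  (forall x, nrm (F x) <= M * nrm x) -> nrm (badj F f) <= M * nrm f.
Proof.
move=> M0 h; apply: nrm_dual_fun_le; first by rewrite mulr_ge0 ?nrm_ge0.
move=> x /=; rewrite (le_trans (nrm_bop _ _))// mulrC [leRHS]mulrAC.
by rewrite ler_wpM2r ?nrm_ge0.
Qed.

End AdjointBounds.

Arguments cvg_eval {R X T F FF} [u f] x _.

Section AdjointGroup.
Context {R : realType} {H : hilbertType R}.
Variables (A : dcop H) (S : R -> bop H H).
Hypothesis gS : C0_group S.
Hypothesis genS : group_generator S A.

Let cS : strongly_continuous S := group_strongly_continuous gS.
Let S0 x : S 0 x = x. Proof. by have [] := gS. Qed.
Let SD s t x : S (s + t) x = S s (S t x). Proof. by have [] := gS. Qed.

Lemma orbit_quotient (x : H) (t : R) : ldom A x ->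
  (h^-1)%:C *: (S h (S t x) - S t x) @[h --> 0^'] --> S t (lfun A x).
Proof.
move=> Ax; have [/(_ (conj Ax erefl)) h _] := genS x (lfun A x).
apply: cvg_eq_fun (cvg_bop (S t) h) => s.
by rewrite bop_scale bop_sub -!SD [t + s]addrC.
Qed.

Lemma orbit_dom (x : H) (t : R) : ldom A x ->
  ldom A (S t x) /\ lfun A (S t x) = S t (lfun A x).
Proof. by move=> Ax; apply/genS; exact: orbit_quotient. Qed.

Let IS_subproof (a b : R) :
  (fun x => wint a b (fun s => S s x)) \in @bounded_linear R H H.
Proof.
apply: is_bounded_linear_bop; split=> [w x y|].
  under eq_fun do rewrite bop_lin.
  by apply: wint_lin; exact: cS.1.
have [M [M0 hM]] := locally_bounded_gt0 (`|a| + `|b|) cS.2.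
have [ab|ba] := leP a b; last first.
  by exists 0 => x; rewrite wint_empty ?(ltW ba)// nrm0 mul0r.
exists (M * (b - a)) => x; rewrite mulrAC -int_cst//.
apply: nrm_wint_le; [exact: cS.1|exact: cst_continuous|move=> t /andP[at_ tb]].
apply: hM; rewrite ler_norml; apply/andP; split.
  by have := ler_norm (- a); rewrite normrN; have := normr_ge0 b; lra.
by have := ler_norm b; have := normr_ge0 a; lra.
Qed.

Definition orbit_int (a b : R) : bop H H := Bop (IS_subproof a b).

Lemma orbit_intP (a b : R) (psi : dual H) x :
  psi (orbit_int a b x) = Cintegral a b (fun s => psi (S s x)).
Proof. by apply: wintP; exact: cS.1. Qed.

Lemma orbit_int_gen (a b : R) x : a <= b -> ldom A x ->
  orbit_int a b (lfun A x) = S b x - S a x.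
Proof.
move=> ab Ax; apply: dual_sep => psi; rewrite orbit_intP bop_sub.
have der (phi : dual H) (t : R) : is_derive t 1 (fun s => complex.Re (phi (S s x)))
    (complex.Re (phi (S t (lfun A x)))).
  apply: is_derive_quotient.
  apply: cvg_eq_fun (cvg_Re (cvg_bop phi (@orbit_quotient x t Ax))) => h.
  by rewrite bop_scale bop_sub Re_scale Re_add Re_opp -SD.
have FTC (phi : dual H) : complex.Re (Cintegral a b (fun s => phi (S s (lfun A x)))) =
    complex.Re (phi (S b x) - phi (S a x)).
  rewrite Re_add Re_opp /Cintegral /= (int_primitive ab _ (der phi))//.
  by case: (ccont_dual phi (cS.1 (lfun A x))).
apply: complex_eq_Re; first exact: FTC.
have := FTC ('i *: psi); under [in LHS]eq_fun do rewrite bopZE.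
rewrite !bopZE -mulrBr CintegralZ//.
by apply: ccont_integrable; apply: ccont_dual; exact: cS.1.
Qed.

Lemma dense_dual_ext (f g : dual H) : (forall x, ldom A x -> f x = g x) -> f = g.
Proof.
move=> fg; suff h : f - g = 0 by apply/eqP; rewrite -subr_eq0 h.
apply: (@adj_rel_fun R H A 0) => x //=.
by rewrite -[RHS]/(f (dval x) - g (dval x)) fg ?subrr//; exact: domP.
Qed.

Lemma orbit_int_adj_dom (a b : R) (phi : dual H) : a <= b ->
  ldom (adjoint A) (badj (orbit_int a b) phi) /\
  lfun (adjoint A) (badj (orbit_int a b) phi) = badj (S b) phi - badj (S a) phi.
Proof.
move=> ab.
have h : adj_rel A (badj (orbit_int a b) phi) (badj (S b) phi - badj (S a) phi).
  move=> x; rewrite -[LHS]/(phi (orbit_int a b (lfun A x))).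
  by rewrite orbit_int_gen ?bop_sub//; exact: domP.
by split; [exists (badj (S b) phi - badj (S a) phi)|exact: adj_funP h].
Qed.

Lemma adj_orbit_dom (phi : dual H) (t : R) : ldom (adjoint A) phi ->
  ldom (adjoint A) (badj (S t) phi) /\
  lfun (adjoint A) (badj (S t) phi) = badj (S t) (lfun (adjoint A) phi).
Proof.
move=> Aphi; have [z hz] := Aphi.
have -> : lfun (adjoint A) phi = z by exact: adj_funP hz.
have h : adj_rel A (badj (S t) phi) (badj (S t) z).
  move=> x; have [d e] := @orbit_dom (dval x) t (domP x).
  by rewrite /= -e; exact: (hz (Dom (mem_set d))).
by split; [exists (badj (S t) z)|exact: adj_funP h].
Qed.

(** The weak form of the fundamental theorem of calculus for the adjoint orbit:
    it is enough to test it on the dense domain of [A]. *)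
Lemma adj_increment (phi : dual H) (a b : R) : a <= b -> ldom (adjoint A) phi ->
  badj (S b) phi - badj (S a) phi = badj (orbit_int a b) (lfun (adjoint A) phi).
Proof.
move=> ab [z hz]; have -> : lfun (adjoint A) phi = z by exact: adj_funP hz.
apply: dense_dual_ext => x Ax.
rewrite -[LHS]/(phi (S b x) - phi (S a x)) -bop_sub -(orbit_int_gen ab Ax).
rewrite -[RHS]/(z (orbit_int a b x)) !orbit_intP; congr Cintegral.
apply/funext => s; have [d e] := @orbit_dom x s Ax.
by rewrite -e; exact: (hz (Dom (mem_set d))).
Qed.

(** The integrals [\int_0^r S^* s phi ds] lie in the domain of the adjoint and
    separate points, since [r^-1 *: \int_0^r S s x ds] tends to [x]. *)
Lemma adj_dom_dense (phi : dual H) (e : R) : 0 < e ->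
  exists g, ldom (adjoint A) g /\ nrm (phi - g) < e.
Proof.
apply: dual_dense; first exact: ldom0.
  by move=> a f g; exact: ldom_lin.
move=> x hx.
have int0 r : 0 <= r -> orbit_int 0 r x = 0.
  move=> r0; apply: dual_sep => psi; rewrite linear0.
  by have := hx _ (orbit_int_adj_dom psi r0).1.
apply: nrm_small => d d0.
have /continuous_nrmP/(_ 0 _ d0)/nbhs_ballP[r /= r0 hr] := cS.1 x.
have r20 : 0 < r / 2 by rewrite divr_gt0.
have := @wint_mean _ _ (fun s => S s x) 0 (r / 2) d (cS.1 x) (ltW r20).
rewrite add0r -[wint _ _ _]/(orbit_int 0 (r / 2) x) int0 ?(ltW r20)// sub0r nrmN.
rewrite nrmRZ gtr0_norm// S0 ler_pM2l//; apply => t /andP[t0 tr].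
have := hr t; rewrite S0 => h; apply/ltW/h.
by rewrite -ball_normE /= sub0r normrN ger0_norm// (le_lt_trans tr)// ltr_pdivrMr// ltr_pMr// ltr1n.
Qed.

Definition adj_group (t : R) : bop (dual H) (dual H) := adj_op (S t).
Local Notation Sd := adj_group.

Lemma adj_group_locally_bounded : locally_bounded Sd.
Proof.
move=> tau; have [M [M0 hM]] := locally_bounded_gt0 tau cS.2.
exists M => t f tt; apply: nrm_badj_le; first exact: ltW.
by move=> x; exact: hM.
Qed.

Let adj_lipschitz (phi : dual H) : ldom (adjoint A) phi ->
  exists K : R, 0 < K /\ forall t, `|t| <= 1 -> nrm (Sd t phi - phi) <= K * `|t|.
Proof.
move=> Aphi; have [M [M0 hM]] := locally_bounded_gt0 1 cS.2.
pose z := lfun (adjoint A) phi.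
exists (M * (nrm z + 1)); split; first by rewrite mulr_gt0// ltr_wpDl// nrm_ge0.
have oi a b : -1 <= a -> a <= b -> b <= 1 ->
    nrm (badj (orbit_int a b) z) <= M * (nrm z + 1) * (b - a).
  move=> a1 ab b1; rewrite (@le_trans _ _ (M * (b - a) * nrm z))//; last first.
    rewrite mulrAC ler_wpM2r ?subr_ge0// ler_wpM2l ?(ltW M0)//.
    by rewrite lerDl.
  apply: nrm_badj_le => [|x]; first by rewrite mulr_ge0 ?subr_ge0 ?(ltW M0).
  rewrite mulrAC -int_cst//.
  apply: nrm_wint_le; [exact: cS.1|exact: cst_continuous|move=> t /andP[at_ tb]].
  by apply: hM; rewrite ler_norml (le_trans a1)//= (le_trans tb).
have Sd0 : phi = badj (S 0) phi by apply: bop_ext => x /=; rewrite S0.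
move=> t; rewrite ler_norml => /andP[t1 t2].
have [t0|t0] := leP 0 t.
  have -> : Sd t phi - phi = badj (orbit_int 0 t) z.
    by rewrite -adj_increment// -Sd0.
  by rewrite (le_trans (oi _ _ (@lerN10 _) t0 t2))// subr0 ger0_norm.
rewrite nrm_sub; have -> : phi - Sd t phi = badj (orbit_int t 0) z.
  by rewrite -adj_increment ?(ltW t0)// -Sd0.
by rewrite (le_trans (oi _ _ t1 (ltW t0) (@ler01 _)))// sub0r ltr0_norm.
Qed.

(** By [adj_increment] the orbits of the domain of the adjoint are Lipschitz
    continuous near [0]; the domain is dense and the group locally bounded. *)
Lemma adj_group_C0 : C0_group Sd.
Proof.
split=> [f|s t f|f].
- by apply: bop_ext => x /=; rewrite S0.
- by apply: bop_ext => x /=; rewrite [s + t]addrC SD.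
apply/cvg_nrmP => e e0.
have [M [M0 hM]] := locally_bounded_gt0 1 adj_group_locally_bounded.
have e1 : 0 < e / 3 / (M + 1) by rewrite !divr_gt0// ltr_wpDl// ltW.
have [g [Ag hg]] := adj_dom_dense f e1.
have [K [K0 hK]] := adj_lipschitz Ag.
apply/nbhs_ballP; exists (Num.min 1 (e / 3 / K)).
  by rewrite /= lt_min ltr01 !divr_gt0.
move=> t /=; rewrite sub0r normrN lt_min => /andP[t1 t2].
have h1 := hM t (f - g) (ltW t1); have h2 := hK t (ltW t1).
rewrite bop_sub in h1.
have h3 : K * `|t| < e / 3 by rewrite mulrC -ltr_pdivlMr.
have h4 : nrm (f - g) * (M + 1) < e / 3 by rewrite -ltr_pdivlMr// ltr_wpDl// ltW.
have h5 := nrmBD (Sd t g) (Sd t f) f; have h6 := nrmBD g (Sd t g) f.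
rewrite (nrm_sub g f) in h6.
apply: (le_lt_trans h5); apply: (le_lt_trans (lerD h1 (le_trans h6 (lerD h2 (lexx _))))).
clear hM e1 hg hK h1 h2 h5 h6 t1 t2 M0 K0.
move: h3 h4 (nrm_ge0 (f - g)); move: (nrm (f - g)) (K * `|t|) => n k *.
by lra.
Qed.

Lemma adj_strongly_continuous : strongly_continuous Sd.
Proof.
apply: bounded_group_strongly_continuous; first exact: adj_group_C0.
exact: adj_group_locally_bounded.
Qed.

(** One way, [adj_increment] makes the quotients means of a continuous orbit;
    the other way, testing convergent quotients on the domain of [A] exhibits
    the adjoint relation. Time runs backwards because the closed loop is built
    from the group [S^* (- t)]. *)
Lemma adj_group_generator (phi chi : dual H) :
  (ldom (adjoint A) phi /\ lfun (adjoint A) phi = chi) <->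
  (h^-1)%:C *: (Sd (- h) phi - phi) @[h --> 0^'+] --> - chi.
Proof.
split=> [[Aphi <-]|hphi].
  set z := lfun _ _; apply/cvg_nrmP => e e0.
  have cz := adj_strongly_continuous.1 z.
  have Sdz : Sd 0 z = z by apply: bop_ext => x /=; rewrite S0.
  have Sdp : Sd 0 phi = phi by apply: bop_ext => x /=; rewrite S0.
  have e2 : 0 < e / 2 by rewrite divr_gt0.
  have /continuous_nrmP/(_ 0 _ e2)/nbhs_ballP[q /= q0 hq] := cz.
  near=> h.
  have h0 : 0 < h by near: h; exact: nbhs_right_gt.
  have hq' : h < q by near: h; exact: nbhs_right_lt.
  have Nh : - h <= 0 by rewrite oppr_le0 ltW.
  have -> : Sd (- h) phi - phi = - badj (orbit_int (- h) 0) z.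
    by rewrite -adj_increment// opprB; congr (_ - _); rewrite -[LHS]Sdp.
  rewrite scalerN -opprD nrmN.
  apply: (@le_lt_trans _ _ (e / 2)); last by rewrite ltr_pdivrMr// ltr_pMr// ltr1n.
  have -> : (h^-1)%:C *: badj (orbit_int (- h) 0) z - z =
      (h^-1)%:C *: (badj (orbit_int (- h) 0) z - h%:C *: z).
    rewrite [in RHS]scalerBr scalerA -rmorphM mulVf ?gt_eqF// rmorph1.
    by rewrite scale1r.
  rewrite nrmRZ ger0_norm ?invr_ge0 ?(ltW h0)// ler_pdivrMl//.
  apply: nrm_dual_fun_le => [|x]; first by rewrite mulr_ge0 ?(ltW h0)// ltW.
  rewrite bopBE badjE bopZE orbit_intP.
  have cSz : cintegrable (- h) 0 (fun s => z (S s x)).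
    by apply: ccont_integrable; apply: ccont_dual; exact: cS.1.
  have cst : cintegrable (- h) 0 (fun=> z x).
    by apply: ccont_integrable; split; exact: cst_continuous.
  have -> : Cintegral (- h) 0 (fun s => z (S s x)) - h%:C * z x =
      Cintegral (- h) 0 (fun s => -1 * z x + z (S s x)).
    rewrite Cintegral_lin// mulN1r addrC; congr (- _ + _).
    rewrite /Cintegral !int_cst// sub0r opprK; case: (z x) => u v.
    by apply/eqP; rewrite eq_complex /= !mul0r subr0 addr0 ![_ * h]mulrC !eqxx.
  have -> : h * (e / 2) * nrm x = \int[lebesgue_measure]_(s in `[(- h), 0]) (e / 2 * nrm x).
    by rewrite int_cst// sub0r opprK; ring.
  apply: nrm_Cintegral_le.
  - exact: cintegrable_lin.
  - by apply: continuous_integrable; exact: cst_continuous.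
  move=> s /andP[s1 s2]; rewrite mulN1r addrC.
  have hs : nrm (Sd s z - Sd 0 z) < e / 2.
    apply: hq; rewrite -ball_normE /= sub0r normrN ler0_norm// (le_lt_trans _ hq')//.
    by rewrite lerNl.
  rewrite Sdz in hs; rewrite (le_trans (nrm_bop (Sd s z - z) x))//.
  by rewrite ler_wpM2r ?nrm_ge0// ltW.
have h : adj_rel A phi chi.
  move=> x.
  have [/(_ (conj (domP x) erefl)) hx _] := genS (dval x) (lfun A x).
  apply: (cvg_unique _ (cvg_bop phi (cvg_at0_opp hx))) => //.
  rewrite /= -[chi (dval x)]opprK -(bopNE chi).
  apply: cvg_eq_fun (cvgN (cvg_eval (dval x) hphi)) => r.
  rewrite -[LHS]/(- (((r^-1)%:C *: (Sd (- r) phi - phi)) (dval x))).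
  by rewrite bopZE bopBE badjE bop_scale bop_sub invrN rmorphN scaleNr.
by split; [exists chi|exact: adj_funP h].
Unshelve. all: by end_near. Qed.

End AdjointGroup.

(** * Extension of the observation to all states *)

Section StrongMeasurability.
Context {R : realType} {V : normedModType R[i]}.
Implicit Types f g : R -> V.

Definition simple_map (s : R -> V) : Prop :=
  finite_set (range s) /\ forall v, measurable (s @^-1` [set v]).

Lemma simple_map_measurable2 (s1 s2 : R -> V) (h : V -> V -> R) :
  simple_map s1 -> simple_map s2 ->
  measurable_fun setT (fun t => h (s1 t) (s2 t)).
Proof.
move=> [f1 m1] [f2 m2] _ Y mY; rewrite setTI.
have -> : (fun t => h (s1 t) (s2 t)) @^-1` Y =
    \bigcup_(v in range s1) \bigcup_(w in range s2 `&` [set w | Y (h v w)])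
      (s1 @^-1` [set v] `&` s2 @^-1` [set w]).
  apply/seteqP; split=> [t Yt|t [_ [u _ <-]] [_ [[r _ <-] /= Yh]] [/= -> ->]] //.
  by exists (s1 t) => //; exists (s2 t).
apply: fin_bigcup_measurable => // v _; apply: fin_bigcup_measurable.
  exact: finite_setIl.
by move=> w _; exact: measurableI.
Qed.

(** Along simple maps the function takes finitely many values; the pointwise
    limit of measurable real functions is measurable. *)
Lemma strongly_measurable2 f g (h : V -> V -> R) :
  strongly_measurable f -> strongly_measurable g ->
  (forall (u w : nat -> V) a b, u @ \oo --> a -> w @ \oo --> b ->
    h (u n) (w n) @[n --> \oo] --> h a b) ->
  measurable_fun setT (fun t => h (f t) (g t)).
Proof.
move=> [s1 [s1m s1f]] [s2 [s2m s2g]] hc.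
apply: (measurable_fun_cvg (h := fun n t => h (s1 n t) (s2 n t))) => [n|t _].
  by apply: simple_map_measurable2; [exact: s1m|exact: s2m].
exact: hc.
Qed.

(** A step function constant on a mesh of [-n, n] is simple; meshes fine enough
    for the moduli of continuity turn limits of continuous curves, taken off a
    measurable set, into limits of simple maps. *)
Lemma strongly_measurable_limit (N : set R) (f : nat -> R -> V) g :
  measurable N ->
  (forall n, exists d : R, 0 < d /\ forall s t, `|t| <= n%:R -> `|s - t| <= d ->
    nrm (f n s - f n t) <= 2^-1 ^+ n) ->
  (forall t, N t -> g t = 0) ->
  (forall t, ~ N t -> f n t @[n --> \oo] --> g t) ->
  strongly_measurable g.
Proof.
move=> mN fu gN gf.
pose d n := projT1 (cid (fu n)).
have d0 n : 0 < d n by rewrite /d; case: cid => ? [].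
have fd n s t : `|t| <= n%:R -> `|s - t| <= d n -> nrm (f n s - f n t) <= 2^-1 ^+ n.
  by rewrite /d; case: cid => ? [? h]; exact: h.
pose k n t := Num.truncn ((t + n%:R) / d n).
pose p n (i : nat) : R := i%:R * d n - n%:R.
pose G n := `[(- n%:R), n%:R]%classic `&` ~` N.
have mG n : measurable (G n) by apply: measurableI => //; exact: measurableC.
pose s n t := if t \in G n then f n (p n (k n t)) else 0.
have kP n t : G n t -> p n (k n t) <= t < p n (k n t).+1.
  move=> [/=]; rewrite in_itv /= => /andP[t1 t2] _.
  have := @truncn_itv _ ((t + n%:R) / d n); rewrite divr_ge0 ?(ltW (d0 n))//; last first.
    by rewrite -[n%:R]opprK subr_ge0.
  move=> /(_ isT); rewrite -/(k n t) ler_pdivlMr// ltr_pdivrMr// /p.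
  by rewrite lerBlDr ltrBrDr.
exists s; split=> [n|t].
  split.
    pose K := Num.truncn (2 * n%:R / d n).
    apply: (@sub_finite_set _ _ ([set 0] `|` (fun i => f n (p n i)) @` `I_K.+1)).
      move=> _ [t _ <-]; rewrite /s; case: ifPn => [/set_mem Gt|_]; last by left.
      right; exists (k n t) => //=; rewrite ltnS /k /K le_truncn//.
      rewrite ler_pM2r ?invr_gt0//; case: Gt => /=; rewrite in_itv /= => /andP[_ t2] _.
      by rewrite mulr2n mulrDl !mul1r lerD2r.
    by rewrite finite_setU; split; [exact: finite_set1|apply: finite_image; exact: finite_II].
  move=> v.
  have -> : s n @^-1` [set v] = (G n `&` \bigcup_(i in [set i | f n (p n i) = v])
      `[p n i, p n i.+1[%classic) `|` (~` G n `&` [set _ | v = 0]).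
    apply/seteqP; split=> [t|t].
      rewrite /s /=; case: ifPn => [/set_mem Gt fv|/negP Gt v0].
        by left; split=> //; exists (k n t) => //=; rewrite in_itv /= kP.
      by right; split=> // Gt'; apply: Gt; exact: mem_set.
    move=> [[Gt [i /= fi]]|[Gt /= v0]]; rewrite /s; last first.
      by rewrite ifN ?v0//; apply/negP => /set_mem.
    rewrite in_itv /= => /andP[i1 i2]; rewrite mem_set//.
    have /andP[k1 k2] := kP n t Gt.
    suff -> : k n t = i by [].
    apply/eqP; rewrite eqn_leq; apply/andP; split.
      rewrite -ltnS -(ltr_nat R) -(ltr_pM2r (d0 n)) -(ltrD2r (- n%:R)).
      exact: le_lt_trans i2.
    rewrite -ltnS -(ltr_nat R) -(ltr_pM2r (d0 n)) -(ltrD2r (- n%:R)).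
    exact: le_lt_trans k2.
  apply: measurableU.
    apply: measurableI => //; apply: bigcup_measurable => i _.
    exact: measurable_itv.
  apply: measurableI; first exact: measurableC.
  have [->|v0] := pselect (v = 0).
    by rewrite (_ : [set _ | _] = setT)//; apply/seteqP; split.
  by rewrite (_ : [set _ | _] = set0)//; apply/seteqP; split.
have [Nt|Nt] := pselect (N t).
  rewrite gN//; have -> : (fun n => s n t) = fun=> 0.
    by apply/funext => n; rewrite /s ifN//; apply/negP => /set_mem[].
  exact: cvg_cst.
apply/cvg_nrmP => e e0.
have e2 : 0 < e / 2 by rewrite divr_gt0.
have /cvg_nrmP/(_ _ e2) h1 := gf t Nt.
have h2 := halfpow_lt 1 e2.
have h3 : \forall n \near \oo, `|t| <= n%:R.
  exists (Num.bound `|t|) => // n /= bn.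
  by rewrite (le_trans (ltW (archi_boundP (normr_ge0 t))))// ler_nat.
near=> n.
have tn : `|t| <= n%:R by near: n.
have Gt : G n t by split=> //=; rewrite in_itv /= -ler_norml.
rewrite /s mem_set//.
rewrite (le_lt_trans (nrmBD (f n t) _ _))// [ltRHS]splitr ler_ltD//; last by near: n.
have hp : `|p n (k n t) - t| <= d n.
  have /andP[k1 k2] := kP n t Gt.
  rewrite distrC ger0_norm ?subr_ge0// ltW// ltrBlDr (lt_le_trans k2)//.
  by rewrite /p -natr1 mulrDl mul1r addrAC addrC.
rewrite (le_trans (fd _ _ _ tn hp))// ltW// -[ltLHS]mul1r.
by near: n.
Unshelve. all: by end_near. Qed.

End StrongMeasurability.

Section AlmostEverywhere.
Context {R : realType}.
Notation mu := (@lebesgue_measure R).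

Lemma ae_mono (P Q : R -> Prop) : {ae mu, forall t, P t} ->
  (forall t, P t -> Q t) -> {ae mu, forall t, Q t}.
Proof.
move=> [N [mN N0 PN]] PQ; exists N; split=> // t nQ; apply: PN => Pt.
exact/nQ/PQ.
Qed.

Lemma ae_and (P Q : R -> Prop) : {ae mu, forall t, P t} ->
  {ae mu, forall t, Q t} -> {ae mu, forall t, P t /\ Q t}.
Proof.
move=> [N [mN N0 PN]] [M [mM M0 QM]]; exists (N `|` M); split.
- exact: measurableU.
- by rewrite measureU0.
- move=> t /= nPQ; have [Pt|nP] := pselect (P t); last by left; exact: PN.
  by right; apply: QM => Qt; exact: nPQ.
Qed.

End AlmostEverywhere.

Section Observation.
Context {R : realType} {H U : hilbertType R}.
Variables (A : dcop H) (S : R -> bop H H) (B : bop U (dual (dom (adjoint A)))).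
Hypothesis gS : C0_group S.
Hypothesis genS : group_generator S A.
Implicit Types phi psi : dom (adjoint A).
Notation mu := (@lebesgue_measure R).
Local Notation Sd := (adj_group S).

Let cSd : strongly_continuous Sd := adj_strongly_continuous gS genS.

Definition dom_orbit phi (t : R) : dom (adjoint A) :=
  Dom (mem_set (@adj_orbit_dom _ _ _ _ gS genS (dval phi) t (domP phi)).1).

Lemma dom_orbit_fun phi t :
  lfun (adjoint A) (dval (dom_orbit phi t)) = Sd t (lfun (adjoint A) (dval phi)).
Proof. by have [] := @adj_orbit_dom _ _ _ _ gS genS (dval phi) t (domP phi). Qed.

Lemma dappE (X : normedModType R[i]) (L : lop X) (Y : zmodType) (f : dom L -> Y)
  (u : dom L) : dapp f (dval u) = f u.
Proof. by rewrite /dapp (_ : dval u = val u)// valK. Qed.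

Lemma BS_dom_orbit phi t : BS S B phi t = predual_adj B (dom_orbit phi t).
Proof. exact: (dappE (predual_adj B) (dom_orbit phi t)). Qed.

Lemma nrm_graph_le (X : normedModType R[i]) (L : lop X) (u : dom L) :
  nrm u <= nrm (dval u) + nrm (lfun L u).
Proof.
rewrite nrm_dom /graph_norm -(ler_sqr) ?nnegrE ?sqrtr_ge0 ?addr_ge0 ?nrm_ge0//.
rewrite sqr_sqrtr ?addr_ge0 ?sqr_ge0// sqrrD -addrA lerD2l lerDr.
by rewrite mulrn_wge0 ?mulr_ge0 ?nrm_ge0.
Qed.

Lemma nrm_predual_adj phi : nrm (predual_adj B phi) <= nrm B * nrm phi.
Proof.
apply: nrm_dual_fun_le => [|u]; first by rewrite mulr_ge0 ?nrm_ge0.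
rewrite -[X in nrm X]/(B u phi) (le_trans (nrm_bop _ _))// mulrAC.
by rewrite ler_wpM2r ?nrm_ge0// nrm_bop.
Qed.

Lemma predual_adj_lin (a : R[i]) phi psi :
  predual_adj B (a *: phi + psi) = a *: predual_adj B phi + predual_adj B psi.
Proof.
apply: bop_ext => u; rewrite bopDE bopZE.
by rewrite -[LHS]/(B u (a *: phi + psi)) dual_lin.
Qed.

Lemma predual_adj_sub phi psi :
  predual_adj B (phi - psi) = predual_adj B phi - predual_adj B psi.
Proof.
by have := predual_adj_lin (-1) psi phi; rewrite !scaleN1r addrC => ->; rewrite addrC.
Qed.

Lemma dom_orbit_lin (a : R[i]) phi psi t :
  dom_orbit (a *: phi + psi) t = a *: dom_orbit phi t + dom_orbit psi t.
Proof. by apply: val_inj; exact: (bop_lin (Sd t) a (dval phi) (dval psi)). Qed.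

Lemma BS_lin (a : R[i]) phi psi t :
  BS S B (a *: phi + psi) t = a *: BS S B phi t + BS S B psi t.
Proof. by rewrite !BS_dom_orbit dom_orbit_lin predual_adj_lin. Qed.

Lemma BS_sub phi psi t : BS S B (phi - psi) t = BS S B phi t - BS S B psi t.
Proof.
by have := BS_lin (-1) psi phi t; rewrite !scaleN1r addrC => ->; rewrite addrC.
Qed.

Lemma BS_group phi s t : BS S B (dom_orbit phi s) t = BS S B phi (s + t).
Proof.
rewrite /BS; congr dapp; apply: bop_ext => x.
by have [_ SD _] := gS; rewrite /= SD.
Qed.

Lemma BS_dist phi s t : nrm (BS S B phi s - BS S B phi t) <=
  nrm B * (nrm (Sd s (dval phi) - Sd t (dval phi)) +
    nrm (Sd s (lfun (adjoint A) (dval phi)) - Sd t (lfun (adjoint A) (dval phi)))).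
Proof.
rewrite !BS_dom_orbit -predual_adj_sub (le_trans (nrm_predual_adj _))//.
rewrite ler_wpM2l ?nrm_ge0// (le_trans (nrm_graph_le _))// lerD//.
have -> : lfun (adjoint A) (dval (dom_orbit phi s - dom_orbit phi t)) =
    Sd s (lfun (adjoint A) (dval phi)) - Sd t (lfun (adjoint A) (dval phi)).
  have := dom_funD (dom_orbit phi s) (- dom_orbit phi t).
  rewrite -!dom_orbit_fun => ->; congr (_ + _).
  by have := dom_funZ (-1) (dom_orbit phi t); rewrite !scaleN1r.
exact: lexx.
Qed.

(** In the graph norm an orbit is controlled by the orbits of [phi] and
    [A^* phi], and the group law moves continuity at [0] to any time, uniformly
    where the group is bounded. *)
Lemma BS_uniformly_continuous phi (n : R) (e : R) : 0 < e -> exists d : R, 0 < d /\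
  forall s t, `|t| <= n -> `|s - t| <= d -> nrm (BS S B phi s - BS S B phi t) <= e.
Proof.
move=> e0; have [M [M0 hM]] := locally_bounded_gt0 n cSd.2.
have [Sd0 SdD _] := adj_group_C0 gS genS.
pose z := lfun (adjoint A) (dval phi).
pose e' := e / 2 / (M * (nrm B + 1)).
have B1 : 0 < nrm B + 1 by rewrite ltr_wpDl// nrm_ge0.
have e'0 : 0 < e' by rewrite !divr_gt0// mulr_gt0.
have near0 x : exists r : R, 0 < r /\ forall h, `|h| < r -> nrm (Sd h x - x) < e'.
  have /continuous_nrmP/(_ 0 _ e'0)/nbhs_ballP[r r0 hr] := cSd.1 x.
  exists r; split=> // h hh; have := hr h; rewrite Sd0; apply.
  by rewrite -ball_normE /= sub0r normrN.
have [r1 [r10 h1]] := near0 (dval phi); have [r2 [r20 h2]] := near0 z.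
exists (Num.min r1 r2 / 2); split; first by rewrite divr_gt0// lt_min r10.
move=> s t tn st; have st' : `|s - t| < Num.min r1 r2.
  by rewrite (le_lt_trans st)// ltr_pdivrMr// ltr_pMr ?ltr1n// lt_min r10.
have key x : nrm (Sd (s - t) x - x) < e' -> nrm (Sd s x - Sd t x) <= M * e'.
  move=> h; have -> : Sd s x = Sd t (Sd (s - t) x) by rewrite -SdD addrC subrK.
  by rewrite -bop_sub (le_trans (hM _ _ tn))// ler_pM2l// ltW.
move: st'; rewrite lt_min => /andP[/h1/key k1 /h2/key k2].
rewrite (le_trans (BS_dist _ _ _))// -/z.
rewrite (@le_trans _ _ ((nrm B + 1) * (M * e' + M * e')))//.
  rewrite ler_pM ?addr_ge0 ?nrm_ge0//; first by rewrite lerDl.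
  exact: lerD.
have -> : (nrm B + 1) * (M * e' + M * e') = e.
  by rewrite /e'; field; rewrite !gt_eqF.
exact: lexx.
Qed.

Lemma BS_continuous phi : continuous (BS S B phi).
Proof.
apply/continuous_nrmP => t e e0; have e2 : 0 < e / 2 by rewrite divr_gt0.
have [d [d0 hd]] := BS_uniformly_continuous phi `|t| e2.
apply/nbhs_ballP; exists d => //= s; rewrite -ball_normE /= => ts.
rewrite (le_lt_trans (hd _ _ (lexx _) _)) ?ltr_pdivrMr ?ltr_pMr ?ltr1n//.
by rewrite distrC ltW.
Qed.

Lemma sqL2norm_continuous (V : normedModType R[i]) (f : R -> V) (a b : R) :
  continuous f -> sqL2norm `[a, b] f = (\int[mu]_(t in `[a, b]) (nrm (f t) ^+ 2))%:E.
Proof.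
move=> cf; rewrite /sqL2norm /Rintegral fineK//.
have ci : mu.-integrable `[a, b] (EFin \o (fun t => nrm (f t) ^+ 2)).
  apply: continuous_integrable => t; apply: cvgM; exact: continuous_nrm.
exact: integrable_fin_num.
Qed.

Hypothesis admissible : forall T : R, 0 < T -> exists2 C : R, 0 < C &
  forall phi : dom (adjoint A),
    (sqL2norm `[0%R, T] (BS S B phi) <= (C * nrm (dval phi) ^+ 2)%:E)%E.

Let cnrmBS phi : continuous (fun t => nrm (BS S B phi t) ^+ 2).
Proof. by move=> t; apply: cvgM; apply: continuous_nrm; exact: BS_continuous. Qed.

(** The window [[- T, T]] for [phi] is the window [[0, 2 T]] for
    [S^* (- T) phi]. *)
Lemma BS_bounded (T : R) : 0 < T -> exists C : R, 0 < C /\ forall phi,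
  \int[mu]_(t in `[(- T), T]) (nrm (BS S B phi t) ^+ 2) <= C * nrm (dval phi) ^+ 2.
Proof.
move=> T0; have T2 : 0 < T + T by rewrite addr_gt0.
have [C C0 hC] := admissible T2.
have [M [M0 hM]] := locally_bounded_gt0 T cSd.2.
exists (C * M ^+ 2); split=> [|phi]; first by rewrite mulr_gt0// exprn_gt0.
have := hC (dom_orbit phi (- T)); rewrite sqL2norm_continuous; last exact: BS_continuous.
rewrite lee_fin.
have -> : \int[mu]_(t in `[(- T), T]) (nrm (BS S B phi t) ^+ 2) =
    \int[mu]_(t in `[0, (T + T)]) (nrm (BS S B (dom_orbit phi (- T)) t) ^+ 2).
  have -> : (fun t => nrm (BS S B (dom_orbit phi (- T)) t) ^+ 2) =
      (fun t => nrm (BS S B phi (t + - T)) ^+ 2).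
    by apply/funext => t; rewrite BS_group addrC.
  have := int_shift (- T) (@cnrmBS phi) (ltW T2).
  by rewrite add0r addrK => ->.
move=> /le_trans; apply; rewrite -mulrA ler_pM2l// -exprMn.
rewrite lerXn2r ?nnegrE ?mulr_ge0 ?nrm_ge0 ?(ltW M0)//.
by apply: hM; rewrite normrN gtr0_norm.
Qed.

(** Summing the squares weighted by [4^n] shows that observations of a sequence
    of states with rapidly decreasing norms decrease almost everywhere. *)
Lemma ae_BS_small (chi : nat -> dom (adjoint A)) (K : R) :
  (forall n, nrm (dval (chi n)) <= K * 4^-1 ^+ n) ->
  {ae mu, forall t : R, exists C : R, forall n,
    nrm (BS S B (chi n) t) <= C * 2^-1 ^+ n}.
Proof.
move=> hchi.
have K0 : 0 <= K.
  by have := hchi 0%N; rewrite expr0 mulr1; apply: le_trans; exact: nrm_ge0.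
pose g n t := (4 ^+ n * nrm (BS S B (chi n) t) ^+ 2)%:E.
have g0 n t : (0 <= g n t)%E by rewrite lee_fin mulr_ge0 ?exprn_ge0 ?nrm_ge0.
have cg n : continuous (fun t => 4 ^+ n * nrm (BS S B (chi n) t) ^+ 2).
  by move=> t; apply: cvgMl_tmp; exact: cnrmBS.
have mg n (D : set R) : measurable_fun D (g n).
  apply/measurable_EFinP; apply: measurable_funTS.
  exact: continuous_measurable_fun.
have local (T : R) : 0 < T ->
    {ae mu, forall t, `[(- T), T]%classic t -> (\sum_(n <oo) g n t < +oo)%E}.
  move=> T0; have [C [C0 hC]] := BS_bounded T0.
  have fin : (\int[mu]_(t in `[(- T)%R, T]) (\sum_(n <oo) g n t) < +oo)%E.
    rewrite integral_nneseries//; last by move=> n; exact: mg.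
    apply: (@le_lt_trans _ _ (\sum_(n <oo) (C * K ^+ 2 * 2 / (2 ^ (n + 1))%:R)%:E)%E).
      apply: lee_nneseries => [n _ _|n _]; first exact: integral_ge0.
      have -> : (\int[mu]_(t in `[(- T)%R, T]) g n t)%E =
          (\int[mu]_(t in `[(- T), T]) (4 ^+ n * nrm (BS S B (chi n) t) ^+ 2))%:E.
        rewrite /Rintegral fineK//; apply: integrable_fin_num => //.
        exact: continuous_integrable.
      rewrite lee_fin intZ; last exact: cnrmBS.
      rewrite (@le_trans _ _ (4 ^+ n * (C * (K * 4^-1 ^+ n) ^+ 2)))//.
        rewrite ler_pM2l ?exprn_gt0// (le_trans (hC _))// ler_pM2l//.
        rewrite lerXn2r ?nnegrE ?nrm_ge0//.
        exact: le_trans (nrm_ge0 _) (hchi n).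
      rewrite natrX exprD expr1 invfM -exprVn [leRHS](_ : _ = C * K ^+ 2 * 2^-1 ^+ n); last by field.
      have -> : 4 ^+ n * (C * (K * 4^-1 ^+ n) ^+ 2) = C * K ^+ 2 * 4^-1 ^+ n.
        by rewrite exprVn; field; rewrite expf_neq0.
      rewrite ler_wpM2l ?mulr_ge0 ?(ltW C0)//.
      by rewrite lerXn2r ?nnegrE// lef_pV2 ?posrE// ler_nat.
    have := @cvg_geometric_eseries_half R (C * K ^+ 2 * 2) 0.
    by move=> /cvg_lim -> //; rewrite expr0 divr1 ltry.
  have int : mu.-integrable `[(- T), T] (fun t => \sum_(n <oo) g n t)%E.
    apply/integrableP; split.
      by apply: ge0_emeasurable_sum => // n _; exact: mg.
    under eq_integral do rewrite gee0_abs ?nneseries_ge0//.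
    exact: fin.
  have mT : measurable (`[(- T), T]%classic : set (measurableTypeR R)).
    exact: measurable_itv.
  apply: filterS (integrable_ae mT int) => t h tT.
  by rewrite ltey_eq h.
have all : {ae mu, forall t n, `[(- n.+1%:R), n.+1%:R]%classic t ->
    (\sum_(n <oo) g n t < +oo)%E}.
  apply: ae_foralln => n; exact: local.
apply: (ae_mono all) => t h.
have [n tn] : exists n : nat, `|t| <= n.+1%:R.
  exists (Num.bound `|t|); rewrite (le_trans (ltW (archi_boundP (normr_ge0 t))))//.
  by rewrite ler_nat.
have {h} := h n; rewrite /= in_itv /= -ler_norml => /(_ tn) fin.
have sum0 : (0 <= \sum_(n <oo) g n t)%E by exact: nneseries_ge0.
exists (1 + fine (\sum_(n <oo) g n t)) => m.
have hm : (g m t <= \sum_(n <oo) g n t)%E.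
  rewrite (le_trans _ (nneseries_lim_ge m.+1 _))//.
  by rewrite big_nat_recr//= leeDr// sume_ge0.
have := hm; rewrite -{1}[X in (_ <= X)%E]fineK ?ge0_fin_numE// lee_fin.
move: (fine _) (fine_ge0 sum0) => s s0 hs.
have h4 : (2 ^+ m * nrm (BS S B (chi m) t)) ^+ 2 <= (1 + s) ^+ 2.
  rewrite exprMn -exprM mulnC exprM -natrX (le_trans hs)//.
  rewrite (_ : (1 + s) ^+ 2 = s + (1 + s + s ^+ 2)); last by ring.
  by rewrite lerDl !addr_ge0 ?sqr_ge0.
have h5 : 2 ^+ m * nrm (BS S B (chi m) t) <= 1 + s.
  by rewrite -ler_sqr ?nnegrE ?mulr_ge0 ?exprn_ge0 ?nrm_ge0 ?addr_ge0.
by rewrite exprVn ler_pdivlMr ?exprn_gt0// mulrC.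
Qed.

(** The rate [4^-n] makes [ae_BS_small] applicable to the increments; the bound
    by [2 * nrm f] is for the estimate of the limit by Fatou's lemma. *)
Let approx_ex (f : dual H) (n : nat) : exists g : dom (adjoint A),
  nrm (f - dval g) <= 4^-1 ^+ n /\ nrm (dval g) <= 2 * nrm f.
Proof.
have [->|f0] := eqVneq f 0.
  exists 0; rewrite (_ : dval (0 : dom (adjoint A)) = 0)// subrr nrm0 mulr0.
  by split=> //; exact: exprn_ge0.
have nf : 0 < nrm f.
  by rewrite lt_neqAle nrm_ge0 andbT eq_sym; apply: contra_neq f0 => /nrm0_eq0.
have e0 : 0 < Num.min (4^-1 ^+ n) (nrm f) by rewrite lt_min exprn_gt0.
have [g [Ag]] := adj_dom_dense gS genS f e0; rewrite lt_min => /andP[g1 g2].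
exists (Dom (mem_set Ag)) => /=; split; first exact: ltW.
have := nrmB f (f - g); rewrite opprB addrC subrK => /le_trans; apply.
by rewrite mulr2n mulrDl mul1r lerD2l ltW.
Qed.

Let approx f n : dom (adjoint A) := projT1 (cid (approx_ex f n)).

Let approx_dist f n : nrm (f - dval (approx f n)) <= 4^-1 ^+ n.
Proof. by rewrite /approx; case: cid => ? []. Qed.

Let approx_le f n : nrm (dval (approx f n)) <= 2 * nrm f.
Proof. by rewrite /approx; case: cid => ? []. Qed.

Let approx_conv f : exists N : set R, [/\ measurable N, mu N = 0 &
  forall t, ~ N t -> exists l : dual U, BS S B (approx f n) t @[n --> \oo] --> l].
Proof.
pose chi n := approx f n.+1 - approx f n.
have hchi n : nrm (dval (chi n)) <= 2 * 4^-1 ^+ n.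
  rewrite -[dval (chi n)]/(dval (approx f n.+1) - dval (approx f n)).
  rewrite (le_trans (nrmBD f _ _))// nrm_sub mulr2n mulrDl mul1r lerD//.
  by rewrite (le_trans (approx_dist f n.+1))// exprS ler_piMl ?exprn_ge0// invf_le1// ler1n.
have [N [mN N0 hN]] := ae_BS_small hchi; exists N; split=> // t Nt.
have [C hC] : exists C, forall n, nrm (BS S B (chi n) t) <= C * 2^-1 ^+ n.
  by apply: contrapT => h; apply: Nt; apply: hN.
have [n|l hl] := @dual_geo_complete R U (fun n => BS S B (approx f n) t) C.
  by rewrite -BS_sub; exact: hC.
exists l; apply/cvg_nrmP => e e0; have := halfpow_lt (2 * C) e0.
by apply: filterS => n; apply: le_lt_trans; exact: hl.
Qed.

Let null f : set R := projT1 (cid (approx_conv f)).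

Let null_measurable f : measurable (null f).
Proof. by rewrite /null; case: cid => ? []. Qed.

Let null0 f : mu (null f) = 0.
Proof. by rewrite /null; case: cid => ? []. Qed.

Let ext (f : dual H) (t : R) : dual U := if t \in null f then 0
  else xget 0 [set l : dual U | BS S B (approx f n) t @[n --> \oo] --> l].

Let ext_null f t : null f t -> ext f t = 0.
Proof. by move=> nt; rewrite /ext mem_set. Qed.

Let ext_cvg f t : ~ null f t -> BS S B (approx f n) t @[n --> \oo] --> ext f t.
Proof.
move=> nt; rewrite /ext ifN; last by apply/negP => /set_mem.
suff ex : exists l : dual U, [set l : dual U | BS S B (approx f n) t @[n --> \oo] --> l] l.
  exact: (@xgetPex _ 0 _ ex).
by move: nt; rewrite /null; case: cid => N [? ? h] /h.
Qed.

Let ext_cvg_ae f :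
  {ae mu, forall t : R, BS S B (approx f n) t @[n --> \oo] --> ext f t}.
Proof.
exists (null f); split; [exact: null_measurable|exact: null0|move=> t /= h].
by apply: contrapT => nt; apply: h; exact: ext_cvg.
Qed.

Let ext_measurable f : strongly_measurable (ext f).
Proof.
apply: (@strongly_measurable_limit _ _ (null f) (fun n => BS S B (approx f n))) => //.
- by move=> n; apply: BS_uniformly_continuous; rewrite exprn_gt0.
- exact: ext_null.
- exact: ext_cvg.
Qed.

Lemma einfs_bounded (u : nat -> \bar R) (c : \bar R) :
  (forall n, (u n <= c)%E) -> (limn_einf u <= c)%E.
Proof.
move=> uc; rewrite limn_einf_lim; apply: lime_le; first exact: is_cvg_einfs.
by apply: nearW => n; rewrite (le_trans _ (uc n))//; apply: ereal_inf_lbound; exists n => /=.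
Qed.

Let ext_bounded (T : R) : 0 < T -> exists M : R, forall f,
  (sqL2norm `[(- T)%R, T] (ext f) <= (M * nrm f ^+ 2)%:E)%E.
Proof.
move=> T0; have [C [C0 hC]] := BS_bounded T0.
exists (C * 4) => f.
pose h n t := (nrm (BS S B (approx f n) t) ^+ 2 * \1_(~` null f) t)%:E.
have h0 n t : (0 <= h n t)%E by rewrite lee_fin mulr_ge0 ?sqr_ge0.
have mh n (D : set R) : measurable_fun D (h n).
  apply/measurable_EFinP; apply: measurable_funTS; apply: measurable_funM.
    by apply: continuous_measurable_fun; exact: cnrmBS.
  by apply: measurable_indic; exact: measurableC.
have e t : limn_einf (h ^~ t) = (nrm (ext f t) ^+ 2)%:E.
  apply: (cvg_limn_einf_sup _).1; apply: cvg_EFin; first exact: nearW.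
  have [nt|nt] := pselect (null f t).
    apply: (@cvg_eq_fun _ _ _ (fun=> 0)) => [n|].
      by rewrite /= indicE memNset ?mulr0//= => /(_ nt).
    by rewrite ext_null// nrm0 expr0n; exact: cvg_cst.
  apply: (@cvg_eq_fun _ _ _ (fun n => nrm (BS S B (approx f n) t) ^+ 2)) => [n|].
    by rewrite /= indicE mem_set// mulr1.
  by apply: cvgM; apply: cvg_nrm; exact: ext_cvg.
rewrite /sqL2norm; under eq_integral do rewrite -e.
have mD : measurable (`[(- T), T]%classic : set (measurableTypeR R)).
  exact: measurable_itv.
apply: le_trans (fatou _ mD _ _) _ => //; first by move=> n; exact: mh.
apply: einfs_bounded => n.
apply: (@le_trans _ _ (\int[mu]_(t in `[(- T)%R, T]) (nrm (BS S B (approx f n) t) ^+ 2)%:E)%E).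
  apply: ge0_le_integral => //.
  - exact: mh.
  - apply/measurable_EFinP; apply: measurable_funTS.
    by apply: continuous_measurable_fun; exact: cnrmBS.
  - by move=> t _; rewrite lee_fin ler_piMr ?sqr_ge0// indicE; case: (_ \in _).
have := sqL2norm_continuous (- T) T (@BS_continuous (approx f n)).
rewrite /sqL2norm => ->; rewrite lee_fin (le_trans (hC _))// -mulrA ler_pM2l//.
have -> : 4 * nrm f ^+ 2 = (2 * nrm f) ^+ 2 by rewrite exprMn -natrX.
by rewrite lerXn2r ?nnegrE ?mulr_ge0 ?nrm_ge0// approx_le.
Qed.

Let cvg_ae_zero (chi : nat -> dom (adjoint A)) (K : R) :
  (forall n, nrm (dval (chi n)) <= K * 4^-1 ^+ n) ->
  {ae mu, forall t : R, BS S B (chi n) t @[n --> \oo] --> (0 : dual U)}.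
Proof.
move=> /ae_BS_small h; apply: (ae_mono h) => t [C hC].
apply/cvg_nrmP => e e0; have := halfpow_lt C e0.
by apply: filterS => n; apply: le_lt_trans; rewrite subr0.
Qed.

Let ext_lin (a : R[i]) f g : {ae mu, forall t : R,
  ext (a *: f + g) t = a *: ext f t + ext g t}.
Proof.
pose chi n := approx (a *: f + g) n - (a *: approx f n + approx g n).
have hchi n : nrm (dval (chi n)) <= (2 + nrm (a : R[i]^o)) * 4^-1 ^+ n.
  rewrite -[dval (chi n)]/(dval (approx (a *: f + g) n) -
    (a *: dval (approx f n) + dval (approx g n))).
  rewrite (le_trans (nrmBD (a *: f + g) _ _))//.
  rewrite (nrm_sub (dval (approx (a *: f + g) n))).
  rewrite (_ : a *: f + g - (a *: _ + _) = a *: (f - dval (approx f n)) + (g - dval (approx g n))); last first.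
    by rewrite scalerBr opprD addrACA.
  have h1 := approx_dist (a *: f + g) n; have h2 := approx_dist f n.
  have h3 := approx_dist g n.
  rewrite (le_trans (lerD h1 (nrmD _ _)))// nrmZ -/(nrm (a : R[i]^o)).
  rewrite (_ : (2 + _) * _ = 4^-1 ^+ n + (nrm (a : R[i]^o) * 4^-1 ^+ n + 4^-1 ^+ n)); last by ring.
  by rewrite lerD2l lerD// ler_wpM2l// nrm_ge0.
have h := ae_and (ae_and (ext_cvg_ae f) (ext_cvg_ae g))
  (ae_and (ext_cvg_ae (a *: f + g)) (cvg_ae_zero hchi)).
apply: (ae_mono h) => t [[hf hg] [hfg h0]].
apply: (cvg_unique _ hfg) => //.
rewrite -[_ + ext g t]add0r.
have -> : (fun n => BS S B (approx (a *: f + g) n) t) = (fun n => BS S B (chi n) t +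
    (a *: BS S B (approx f n) t + BS S B (approx g n) t)).
  by apply/funext => n; rewrite BS_sub BS_lin subrK.
apply: cvgD; first exact: h0.
by apply: cvgD; [apply: cvgZl_tmp; exact: hf|exact: hg].
Qed.

Let ext_dom (phi : dom (adjoint A)) : {ae mu, forall t : R,
  ext (dval phi) t = BS S B phi t}.
Proof.
pose chi n := approx (dval phi) n - phi.
have hchi n : nrm (dval (chi n)) <= 1 * 4^-1 ^+ n.
  rewrite mul1r -[dval (chi n)]/(dval (approx (dval phi) n) - dval phi) nrm_sub.
  exact: approx_dist.
apply: (ae_mono (ae_and (ext_cvg_ae (dval phi)) (cvg_ae_zero hchi))) => t [hf h0].
apply: (cvg_unique _ hf) => //; rewrite -[BS S B phi t]add0r.
have -> : (fun n => BS S B (approx (dval phi) n) t) =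
    (fun n => BS S B (chi n) t + BS S B phi t).
  by apply/funext => n; rewrite BS_sub subrK.
apply: cvgD; first exact: h0.
exact: cvg_cst.
Qed.

(** The observations of approximations at the rate [4^-n] converge almost
    everywhere; two such approximations of the same state have the same limit
    off a null set, which gives linearity and the values on the domain. *)
Lemma BS_extP : is_BS_ext S B (BS_ext S B).
Proof.
apply: (@xgetPex _ (fun _ _ => 0) (is_BS_ext S B)); exists ext; split.
- move=> f; split=> [|T T0]; first exact: ext_measurable.
  by have [M hM] := ext_bounded T0; rewrite (le_lt_trans (hM f))// ltry.
- exact: ext_lin.
- exact: ext_bounded.
- exact: ext_dom.
Qed.

End Observation.

(** * The weighted Gramian *)

Lemma mulr_le_sqrD (R : realType) (x y : R) : x * y <= x ^+ 2 + y ^+ 2.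
Proof.
rewrite -subr_ge0 -(@pmulr_rge0 _ 2)// (_ : 2 * _ = (x - y) ^+ 2 + (x ^+ 2 + y ^+ 2)).
  by rewrite !addr_ge0 ?sqr_ge0.
by ring.
Qed.

Section HermitianForms.
Context {R : realType} {X : normedModType R[i]}.

(** Forms are linear in the second argument, like [ddot]. *)
Record hermitian_form (q : X -> X -> R[i]) : Prop := {
  form_lin : forall (a : R[i]) f g h, q f (a *: g + h) = a * q f g + q f h;
  form_conj : forall f g, q f g = Num.conj (q g f)
}.

Variable q : X -> X -> R[i].
Hypothesis hq : hermitian_form q.

Lemma form_linl (a : R[i]) f g h :
  q (a *: f + g) h = Num.conj a * q f h + q g h.
Proof.
by rewrite (form_conj hq) (form_lin hq) rmorphD rmorphM /= -!(form_conj hq).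
Qed.

Lemma form0r f : q f 0 = 0.
Proof.
have := form_lin hq 1 f 0 0; rewrite scale1r addr0 mul1r => /eqP.
by rewrite -subr_eq subrr eq_sym => /eqP.
Qed.

Lemma formBr f g h : q f (g - h) = q f g - q f h.
Proof. by have := form_lin hq (-1) f h g; rewrite scaleN1r mulN1r addrC => ->; rewrite addrC. Qed.

Lemma formBl f g h : q (f - g) h = q f h - q g h.
Proof. by rewrite (form_conj hq) formBr rmorphB /= -!(form_conj hq). Qed.

Lemma formZr (a : R[i]) f g : q f (a *: g) = a * q f g.
Proof. by have := form_lin hq a f g 0; rewrite form0r !addr0. Qed.

Lemma formNr f g : q f (- g) = - q f g.
Proof. by have := formBr f 0 g; rewrite form0r !sub0r. Qed.

Lemma formNl f g : q (- f) g = - q f g.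
Proof. by rewrite (form_conj hq) formNr rmorphN /= -(form_conj hq). Qed.

(** Rescaling [g] to the norm of [f] turns a bound by the sum of the squares into
    a bound by the product. *)
Lemma form_bounded (K : R) :
  (forall f g, nrm (q f g : R[i]^o) <= K * (nrm f ^+ 2 + nrm g ^+ 2)) ->
  forall f g, nrm (q f g : R[i]^o) <= 2 * K * (nrm f * nrm g).
Proof.
move=> hK f g.
have [->|f0] := eqVneq f 0.
  by rewrite (form_conj hq) form0r nrmC_conj !nrm0 mul0r mulr0.
have [->|g0] := eqVneq g 0; first by rewrite form0r !nrm0 !mulr0.
have nf : 0 < nrm f.
  by rewrite lt_neqAle nrm_ge0 andbT eq_sym; apply: contra_neq f0 => /nrm0_eq0.
have ng : 0 < nrm g.
  by rewrite lt_neqAle nrm_ge0 andbT eq_sym; apply: contra_neq g0 => /nrm0_eq0.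
have r0 : 0 < nrm f / nrm g by rewrite divr_gt0.
have := hK f ((nrm f / nrm g)%:C *: g).
have e := form_lin hq ((nrm f / nrm g)%:C) f g 0.
rewrite form0r !addr0 in e; rewrite e nrmCM nrmC_real nrmRZ gtr0_norm//.
rewrite mulrVK ?unitfE ?gt_eqF// => h.
rewrite -(ler_pM2l r0) (le_trans h)// le_eqVlt; apply/orP; left; apply/eqP.
by field; rewrite gt_eqF.
Qed.

End HermitianForms.

Section FormContinuity.
Context {R : realType} {X : normedModType R[i]}.

Lemma cvg_nrm_le {T : Type} {F : set_system T} {FF : Filter F} 
  (u : T -> X) (l : X) (e : T -> R) :
  (forall t, nrm (u t - l) <= e t) -> e t @[t --> F] --> 0 -> u @ F --> l.
Proof.
move=> ue /cvgrPdist_lt e0; apply/cvg_nrmP => d d0; have := e0 d d0.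
apply: filterS => t; rewrite sub0r normrN; apply: le_lt_trans.
exact: le_trans (ue t) (ler_norm _).
Qed.

Lemma cvg_nrm0 {T : Type} {F : set_system T} {FF : Filter F} 
  (u : T -> X) (l : X) : u @ F --> l -> nrm (u t - l) @[t --> F] --> 0.
Proof.
move=> /cvg_nrmP ul; apply/cvgrPdist_lt => d d0; have := ul d d0.
by apply: filterS => t; rewrite sub0r normrN ger0_norm ?nrm_ge0.
Qed.

Lemma cvg_form (q : X -> X -> R[i]) (K : R) : hermitian_form q ->
  (forall f g, nrm (q f g : R[i]^o) <= K * (nrm f * nrm g)) ->
  forall {T : Type} {F : set_system T} {FF : Filter F} (u w : T -> X) f g,
  u @ F --> f -> w @ F --> g ->
  (fun t => q (u t) (w t) : R[i]^o) @ F --> (q f g : R[i]^o).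
Proof.
move=> hq hK T F FF u w f g uf wg.
apply/cvg_nrmP => e e0.
have : K * (nrm (u t - f) * nrm (w t)) + K * (nrm f * nrm (w t - g)) @[t --> F] --> (0 : R).
  rewrite -[0 in X in _ --> X](_ : K * (0 * nrm g) + K * (nrm f * 0) = 0); last by ring.
  apply: cvgD; apply: cvgMl_tmp; apply: cvgM.
  - exact: cvg_nrm0.
  - exact: cvg_nrm.
  - exact: cvg_cst.
  - exact: cvg_nrm0.
move=> /cvgrPdist_lt/(_ e e0); apply: filterS => t; rewrite sub0r normrN.
apply: le_lt_trans; apply: le_trans (ler_norm _).
have -> : q (u t) (w t) - q f g = q (u t - f) (w t) + q f (w t - g).
  by rewrite (formBl hq) (formBr hq) addrA subrK.
by rewrite (le_trans (nrmD (_ : R[i]^o) _))// lerD// hK.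
Qed.

End FormContinuity.

Section DualInnerProduct.
Context {R : realType} {H : hilbertType R}.
Implicit Types f g h : dual H.

Lemma ddot_hermitian : hermitian_form (@ddot R H).
Proof. by split=> [a f g h|f g]; [exact: ddotPr|exact: ddotC]. Qed.

Lemma cvg_ddot {T : Type} {F : set_system T} {FF : Filter F} (u w : T -> dual H) f g :
  u @ F --> f -> w @ F --> g ->
  (fun t => ddot (u t) (w t) : R[i]^o) @ F --> (ddot f g : R[i]^o).
Proof.
apply: (cvg_form ddot_hermitian (K := 1)) => // a b; rewrite mul1r; exact: nrm_ddot.
Qed.

End DualInnerProduct.

Section Reflection.
Context {R : realType}.
Notation mu := (@lebesgue_measure R).

Lemma ge0_integral_opp (f : R -> \bar R) (a b : R) :
  measurable_fun setT f -> (forall r, 0 <= f r)%E ->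
  (\int[mu]_(s in `[a, b]) f (- s)%R = \int[mu]_(s in `[(- b)%R, (- a)%R]) f s)%E.
Proof.
move=> mf f0; rewrite (_ : `[a, b]%classic =
    (-%R : _ -> measurableTypeR R) @^-1` `[(- b), (- a)]); last first.
  by rewrite opp_preimage_itvbndbnd !opprK.
rewrite -ge0_integral_pushforward//=; last exact: measurable_funS mf.
by apply: eq_measure_integral => //= D mD DS; exact: lebesgue_measureN.
Qed.

Lemma ae_opp (P : R -> Prop) : {ae mu, forall t, P t} -> {ae mu, forall t, P (- t)}.
Proof.
move=> [N [mN N0 PN]]; exists ((-%R : _ -> measurableTypeR R) @^-1` N); split.
- have mo : measurable_fun setT (-%R : R -> R) by exact: oppr_measurable.
  by have := mo measurableT N mN; rewrite setTI.
- by have := lebesgue_measureN mN; rewrite /pushforward => ->.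
- by move=> t /= nP; apply: PN.
Qed.

Lemma ae_eq_Rintegral (D : set R) (f g : R -> R) : measurable D ->
  mu.-integrable D (EFin \o f) -> mu.-integrable D (EFin \o g) ->
  {ae mu, forall t, f t = g t} ->
  \int[mu]_(t in D) f t = \int[mu]_(t in D) g t.
Proof.
move=> mD fi gi fg; congr fine; apply: ae_eq_integral => //.
- exact: measurable_int fi.
- exact: measurable_int gi.
- by apply: (ae_mono fg) => t e _; rewrite e.
Qed.

Lemma ae_eq_Cintegral (a b : R) (f g : R -> R[i]) :
  cintegrable a b f -> cintegrable a b g -> {ae mu, forall t, f t = g t} ->
  Cintegral a b f = Cintegral a b g.
Proof.
move=> [f1 f2] [g1 g2] fg; rewrite /Cintegral; congr (_ +i* _).
  by apply: ae_eq_Rintegral => //; apply: (ae_mono fg) => t ->.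
by apply: ae_eq_Rintegral => //; apply: (ae_mono fg) => t ->.
Qed.

Lemma dominated_integrable (D : set R) (f g : R -> R) : measurable D ->
  measurable_fun D f -> mu.-integrable D (EFin \o g) ->
  (forall t, D t -> `|f t| <= g t) -> mu.-integrable D (EFin \o f).
Proof.
move=> mD mf gi fg; have mF : measurable_fun D (EFin \o f) by exact/measurable_EFinP.
have h t : D t -> (`|(EFin \o f) t| <= `|(EFin \o g) t|)%E.
  by move=> Dt; rewrite /= lee_fin (le_trans (fg t Dt))// ler_norm.
exact: (@le_integrable _ _ _ mu D mD (EFin \o f) (EFin \o g) mF h gi).
Qed.

End Reflection.

Section Gramian.
Context {R : realType} {H U : hilbertType R}.
Variables (A : dcop H) (S : R -> bop H H) (B : bop U (dual (dom (adjoint A)))).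
Variables (alpha C1 C2 eps T : R).
Hypothesis gS : C0_group S.
Hypothesis genS : group_generator S A.
Hypothesis hE : is_BS_ext S B (BS_ext S B).
Hypothesis eps0 : 0 <= eps.
Hypothesis eps1 : eps < alpha.
Hypothesis C10 : 0 <= C1.
Hypothesis C21 : 1 <= C2.
Hypothesis T0 : 0 < T.
Implicit Types phi psi : dual H.
Notation mu := (@lebesgue_measure R).
Local Notation Sd := (adj_group S).
Local Notation E := (BS_ext S B).
Local Notation Lf := (Lambda_form S B alpha C1 C2 eps T).

Let cSd : strongly_continuous Sd := adj_strongly_continuous gS genS.
Let beta := alpha - eps.
Let c := C1 * expR (alpha * T).

Let beta0 : 0 < beta. Proof. by rewrite subr_gt0. Qed.
Let c0 : 0 <= c. Proof. by rewrite mulr_ge0// expR_ge0. Qed.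

Let Emeas phi : strongly_measurable (E phi).
Proof. by have [h _ _ _] := hE; have [] := h phi. Qed.

Let G phi psi (s : R) : R[i] :=
  (expR (- (beta * s)))%:C * ddot (E phi (- s)) (E psi (- s)).
Let N phi psi (t : R) : R[i] := ddot (Sd (- t) phi) (Sd (- t) psi).

Let LfE t phi psi : Lf t phi psi =
  c%:C * Cintegral 0 t (G phi psi) + (C2 * expR (- (beta * t)))%:C * N phi psi t.
Proof. by []. Qed.

Let sqE_measurable phi (D : set R) : measurable_fun D (fun s => nrm (E phi (- s)) ^+ 2).
Proof.
apply: measurable_funTS.
have m : measurable_fun setT (fun s => nrm (E phi s) ^+ 2).
  apply: (@strongly_measurable2 _ _ _ _ (fun a _ => nrm a ^+ 2) (Emeas phi) (Emeas phi)).
  by move=> u w a b ua _; apply: cvgM; exact: cvg_nrm.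
by apply: (measurableT_comp m); exact: oppr_measurable.
Qed.

Let sqE_bounded (tau : R) : exists M : R, forall phi,
  (\int[mu]_(s in `[0%R, tau]) (nrm (E phi (- s)) ^+ 2)%:E <= (M * nrm phi ^+ 2)%:E)%E.
Proof.
have [_ _ hb _] := hE.
have t1 : 0 < `|tau| + 1 by rewrite ltr_wpDl.
have [M hM] := hb _ t1; exists M => phi.
apply: le_trans (hM phi); rewrite /sqL2norm.
have m : measurable_fun setT (fun s => (nrm (E phi s) ^+ 2)%:E).
  apply/measurable_EFinP.
  apply: (@strongly_measurable2 _ _ _ _ (fun a _ => nrm a ^+ 2) (Emeas phi) (Emeas phi)).
  by move=> u w a b ua _; apply: cvgM; exact: cvg_nrm.
rewrite (@ge0_integral_opp _ (fun s => (nrm (E phi s) ^+ 2)%:E))//; last first.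
  by move=> r; rewrite lee_fin sqr_ge0.
apply: ge0_subset_integral => //.
- by apply: measurable_funTS m.
- by move=> s _; rewrite lee_fin sqr_ge0.
- apply: subset_itvScc; rewrite ?bnd_simp.
    by rewrite lerN2 (le_trans (ler_norm _))// lerDl.
  by rewrite oppr0 ltW.
Qed.

Let sqE_integrable phi (tau : R) :
  mu.-integrable `[0, tau] (EFin \o (fun s => nrm (E phi (- s)) ^+ 2)).
Proof.
have [M hM] := sqE_bounded tau; apply/integrableP; split.
  by apply/measurable_EFinP; exact: sqE_measurable.
rewrite (@le_lt_trans _ _ (M * nrm phi ^+ 2)%:E)// ?ltry//.
apply: le_trans (hM phi); apply: ge0_le_integral => //.
- by apply: measurableT_comp => //; apply/measurable_EFinP; exact: sqE_measurable.
- by apply/measurable_EFinP; exact: sqE_measurable.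
- by move=> s _; rewrite /= ger0_norm ?sqr_ge0.
Qed.

Let nrm_G phi psi s : 0 <= s ->
  nrm (G phi psi s : R[i]^o) <= nrm (E phi (- s)) ^+ 2 + nrm (E psi (- s)) ^+ 2.
Proof.
move=> s0; rewrite nrmCM nrmC_real gtr0_norm ?expR_gt0//.
have e1 : expR (- (beta * s)) <= 1.
  by rewrite -expR0 ler_expR oppr_le0 mulr_ge0// ltW.
rewrite (le_trans (ler_wpM2r (nrm_ge0 _) e1))// mul1r (le_trans (nrm_ddot _ _))//.
exact: mulr_le_sqrD.
Qed.

Let sum_integrable phi psi (tau : R) : mu.-integrable `[0, tau]
  (EFin \o (fun s => nrm (E phi (- s)) ^+ 2 + nrm (E psi (- s)) ^+ 2)).
Proof.
have mi : measurable (`[0, tau] : set (measurableTypeR R)) by [].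
exact: (@integrableD _ _ _ mu _ mi _ _ (sqE_integrable phi tau) (sqE_integrable psi tau)).
Qed.

Let G_integrable phi psi (tau : R) : cintegrable 0 tau (G phi psi).
Proof.
have meas (h : R[i]^o -> R) : (forall (u : nat -> R[i]^o) a, u @ \oo --> a ->
      h (u n) @[n --> \oo] --> h a) ->
    measurable_fun `[0, tau] (fun s => h (ddot (E phi (- s)) (E psi (- s)))).
  move=> hc; apply: measurable_funTS.
  have m : measurable_fun setT (fun s => h (ddot (E phi s) (E psi s))).
    apply: (@strongly_measurable2 _ _ _ _ (fun a b => h (ddot a b)) (Emeas phi) (Emeas psi)).
    by move=> u w a b ua wb; apply: hc; exact: cvg_ddot.
  by apply: (measurableT_comp m); exact: oppr_measurable.
have cexp : continuous (fun s => expR (- (beta * s))).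
  move=> s; apply: (@continuous_comp _ _ _ (fun s => - (beta * s)) expR).
    by apply: cvgN; apply: cvgMl_tmp.
  exact: continuous_expR.
have mexp : measurable_fun `[0, tau] (fun s => expR (- (beta * s))).
  by apply: measurable_funTS; exact: continuous_measurable_fun.
split; apply: (dominated_integrable _ _ (sum_integrable phi psi tau)) => //.
- have -> : (fun t => complex.Re (G phi psi t)) = (fun s => expR (- (beta * s)) *
    complex.Re (ddot (E phi (- s)) (E psi (- s)))).
    by apply/funext => s; rewrite Re_scale.
  by apply: measurable_funM => //; apply: meas => u a ua; exact: cvg_Re.
- move=> s /=; rewrite in_itv /= => /andP[s0 _].
  exact: le_trans (Re_le_nrm _) (nrm_G _ _ s0).
- have -> : (fun t => complex.Im (G phi psi t)) = (fun s => expR (- (beta * s)) *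
    complex.Im (ddot (E phi (- s)) (E psi (- s)))).
    apply/funext => s; rewrite /G; case: (ddot _ _) => x y /=.
    by rewrite mul0r addr0.
  by apply: measurable_funM => //; apply: meas => u a ua; exact: cvg_Im.
- move=> s /=; rewrite in_itv /= => /andP[s0 _].
  exact: le_trans (Im_le_nrm _) (nrm_G _ _ s0).
Qed.

Let N_ccont phi psi : ccont (N phi psi).
Proof.
apply: continuous_ccont => t; apply: cvg_ddot.
  exact: (strongly_continuous_opp cSd).1.
exact: (strongly_continuous_opp cSd).1.
Qed.

Lemma Lambda_hermitian t : hermitian_form (Lf t).
Proof.
split=> [a f g h|f g].
  rewrite !LfE.
  have -> : Cintegral 0 t (G f (a *: g + h)) =
      Cintegral 0 t (fun s => a * G f g s + G f h s).
    apply: ae_eq_Cintegral; [exact: G_integrable|apply: cintegrable_lin; exact: G_integrable|].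
    have [_ hl _ _] := hE.
    apply: (ae_mono (ae_opp (hl a g h))) => s e.
    by rewrite /G e ddotPr mulrDr mulrCA.
  rewrite Cintegral_lin; [|exact: G_integrable|exact: G_integrable].
  by rewrite /N bop_lin ddotPr; ring.
rewrite !LfE rmorphD !rmorphM /=.
have real (r : R) : Num.conj (r%:C : R[i]) = r%:C.
  by apply/eqP; rewrite eq_complex /= oppr0 !eqxx.
have NC : N f g t = Num.conj (N g f t) by exact: ddotC.
rewrite !real NC; suff -> : Cintegral 0 t (G f g) = Num.conj (Cintegral 0 t (G g f)) by [].
have -> : G f g = (fun s => Num.conj (G g f s)).
  by apply/funext => s; rewrite /G rmorphM /= real -ddotC.
apply/eqP; rewrite eq_complex /=; apply/andP; split; apply/eqP.
  by apply: eq_Rintegral => s _; rewrite Re_conj.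
rewrite -mulN1r -RintegralZl//; last by case: (G_integrable g f t).
by apply: eq_Rintegral => s _; rewrite mulN1r; case: (G g f s).
Qed.

Lemma Lambda_bounded : exists K : R, forall t phi psi, 0 <= t <= T ->
  nrm (Lf t phi psi : R[i]^o) <= 2 * K * (nrm phi * nrm psi).
Proof.
have [M hM] := sqE_bounded T.
have [M' [M'0 hM']] := locally_bounded_gt0 T cSd.2.
exists (c * M + C2 * M' ^+ 2) => t phi psi /andP[t0 tT].
apply: (form_bounded (Lambda_hermitian t)) => f g.
rewrite LfE (le_trans (nrmD (_ : R[i]^o) _))// !nrmCM !nrmC_real.
rewrite [leRHS]mulrDl; apply: lerD.
  rewrite ger0_norm// -mulrA ler_wpM2l//.
  have h1 := nrm_Cintegral_le (G_integrable f g t) (sum_integrable f g t).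
  have {h1} := h1 _; move=> /(_ (fun s st => nrm_G f g (andP st).1))/le_trans; apply.
  have int h : \int[mu]_(s in `[0, t]) (nrm (E h (- s)) ^+ 2) <= M * nrm h ^+ 2.
    rewrite -lee_fin /Rintegral fineK; last first.
      by apply: integrable_fin_num => //; exact: sqE_integrable.
    apply: le_trans (hM h); apply: ge0_subset_integral => //.
    - by apply/measurable_EFinP; exact: sqE_measurable.
    - by move=> s _; rewrite lee_fin sqr_ge0.
    - by apply: subset_itvScc; rewrite ?bnd_simp.
  by rewrite RintegralD// mulrDr lerD.
have e1 : expR (- (beta * t)) <= 1.
  by rewrite -expR0 ler_expR oppr_le0 mulr_ge0// ltW.
rewrite normrM (ger0_norm (le_trans ler01 C21)) gtr0_norm ?expR_gt0//.
rewrite -!mulrA ler_wpM2l ?(le_trans ler01 C21)//.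
rewrite (le_trans (ler_wpM2r (nrm_ge0 _) e1))// mul1r (le_trans (nrm_ddot _ _))//.
have hb h : nrm (Sd (- t) h) <= M' * nrm h by apply: hM'; rewrite normrN ger0_norm.
rewrite (le_trans (ler_pM (nrm_ge0 _) (nrm_ge0 _) (hb f) (hb g)))//.
rewrite mulrACA -mulrA !(ler_wpM2l (ltW M'0))//.
exact: mulr_le_sqrD.
Qed.

Lemma Lambda_integrable phi psi : cintegrable 0 T (fun t => Lf t phi psi).
Proof.
have i1 : cintegrable 0 T (fun t => Cintegral 0 t (G phi psi)).
  have [g1 g2] := G_integrable phi psi T.
  have cint := @continuous_compact_integrable R _ _ (@segment_compact R 0 T).
  split; apply: cint.
    exact: (@parameterized_integral_continuous R 0 T _ (ltW T0) g1).
  exact: (@parameterized_integral_continuous R 0 T _ (ltW T0) g2).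
have i2 : cintegrable 0 T (fun t => (C2 * expR (- (beta * t)))%:C * N phi psi t).
  apply: ccont_integrable; have [n1 n2] := N_ccont phi psi.
  have ce : continuous (fun t => C2 * expR (- (beta * t))).
    move=> s; apply: cvgMl_tmp; apply: (@continuous_comp _ _ _ (fun s => - (beta * s)) expR).
      by apply: cvgN; apply: cvgMl_tmp.
    exact: continuous_expR.
  split.
    have -> : (fun t => complex.Re ((C2 * expR (- (beta * t)))%:C * N phi psi t)) =
        (fun t => (C2 * expR (- (beta * t))) * complex.Re (N phi psi t)).
      by apply/funext => t; rewrite Re_scale.
    by move=> t; apply: cvgM; [exact: ce|exact: n1].
  have -> : (fun t => complex.Im ((C2 * expR (- (beta * t)))%:C * N phi psi t)) =
      (fun t => (C2 * expR (- (beta * t))) * complex.Im (N phi psi t)).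
    by apply/funext => t; case: (N phi psi t) => x y /=; rewrite mul0r addr0.
  by move=> t; apply: cvgM; [exact: ce|exact: n2].
exact: (cintegrable_lin c%:C i1 i2).
Qed.

Lemma Lambda_opP t phi psi : 0 <= t <= T ->
  psi (Lambda_op S B alpha C1 C2 eps T t phi) = Lf t phi psi.
Proof.
move=> t0; have [K hK] := Lambda_bounded; apply: of_bidualP.
  by move=> a f g; rewrite (form_lin (Lambda_hermitian t)).
by exists (2 * K * nrm phi) => f; rewrite -mulrA; exact: hK.
Qed.

Definition Pi_form phi psi : R[i] := Cintegral 0 T (fun t => Lf t phi psi).

Lemma Pi_hermitian : hermitian_form Pi_form.
Proof.
split=> [a f g h|f g]; rewrite /Pi_form.
  rewrite -Cintegral_lin; [|exact: Lambda_integrable|exact: Lambda_integrable].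
  by congr Cintegral; apply/funext => t; rewrite (form_lin (Lambda_hermitian t)).
have -> : (fun t => Lf t f g) = (fun s => Num.conj (Lf s g f)).
  by apply/funext => s; rewrite (form_conj (Lambda_hermitian s)).
apply/eqP; rewrite eq_complex /=; apply/andP; split; apply/eqP.
  by apply: eq_Rintegral => s _; rewrite Re_conj.
rewrite -mulN1r -RintegralZl//; last by case: (Lambda_integrable g f).
by apply: eq_Rintegral => s _; rewrite mulN1r; case: (Lf s g f).
Qed.

Lemma Pi_bounded : exists K : R, 0 < K /\ forall phi psi,
  nrm (Pi_form phi psi : R[i]^o) <= K * (nrm phi * nrm psi).
Proof.
have [K hK] := Lambda_bounded; exists (T * (`|2 * K| + 1)).
split=> [|phi psi]; first by rewrite mulr_gt0// ltr_wpDl.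
pose L := (`|2 * K| + 1) * (nrm phi * nrm psi).
rewrite -mulrA -/L; have -> : T * L = \int[mu]_(t in `[0, T]) L.
  by rewrite int_cst ?(ltW T0)// subr0 mulrC.
apply: nrm_Cintegral_le; first exact: Lambda_integrable.
  by apply: continuous_integrable; exact: cst_continuous.
move=> t /hK h; rewrite (le_trans (h _ _))// ler_wpM2r ?mulr_ge0 ?nrm_ge0//.
by rewrite (le_trans (ler_norm _))// lerDl.
Qed.

Lemma Pi_opP phi psi : psi (Pi_op S B alpha C1 C2 eps T phi) = Pi_form phi psi.
Proof.
have [K [K0 hK]] := Pi_bounded.
have e (f : dual H) : Cintegral 0 T (fun t => f (Lambda_op S B alpha C1 C2 eps T t phi)) =
    Pi_form phi f.
  rewrite /Pi_form /Cintegral; congr (_ +i* _);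
    by apply: eq_Rintegral => t /set_mem /=; rewrite in_itv /= => tT; rewrite Lambda_opP.
rewrite /Pi_op of_bidualP ?e//.
  by move=> a f g; rewrite !e (form_lin Pi_hermitian).
by exists (K * nrm phi) => f; rewrite e -mulrA; exact: hK.
Qed.


(** The weight [expR (beta * s)] makes the densities of the states [S^* r phi]
    and [S^* r psi] the translates by [r] of those of [phi] and [psi], up to the
    factor [expR (- (beta * r))]. *)
Definition obs_density (phi psi : dom (adjoint A)) (s : R) : R :=
  expR (beta * s) * complex.Re (ddot (BS S B phi s) (BS S B psi s)).
Definition adj_density phi psi (s : R) : R :=
  expR (beta * s) * complex.Re (ddot (Sd s phi) (Sd s psi)).

Let cexp : continuous (fun s => expR (beta * s)).
Proof.
move=> s; apply: (@continuous_comp _ _ _ (fun s => beta * s) expR).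
  exact: cvgMl_tmp.
exact: continuous_expR.
Qed.

Lemma obs_density_continuous (phi psi : dom (adjoint A)) : continuous (obs_density phi psi).
Proof.
have [h _] : ccont (fun t => ddot (BS S B phi t) (BS S B psi t)).
  apply: continuous_ccont => t; apply: cvg_ddot.
    exact: (BS_continuous gS genS (B := B) (phi := phi)).
  exact: (BS_continuous gS genS (B := B) (phi := psi)).
by move=> s; apply: cvgM; [exact: cexp|exact: h].
Qed.

Lemma adj_density_continuous phi psi : continuous (adj_density phi psi).
Proof.
have [h _] : ccont (fun t => ddot (Sd t phi) (Sd t psi)).
  by apply: continuous_ccont => t; apply: cvg_ddot; exact: cSd.1.
by move=> s; apply: cvgM; [exact: cexp|exact: h].
Qed.

Lemma Re_Lambda_dom (phi psi : dom (adjoint A)) (t : R) : 0 <= t ->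
  complex.Re (Lf t (dval phi) (dval psi)) =
  c * \int[mu]_(s in `[- t, 0]) obs_density phi psi s +
  C2 * adj_density (dval phi) (dval psi) (- t).
Proof.
move=> t0; rewrite LfE Re_add !Re_scale /adj_density mulrN mulrA; congr (_ * _ + _).
have -> : \int[mu]_(s in `[- t, 0]) obs_density phi psi s =
    \int[mu]_(s in `[0, t]) obs_density phi psi (- s).
  by rewrite -(int_opp (@obs_density_continuous phi psi) t0) oppr0.
apply: ae_eq_Rintegral => //.
- by have [] := G_integrable (dval phi) (dval psi) t.
- apply: continuous_integrable => s; apply: (@continuous_comp _ _ _ -%R (obs_density phi psi)).
    exact: cvgN.
  exact: obs_density_continuous.
have [_ _ _ hd] := hE.
apply: (ae_mono (ae_opp (ae_and (hd phi) (hd psi)))) => s [e1 e2].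
by rewrite /G Re_scale e1 e2 /obs_density mulrN.
Qed.


Hypothesis observable : forall (t : R) (phi : dom (adjoint A)), 0 < t ->
  ((nrm (badj (S t) (dval phi)) ^+ 2)%:E <=
    C1%:E * sqL2norm `[0%R, t] (BS S B phi) +
    (C2 * expR (- (alpha * t)) * nrm (dval phi) ^+ 2)%:E)%E.

Let csq (phi : dom (adjoint A)) : continuous (fun t => nrm (BS S B phi t) ^+ 2).
Proof.
have h := BS_continuous gS genS (B := B) (phi := phi).
by move=> t; apply: cvgM; exact: (continuous_nrm h).
Qed.

(** Observability of the state [S^* (- t) phi], whose orbit over [[0, t]] is that
    of [phi] over [[- t, 0]]. *)
Let observable_back (phi : dom (adjoint A)) (t : R) : 0 < t ->
  nrm (dval phi) ^+ 2 <= C1 * \int[mu]_(s in `[- t, 0]) (nrm (BS S B phi s) ^+ 2) +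
    C2 * expR (- (alpha * t)) * nrm (Sd (- t) (dval phi)) ^+ 2.
Proof.
move=> t0; have := observable (dom_orbit gS genS phi (- t)) t0.
have -> : badj (S t) (dval (dom_orbit gS genS phi (- t))) = dval phi.
  have [g0 gD _] := gS; apply: bop_ext => x.
  by transitivity (dval phi (S (- t) (S t x))); rewrite // -gD addNr g0.
have -> : BS S B (dom_orbit gS genS phi (- t)) = fun s => BS S B phi (s + - t).
  by apply/funext => s; rewrite BS_group addrC.
rewrite sqL2norm_continuous; last first.
  move=> s; apply: (@continuous_comp _ _ _ (fun s => s - t) (BS S B phi)).
    by apply: cvgB => //; exact: cvg_cst.
  exact: (BS_continuous gS genS).
rewrite -EFinM -EFinD lee_fin.
suff -> : \int[mu]_(s in `[- t, 0]) (nrm (BS S B phi s) ^+ 2) =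
  \int[mu]_(s in `[0, t]) (nrm (BS S B phi (s + - t)) ^+ 2) by [].
rewrite -(int_shift (f := fun s => nrm (BS S B phi s) ^+ 2))//; last exact: ltW.
by rewrite add0r subrr.
Qed.

(** This is [observable_back] multiplied by [expR (eps * t)]: on [[- t, 0]] the
    weight of the observation is at least [expR (- (beta * t))], and
    [alpha * T] in the constant leaves room for [alpha * t]. *)
Let Lambda_ge_dom (phi : dom (adjoint A)) (t : R) : 0 <= t <= T ->
  expR (eps * t) * nrm (dval phi) ^+ 2 <= complex.Re (Lf t (dval phi) (dval phi)).
Proof.
move=> /andP[]; rewrite le_eqVlt => /predU1P[<- _|t0 tT].
  rewrite Re_Lambda_dom// oppr0 int_empty// mulr0 expR0 mul1r mulr0 add0r.
  rewrite /adj_density mulr0 expR0 mul1r ddotxx.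
  have -> : Sd 0 (dval phi) = dval phi.
    by have [g0 _ _] := adj_group_C0 gS genS; exact: g0.
  by rewrite ler_peMl ?sqr_ge0.
rewrite Re_Lambda_dom ?(ltW t0)// /adj_density ddotxx.
have ebt : expR (eps * t) * expR (- (alpha * t)) = expR (beta * - t).
  by rewrite -expRD; congr expR; rewrite /beta; ring.
have eaT : expR (eps * t) * C1 <= c * expR (beta * - t).
  rewrite /c mulrC -mulrA -expRD ler_wpM2l// ler_expR.
  have aT : alpha * t <= alpha * T by rewrite ler_wpM2l// (le_trans eps0 (ltW eps1)).
  by rewrite (_ : beta * - t = eps * t - alpha * t) /beta; [lra|ring].
have := observable_back phi t0; rewrite -(ler_pM2l (expR_gt0 (eps * t))).
move=> /le_trans; apply; rewrite mulrDr; apply: lerD; last first.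
  by rewrite -ebt !mulrA (mulrC C2).
have obs0 : 0 <= \int[mu]_(s in `[- t, 0]) (nrm (BS S B phi s) ^+ 2).
  by apply: Rintegral_ge0 => s _; exact: sqr_ge0.
rewrite mulrA (le_trans (ler_wpM2r obs0 eaT))// -mulrA ler_wpM2l// -intZ//.
apply: int_le => [s||s /andP[st _]].
- by apply: cvgM; [exact: cvg_cst|exact: csq].
- exact: obs_density_continuous.
- rewrite /obs_density ddotxx ler_wpM2r ?sqr_ge0// ler_expR.
  by rewrite ler_wpM2l// ltW.
Qed.

Lemma adj_dom_approx (f : dual H) :
  exists g : nat -> dom (adjoint A), (fun n => dval (g n)) @ \oo --> f.
Proof.
have h n : exists g : dom (adjoint A), nrm (f - dval g) <= 1 * 2^-1 ^+ n.
  have p : 0 < 2^-1 ^+ n :> R by rewrite exprn_gt0.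
  have [g [dg gf]] := adj_dom_dense gS genS f p.
  by exists (Dom (mem_set dg)); rewrite mul1r ltW.
exists (fun n => projT1 (cid (h n))); apply/cvg_nrmP => e e0.
apply: filterS (halfpow_lt 1 e0) => n; apply: le_lt_trans.
by rewrite nrm_sub; exact: (projT2 (cid (h n))).
Qed.

Lemma Lambda_ge t phi : 0 <= t <= T ->
  expR (eps * t) * nrm phi ^+ 2 <= complex.Re (Lf t phi phi).
Proof.
move=> tT; have [g gphi] := adj_dom_approx phi.
have [K hK] := Lambda_bounded.
have l1 : expR (eps * t) * nrm (dval (g n)) ^+ 2 @[n --> \oo] -->
    expR (eps * t) * nrm phi ^+ 2.
  by apply: cvgMl_tmp; apply: cvgM; exact: cvg_nrm.
have l2 : complex.Re (Lf t (dval (g n)) (dval (g n))) @[n --> \oo] -->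
    complex.Re (Lf t phi phi).
  apply: cvg_Re; apply: (cvg_form (Lambda_hermitian t) (K := 2 * K)) => // a b.
  exact: hK.
apply: (ler_cvg_to l1 l2); apply: nearW => n; exact: Lambda_ge_dom.
Qed.

Lemma Pi_ge phi : T * nrm phi ^+ 2 <= complex.Re (Pi_form phi phi).
Proof.
rewrite /Pi_form /Cintegral /=.
have -> : T * nrm phi ^+ 2 = \int[mu]_(t in `[0, T]) (nrm phi ^+ 2).
  by rewrite int_cst ?(ltW T0)// subr0 mulrC.
apply: le_Rintegral => //.
- by apply: continuous_integrable; exact: cst_continuous.
- by have [] := Lambda_integrable phi phi.
move=> t; rewrite /= in_itv /= => tT; apply: le_trans (Lambda_ge phi tT).
by rewrite ler_peMl ?sqr_ge0// -expR0 ler_expR mulr_ge0//; case/andP: tT.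
Qed.

End Gramian.

(** * Coercive forms and Lyapunov functions *)

Section QuotientLimits.
Context {R : realType} {X : normedModType R[i]}.

Lemma cvg_id_at_right0 : (fun h : R => h) @ 0^'+ --> (0 : R).
Proof. by apply: cvg_at_right_filter; exact: cvg_id. Qed.

Lemma cvg_eq_right (f g : R -> X) (l : X) : (forall h, 0 < h -> f h = g h) ->
  f h @[h --> 0^'+] --> l -> g h @[h --> 0^'+] --> l.
Proof.
move=> fg; apply: cvg_trans; apply: near_eq_cvg; near=> h.
by apply: fg; near: h; exact: nbhs_right_gt.
Unshelve. all: by end_near. Qed.

Lemma is_derive_expR_lin (b t : R) :
  is_derive t 1 (fun r => expR (b * r)) (b * expR (b * t)).
Proof.
have e : is_derive t 1 (b \*: @idfun R) (b *: (1 : R)) by exact: is_deriveZ.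
rewrite mulrC -[X in _ * X]mulr1.
exact: (@is_derive1_comp _ expR (b \*: @idfun R) t _ _ (is_derive_expR _) e).
Qed.

Lemma derive_quotient (f : R -> R) (t d : R) : is_derive t 1 f d ->
  h^-1 * (f (t + h) - f t) @[h --> 0^'] --> d.
Proof.
move=> [df dv]; rewrite -dv; apply: cvg_eq_fun df => h.
by rewrite -[LHS]/(h^-1 * (f (h * 1 + t) - f t)) mulr1 (addrC h).
Qed.

Lemma derive_quotient_right (f : R -> R) (t d : R) : is_derive t 1 f d ->
  h^-1 * (f (t + h) - f t) @[h --> 0^'+] --> d.
Proof.
move=> /derive_quotient; apply: cvg_trans; apply: cvg_app => V.
have sub (h : R) : (h != 0 -> V h) -> 0 < h -> V h by move=> Vh h0; apply: Vh; rewrite gt_eqF.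
by move=> /(filterS sub).
Qed.

Lemma derive_quotient_opp (f : R -> R) (d : R) : is_derive (0 : R) 1 f d ->
  h^-1 * (f (- h) - f 0) @[h --> 0^'+] --> - d.
Proof.
move=> /derive_quotient/cvg_at0_opp/cvgN; apply: cvg_eq_fun => h.
by rewrite /GRing.opp /= -/(- _) add0r invrN mulNr opprK.
Qed.

Lemma quotient_cvg (u : R -> X) (u0 u' : X) :
  (h^-1)%:C *: (u h - u0) @[h --> 0^'+] --> u' -> u h @[h --> 0^'+] --> u0.
Proof.
move=> uq; apply/cvg_nrmP => e e0.
have : h * nrm ((h^-1)%:C *: (u h - u0)) @[h --> 0^'+] --> (0 : R).
  rewrite -[0 in X in _ --> X](mul0r (nrm u')); apply: cvgM; last exact: cvg_nrm.
  exact: cvg_id_at_right0.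
move=> /cvgrPdist_lt/(_ e e0) near1; near=> h.
have h0 : 0 < h by near: h; exact: nbhs_right_gt.
suff -> : nrm (u h - u0) = `|0 - h * nrm ((h^-1)%:C *: (u h - u0))|.
  by near: h.
rewrite sub0r normrN nrmRZ normrM ger0_norm ?(ltW h0)// normrM normr_id.
by rewrite (ger0_norm (nrm_ge0 _)) gtr0_norm ?invr_gt0// mulVKf// gt_eqF.
Unshelve. all: by end_near. Qed.

Lemma cvg_realZ {T : Type} {F : set_system T} {FF : Filter F} (a : T -> R)
  (w : T -> X) (a0 : R) (w0 : X) : a @ F --> a0 -> w @ F --> w0 ->
  (fun t => (a t)%:C *: w t) @ F --> a0%:C *: w0.
Proof.
move=> aa ww; apply: (@cvg_nrm_le _ _ _ _ _ _ _
  (fun t => `|a t - a0| * nrm (w t) + `|a0| * nrm (w t - w0))).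
  move=> t; have -> : (a t)%:C *: w t - a0%:C *: w0 =
      (a t - a0)%:C *: w t + a0%:C *: (w t - w0).
    by rewrite rmorphB scalerBl scalerBr addrA subrK.
  by rewrite (le_trans (nrmD _ _))// !nrmRZ.
rewrite -[0 in X in _ --> X](_ : `|a0 - a0| * nrm w0 + `|a0| * 0 = 0); last first.
  by rewrite subrr normr0 mul0r mulr0 addr0.
apply: cvgD.
  apply: cvgM; last exact: cvg_nrm.
  by apply: cvg_norm; apply: cvgB => //; exact: cvg_cst.
by apply: cvgMl_tmp; exact: cvg_nrm0.
Qed.

Lemma form_quotient (q : X -> X -> R[i]) (K : R) (u w : R -> X) (u0 w0 u' w' : X) :
  hermitian_form q ->
  (forall f g, nrm (q f g : R[i]^o) <= K * (nrm f * nrm g)) ->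
  (h^-1)%:C *: (u h - u0) @[h --> 0^'+] --> u' ->
  (h^-1)%:C *: (w h - w0) @[h --> 0^'+] --> w' ->
  h^-1 * (complex.Re (q (u h) (w h)) - complex.Re (q u0 w0)) @[h --> 0^'+] -->
    complex.Re (q u' w0) + complex.Re (q u0 w').
Proof.
move=> hq hK uu ww.
have h1 : complex.Re (q ((h^-1)%:C *: (u h - u0)) (w h)) @[h --> 0^'+] -->
    complex.Re (q u' w0).
  apply: cvg_Re; apply: (cvg_form hq hK) => //; exact: quotient_cvg ww.
have h2 : complex.Re (q u0 ((h^-1)%:C *: (w h - w0))) @[h --> 0^'+] -->
    complex.Re (q u0 w').
  by apply: cvg_Re; apply: (cvg_form hq hK) => //; exact: cvg_cst.
apply: cvg_eq_fun (cvgD h1 h2) => h /=.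
have zl : q ((h^-1)%:C *: (u h - u0)) (w h) = (h^-1)%:C * q (u h - u0) (w h).
  have := form_linl hq (h^-1)%:C (u h - u0) 0 (w h).
  rewrite addr0 => ->; rewrite (form_conj hq 0) (form0r hq) conjC0 addr0.
  by congr (_ * _); apply/eqP; rewrite eq_complex /= oppr0 !eqxx.
have zr : q u0 ((h^-1)%:C *: (w h - w0)) = (h^-1)%:C * q u0 (w h - w0).
  by have := form_lin hq (h^-1)%:C u0 (w h - w0) 0; rewrite addr0 (form0r hq) addr0.
rewrite -[LHS]/(complex.Re (q ((h^-1)%:C *: (u h - u0)) (w h)) +
  complex.Re (q u0 ((h^-1)%:C *: (w h - w0)))).
rewrite zl zr !Re_scale (formBl hq) (formBr hq) -mulrDr.
by rewrite !Re_add !Re_opp addrA subrK.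
Qed.

Lemma right_quotient_mul (f g : R -> R) (t a b : R) : continuous g ->
  h^-1 * (f (t + h) - f t) @[h --> 0^'+] --> a ->
  h^-1 * (g (t + h) - g t) @[h --> 0^'+] --> b ->
  h^-1 * (f (t + h) * g (t + h) - f t * g t) @[h --> 0^'+] --> a * g t + f t * b.
Proof.
move=> cg fa gb.
have gt : g (t + h) @[h --> 0^'+] --> g t.
  rewrite -[t in X in _ --> X]addr0; apply: cvg_at_right_filter.
  apply: (@continuous_comp _ _ _ (fun h => t + h) g); last exact: cg.
  by apply: cvgD; [exact: cvg_cst|exact: cvg_id].
have l1 : h^-1 * (f (t + h) - f t) * g (t + h) @[h --> 0^'+] --> a * g t.
  exact: cvgM fa gt.
have l2 : f t * (h^-1 * (g (t + h) - g t)) @[h --> 0^'+] --> f t * b.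
  exact: cvgMl_tmp.
by apply: cvg_eq_fun (cvgD l1 l2) => h; rewrite -[LHS]/(_ + _); ring.
Qed.

(** Comparison principle: at the supremum [s] of the times up to which the
    chord slope from [a] stays below [e], the right derivative would let the
    bound persist beyond [s]. *)
Lemma right_derivative_le0 (f d : R -> R) (a b : R) : continuous f ->
  (forall t, a <= t -> h^-1 * (f (t + h) - f t) @[h --> 0^'+] --> d t) ->
  (forall t, a <= t -> d t <= 0) -> a <= b -> f b <= f a.
Proof.
move=> cf df d0 ab; apply/ler_addgt0Pl => e' e'0.
(* The slope [e] allows an increase of at most [e'] over [[a, b]]; the term [1]
   covers [a = b]. *)
pose e := e' / (b - a + 1).
have ba1 : 0 < b - a + 1 by rewrite ltr_wpDl// subr_ge0.
have e0 : 0 < e by rewrite divr_gt0.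
suff: f b - f a <= e * (b - a).
  have : e * (b - a) <= e' by rewrite /e mulrAC ler_pdivrMr// ler_wpM2l ?(ltW e'0)// lerDl.
  by move=> h1 h2; rewrite addrC -lerBlDl (le_trans h2).
pose E := [set t | a <= t <= b /\ forall s, a <= s <= t -> f s - f a <= e * (s - a)].
have Ea : E a.
  split; first by rewrite lexx.
  by move=> s /andP[h1 h2]; rewrite (@le_anti _ _ s a) ?h1 ?h2// !subrr mulr0.
have hsE : has_sup E by split; [exists a|exists b => t [/andP[]]].
pose tau := sup E.
have atau : a <= tau by exact: sup_upper_bound.
have taub : tau <= b by apply: ge_sup; [exists a|move=> t [/andP[]]].
have below s : a <= s -> s < tau -> f s - f a <= e * (s - a).
  move=> sa stau; have [t [Et1 Et2] st] := sup_gt (ex_intro _ a Ea) stau.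
  by apply: Et2; rewrite sa ltW.
have at_tau : f tau - f a <= e * (tau - a).
  have [->|ne] := eqVneq tau a; first by rewrite !subrr mulr0.
  have lt : a < tau by rewrite lt_neqAle eq_sym ne.
  have c1 : f s - f a @[s --> tau^'-] --> f tau - f a.
    apply: cvgB; last exact: cvg_cst.
    by apply: cvg_at_left_filter; exact: cf.
  have c2 : e * (s - a) @[s --> tau^'-] --> e * (tau - a).
    apply: cvgMl_tmp; apply: cvgB; last exact: cvg_cst.
    by apply: cvg_at_left_filter; exact: cvg_id.
  apply: (ler_cvg_to c1 c2); near=> s; apply: below.
    by apply: ltW; near: s; exact: nbhs_left_gt.
  by near: s; exact: nbhs_left_lt.
move: taub; rewrite le_eqVlt => /predU1P[<-//|taub].
exfalso.
have dt : d tau < e by rewrite (le_lt_trans (d0 _ atau)).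
have [/= dl dl0 Hd] : nbhs 0^'+ (fun h => h^-1 * (f (tau + h) - f tau) < e).
  by have := df tau atau; move/cvgr_lt => /(_ _ dt).
pose t1 := Num.min b (tau + dl / 2).
have t1gt : tau < t1 by rewrite lt_min taub ltrDl divr_gt0.
suff : E t1 by move=> /(sup_upper_bound hsE); rewrite leNgt t1gt.
split; first by rewrite (le_trans atau (ltW t1gt)) ge_min lexx.
move=> s /andP[as_ st1]; case: (leP s tau) => [stau|taus].
  move: stau; rewrite le_eqVlt => /predU1P[->//|stau]; exact: below.
have := Hd (s - tau); rewrite /= sub0r normrN.
have s0 : 0 < s - tau by rewrite subr_gt0.
have sdl : `|s - tau| < dl.
  rewrite gtr0_norm// ltrBlDl (le_lt_trans st1)// gt_min; apply/orP; right.
  by rewrite ltrD2l ltr_pdivrMr// ltr_pMr// ltr1n.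
move=> /(_ sdl s0); rewrite (subrKC tau s) ltr_pdivrMl// => h1.
have -> : f s - f a = (f s - f tau) + (f tau - f a) by rewrite addrA subrK.
have -> : e * (s - a) = (s - tau) * e + e * (tau - a) by ring.
by rewrite lerD// ltW.
Unshelve. all: by end_near. Qed.

End QuotientLimits.


Lemma dom_funB (R : realType) (X : normedModType R[i]) (L : lop X) (u v : dom L) :
  lfun L (dval (u - v)) = lfun L (dval u) - lfun L (dval v).
Proof. by rewrite dom_funD -scaleN1r dom_funZ scaleN1r. Qed.

Section ConjugateLinear.
Context {R : realType} {X Y : normedModType R[i]}.
Variable F : X -> Y.
Variable M : R.
Hypothesis Flin : forall (a : R[i]) f g, F (a *: f + g) = Num.conj a *: F f + F g.
Hypothesis FM : forall f, nrm (F f) <= M * nrm f.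

Lemma conj_lin0 : F 0 = 0.
Proof.
have := Flin 1 0 0; rewrite scale1r addr0 conjC1 scale1r => /eqP.
by rewrite -subr_eq subrr eq_sym => /eqP.
Qed.

Lemma conj_linB f g : F (f - g) = F f - F g.
Proof. by have := Flin (-1) g f; rewrite rmorphN rmorph1 !scaleN1r addrC [RHS]addrC. Qed.

Lemma conj_linZ (a : R) f : F (a%:C *: f) = a%:C *: F f.
Proof.
have := Flin a%:C f 0; rewrite conj_lin0 !addr0 => ->; congr (_ *: _).
by apply/eqP; rewrite eq_complex /= oppr0 !eqxx.
Qed.

Lemma cvg_conj_lin {T : Type} {G : set_system T} {FG : Filter G} (u : T -> X) f :
  u @ G --> f -> (fun t => F (u t)) @ G --> F f.
Proof.
move=> uf; apply: (@cvg_nrm_le _ _ _ _ _ _ _ (fun t => M * nrm (u t - f))).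
  by move=> t; rewrite -conj_linB.
rewrite -[0 in X in _ --> X](mulr0 M); apply: cvgMl_tmp; exact: cvg_nrm0.
Qed.

End ConjugateLinear.

(** The operator [L] with [psi (L phi) = q phi psi] is a conjugate-linear
    isomorphism; it is onto because the energy [q psi psi / 2 - Re (psi h)] has a
    minimiser, which solves [L phi = h]. *)
Section CoerciveForms.
Context {R : realType} {H : hilbertType R}.
Variables (q : dual H -> dual H -> R[i]) (K k : R) (L : dual H -> H).
Hypothesis hq : hermitian_form q.
Hypothesis K0 : 0 < K.
Hypothesis qK : forall f g, nrm (q f g : R[i]^o) <= K * (nrm f * nrm g).
Hypothesis k0 : 0 < k.
Hypothesis qk : forall f, k * nrm f ^+ 2 <= complex.Re (q f f).
Hypothesis Lq : forall f g : dual H, g (L f) = q f g.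

Lemma form_op_lin (a : R[i]) f g : L (a *: f + g) = Num.conj a *: L f + L g.
Proof. by apply: dual_sep => psi; rewrite dual_lin !Lq (form_linl hq). Qed.

Lemma nrm_form_op f : nrm (L f) <= K * nrm f.
Proof.
apply: nrm_dual_le => [|psi]; first by rewrite mulr_ge0 ?nrm_ge0// ltW.
by rewrite Lq -mulrA.
Qed.

Lemma nrm_form_op_ge f : k * nrm f <= nrm (L f).
Proof.
have [->|f0] := eqVneq (nrm f) 0; first by rewrite mulr0 nrm_ge0.
have nf : 0 < nrm f by rewrite lt_neqAle eq_sym f0 nrm_ge0.
rewrite -(ler_pM2r nf) -mulrA -expr2 (le_trans (qk f))// -Lq.
rewrite (le_trans (ler_norm _))// (le_trans (Re_le_nrm _))//.
by rewrite (le_trans (nrm_bop _ _))// mulrC.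
Qed.

Lemma form_op_inj f g : L f = L g -> f = g.
Proof.
move=> fg; apply/eqP; rewrite -subr_eq0; apply/eqP/nrm0_eq0/eqP.
rewrite eq_le nrm_ge0 andbT -(pmulr_rle0 _ k0) (le_trans (nrm_form_op_ge _))//.
by rewrite (conj_linB form_op_lin) fg subrr nrm0.
Qed.

Lemma form_op_surj h : exists f, L f = h.
Proof.
pose b f g := complex.Re (q g f).
have [|||||||||u [_ hu]] := @variational R (dual H) setT b (fun f : dual H => complex.Re (f h))
  k K (nrm h) dual_geo_complete.
- by [].
- by [].
- by move=> x y; rewrite /b (form_conj hq) Re_conj.
- by move=> a x y z; rewrite /b (form_lin hq) Re_add Re_scale.
- by move=> a x y; rewrite bopDE bopZE Re_add -Re_scale.
- exact: k0.
- by move=> x; exact: qk.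
- move=> x y; rewrite (le_trans (Re_le_nrm _))// (le_trans (qK _ _))//.
  by rewrite -mulrA [nrm y * _]mulrC.
- move=> x; rewrite (le_trans (Re_le_nrm _))// (le_trans (nrm_bop _ _))//.
  by rewrite mulrC.
exists u; apply: dual_sep => psi; rewrite Lq.
apply: complex_eq_Re; first by rewrite [RHS]hu.
have := hu ('i *: psi) I; rewrite /b bopZE => ->.
by have := form_lin hq 'i u psi 0; rewrite addr0 (form0r hq) addr0 => ->.
Qed.

Let Linv : H -> dual H := 'pinv_(fun=> 0) setT L.

Lemma form_opK f : Linv (L f) = f.
Proof. by apply: pinvKV; rewrite ?inE// => x y _ _; exact: form_op_inj. Qed.

Lemma form_op_invK h : L (Linv h) = h.
Proof.
have [f <-] := form_op_surj h.
by apply: pinvK; rewrite inE; exists f.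
Qed.

Lemma form_op_inv_lin (a : R[i]) x y :
  Linv (a *: x + y) = Num.conj a *: Linv x + Linv y.
Proof. by apply: form_op_inj; rewrite form_op_lin !form_op_invK conjCK. Qed.

Lemma nrm_form_op_inv x : nrm (Linv x) <= k^-1 * nrm x.
Proof.
by rewrite ler_pdivlMl// (le_trans (nrm_form_op_ge _))// form_op_invK.
Qed.

End CoerciveForms.


(** A form equivalent to the square of the norm and decreasing along orbits at
    the relative rate [beta] makes the norm decrease at the rate [beta / 2]. If
    moreover the output [F] is paid for by the decrease, its square is
    integrable along every orbit of the domain. *)
Section Lyapunov.
Context {R : realType} {H : hilbertType R} {U : normedModType R[i]}.
Variables (V : R -> bop H H) (L : lop H) (F : bop (dom L) U) (E : H -> H -> R[i]).
Variables (KE m beta k : R).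
Hypothesis C0V : C0_semigroup V.
Hypothesis cV : forall x, continuous (fun t => V t x).
Hypothesis gV : semigroup_generator V L.
Hypothesis Ldense : forall x (e : R), 0 < e -> exists y, ldom L y /\ nrm (x - y) < e.
Hypothesis hE : hermitian_form E.
Hypothesis KE0 : 0 < KE.
Hypothesis E_le : forall x y, nrm (E x y : R[i]^o) <= KE * (nrm x * nrm y).
Hypothesis m0 : 0 < m.
Hypothesis E_ge : forall x, m * nrm x ^+ 2 <= complex.Re (E x x).
Hypothesis k0 : 0 <= k.
Hypothesis dissipation : forall u : dom L,
  complex.Re (E (lfun L (dval u)) (dval u)) + complex.Re (E (dval u) (lfun L (dval u))) <=
  - beta * complex.Re (E (dval u) (dval u)).
Hypothesis observation : forall u : dom L, nrm (F u) ^+ 2 <=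
  - k * (complex.Re (E (lfun L (dval u)) (dval u)) +
         complex.Re (E (dval u) (lfun L (dval u)))).
Notation mu := (@lebesgue_measure R).

Let orbit_generator (u : dom L) (t : R) : 0 <= t ->
  (h^-1)%:C *: (V (t + h) (dval u) - V t (dval u)) @[h --> 0^'+] -->
  V t (lfun L (dval u)).
Proof.
have [_ vD _] := C0V => t0.
have [/(_ (conj (domP u) erefl)) q _] := gV (dval u) (lfun L (dval u)).
apply: cvg_eq_right (cvg_bop (V t) q) => h h0.
by rewrite bop_scale bop_sub -vD// ltW.
Qed.

(* Absolute values of times extend the forward orbit to a continuous curve on
   the whole line. *)
Let orbit_ex (u : dom L) (t : R) : exists v : dom L,
  dval v = V `|t| (dval u) /\ lfun L (dval v) = V `|t| (lfun L (dval u)).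
Proof.
have [_ vD _] := C0V; have t0 := normr_ge0 t.
suff [Lv e] : ldom L (V `|t| (dval u)) /\
    lfun L (V `|t| (dval u)) = V `|t| (lfun L (dval u)).
  by exists (Dom (mem_set Lv)).
apply: (gV _ _).2; apply: cvg_eq_right (@orbit_generator u _ t0) => h h0.
by rewrite (addrC `|t|) vD ?(ltW h0).
Qed.

Let orbit (u : dom L) (t : R) : dom L := projT1 (cid (orbit_ex u t)).

Let orbit_val u t : dval (orbit u t) = V `|t| (dval u).
Proof. exact: (projT2 (cid (orbit_ex u t))).1. Qed.

Let orbit_fun u t : lfun L (dval (orbit u t)) = V `|t| (lfun L (dval u)).
Proof. exact: (projT2 (cid (orbit_ex u t))).2. Qed.

Let feedback_continuous u : continuous (fun t => F (orbit u t)).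
Proof.
have c (x : H) : continuous (fun t : R => V `|t| x).
  move=> t; apply: (@continuous_comp _ _ _ (fun t : R => `|t|) (fun s => V s x)).
    exact: norm_continuous.
  exact: cV.
suff co : continuous (orbit u) by exact: (@continuous_bop _ _ _ F _ co).
move=> t; apply: (@cvg_nrm_le _ _ _ _ _ _ _
  (fun s => nrm (V `|s| (dval u) - V `|t| (dval u)) +
    nrm (V `|s| (lfun L (dval u)) - V `|t| (lfun L (dval u))))).
  move=> s; rewrite (le_trans (nrm_graph_le _))//.
  by rewrite dom_funB !orbit_fun -!orbit_val.
rewrite -[0 in X in _ --> X](addr0 0); apply: cvgD.
  by apply: cvg_nrm0; exact: c.
by apply: cvg_nrm0; exact: c.
Qed.

Let energy (u : dom L) (t : R) : R :=
  complex.Re (E (V t (dval u)) (V t (dval u))).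

Let energy_continuous u : continuous (energy u).
Proof. by move=> t; apply: cvg_Re; apply: (cvg_form hE E_le); exact: cV. Qed.

Let energy_ge0 u t : 0 <= energy u t.
Proof. by apply: le_trans (E_ge _); rewrite mulr_ge0 ?sqr_ge0// ltW. Qed.

Let rate (u : dom L) (t : R) : R :=
  complex.Re (E (V t (lfun L (dval u))) (V t (dval u))) +
  complex.Re (E (V t (dval u)) (V t (lfun L (dval u)))).

Let energy_derivative u t : 0 <= t ->
  h^-1 * (energy u (t + h) - energy u t) @[h --> 0^'+] --> rate u t.
Proof.
move=> t0; have q := @orbit_generator u _ t0.
exact: (form_quotient (u0 := V t (dval u)) (w0 := V t (dval u)) hE E_le q q).
Qed.

Let rate_le u t : 0 <= t -> rate u t <= - beta * energy u t.
Proof.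
move=> t0; have := dissipation (orbit u t).
by rewrite orbit_fun orbit_val ger0_norm.
Qed.

Let feedback_le u t : 0 <= t -> nrm (F (orbit u t)) ^+ 2 <= - k * rate u t.
Proof.
move=> t0; have := observation (orbit u t).
by rewrite orbit_fun orbit_val ger0_norm.
Qed.

Let energy_decay u t : 0 <= t -> energy u t <= expR (- (beta * t)) * energy u 0.
Proof.
move=> t0; rewrite expRN ler_pdivlMl ?expR_gt0//.
have e0 : expR (beta * 0) * energy u 0 = energy u 0 by rewrite mulr0 expR0 mul1r.
rewrite -[leRHS]e0.
apply: (@right_derivative_le0 _ (fun t => expR (beta * t) * energy u t)
  (fun t => beta * expR (beta * t) * energy u t + expR (beta * t) * rate u t) 0 t) => //.
- have ce : continuous (fun t => expR (beta * t)).
    move=> s; apply: (@continuous_comp _ _ _ (fun s => beta * s) expR).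
      exact: cvgMl_tmp.
    exact: continuous_expR.
  by move=> s; apply: cvgM; [exact: ce|exact: energy_continuous].
- move=> s s0; have d2 := derive_quotient_right (is_derive_expR_lin beta s).
  apply: (@right_quotient_mul _ (fun r => expR (beta * r)) (energy u) s) => //.
  exact: energy_derivative.
- move=> s s0; rewrite (mulrC beta) -mulrA -mulrDr pmulr_rle0 ?expR_gt0//.
  by rewrite -lerBrDl sub0r -mulNr rate_le.
Qed.

Let energy0 u : energy u 0 <= KE * nrm (dval u) ^+ 2.
Proof.
have [v0 _ _] := C0V; rewrite /energy v0 (le_trans (ler_norm _))//.
by rewrite (le_trans (Re_le_nrm _))// (le_trans (E_le _ _)).
Qed.

(** [expR (beta * t) * energy u t] does not increase, which bounds the orbits of
    the domain; the domain is dense. *)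
Lemma lyapunov_decay : exists2 C : R, 1 <= C &
  forall t : R, 0 <= t -> nrm (V t) <= C * expR (- (2^-1 * beta * t)).
Proof.
pose N := m^-1 * KE; have N0 : 0 < N by rewrite mulr_gt0 ?invr_gt0.
(* The square of [1 + N] exceeds [N], and [1 + N] itself exceeds [1]. *)
exists (1 + N); first by rewrite lerDl ltW.
move=> t t0; have e0 : 0 < expR (- (2^-1 * beta * t)) by rewrite expR_gt0.
have N1 : 0 <= 1 + N by rewrite addr_ge0// ltW.
have C0 : 0 <= (1 + N) * expR (- (2^-1 * beta * t)) by rewrite mulr_ge0// ltW.
have decay_dom (u : dom L) :
    nrm (V t (dval u)) <= (1 + N) * expR (- (2^-1 * beta * t)) * nrm (dval u).
  rewrite -(@ler_pXn2r _ 2)// ?nnegrE ?nrm_ge0 ?(mulr_ge0 C0) ?nrm_ge0//.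
  have h : nrm (V t (dval u)) ^+ 2 <=
      N * (expR (- (2^-1 * beta * t)) ^+ 2 * nrm (dval u) ^+ 2).
    rewrite /N -mulrA ler_pdivlMl// (le_trans (E_ge _))//.
    rewrite (le_trans (energy_decay u t0))// expr2 -expRD.
    rewrite (_ : - (2^-1 * beta * t) + _ = - (beta * t)); last by field.
    by rewrite mulrCA ler_wpM2l ?expR_ge0// energy0.
  rewrite (le_trans h)// !exprMn -[leRHS]mulrA ler_wpM2r ?(mulr_ge0 (sqr_ge0 _) (sqr_ge0 _))//.
  have -> : (1 + N) ^+ 2 = N + (1 + N + N ^+ 2) by ring.
  by rewrite lerDl !addr_ge0 ?sqr_ge0 ?(ltW N0).
rewrite nrm_opnorm; apply: opnorm_le => // x.
apply/ler_addgt0Pl => e e_gt0.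
set C := (1 + N) * _ in C0 decay_dom *.
have D0 : 0 < nrm (V t) + C + 1 by rewrite ltr_wpDl// addr_ge0// nrm_ge0.
have [y [Ly xy]] := Ldense x (divr_gt0 e_gt0 D0).
have := decay_dom (Dom (mem_set Ly)) => /= hy.
have -> : V t x = V t (x - y) + V t y by rewrite -bop_add subrK.
rewrite (le_trans (nrmD _ _))// (le_trans (lerD (nrm_bop _ _) hy))//.
have yx : nrm y <= nrm (x - y) + nrm x 
  by rewrite nrm_sub -[X in nrm X <= _](subrK x y) nrmD.
rewrite (le_trans (lerD (lexx _) (ler_wpM2l C0 yx)))// mulrDr addrA -mulrDl lerD2r.
have VC : nrm (V t) + C <= nrm (V t) + C + 1 by rewrite lerDl.
rewrite (le_trans (ler_wpM2r (nrm_ge0 _) VC))// mulrC -ler_pdivlMr//.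
exact: ltW xy.
Qed.

(** The sum of [k * energy u t] and the integral of the squared output up to [t]
    does not increase, so the integral stays below [k * energy u 0]. *)
Lemma lyapunov_L2 : exists2 C' : R, 0 <= C' & forall u : dom L,
  (sqL2norm `[0%R, +oo[ (fun t => dapp F (V t (dval u)))
    <= ((C' * nrm (dval u)) ^+ 2)%:E)%E.
Proof.
exists (k + KE) => [|u]; first by rewrite addr_ge0// ltW.
pose b t := nrm (F (orbit u t)) ^+ 2.
have cb : continuous b by move=> t; apply: cvgM; exact: (continuous_nrm (@feedback_continuous u)).
have [G dG] := continuous_primitive cb.
have cG : continuous G.
  by move=> t; apply/differentiable_continuous/derivable1_diffP; exact: ex_derive.
have bound n : 0 <= n -> \int[mu]_(t in `[0, n]) b t <= k * energy u 0.
  move=> n0; rewrite (int_primitive n0 cb dG) lerBlDr.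
  have h : k * energy u n + G n <= k * energy u 0 + G 0.
    apply: (@right_derivative_le0 _ (fun t => k * energy u t + G t)
      (fun t => k * rate u t + b t) 0 n) => //.
    - by move=> t; apply: cvgD; [apply: cvgMl_tmp; exact: energy_continuous|exact: cG].
    - move=> t t0; have l1 : k * (h^-1 * (energy u (t + h) - energy u t)) @[h --> 0^'+] -->
          k * rate u t by apply: cvgMl_tmp; exact: energy_derivative.
      have l2 := derive_quotient_right (dG t).
      by apply: cvg_eq_fun (cvgD l1 l2) => h; rewrite -[LHS]/(_ + _); ring.
    - by move=> t t0; rewrite -lerBrDl sub0r -mulNr; exact: feedback_le.
  by apply: le_trans h; rewrite lerDr mulr_ge0.
have -> : sqL2norm `[0%R, +oo[ (fun t => dapp F (V t (dval u))) =
    (\int[mu]_(t in `[0%R, +oo[) (b t)%:E)%E.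
  rewrite /sqL2norm; apply: eq_integral => t /set_mem /=; rewrite in_itv /= andbT => t0.
  have -> : V t (dval u) = dval (orbit u t) by rewrite orbit_val ger0_norm.
  by rewrite dappE.
have mb : measurable_fun setT (EFin \o b).
  by apply/measurable_EFinP; exact: continuous_measurable_fun.
have lim : (\int[mu]_(t in `[0%R, (0 + n%:R)%R]) (b t)%:E @[n --> \oo] -->
    \int[mu]_(t in `[0%R, +oo[) (b t)%:E)%E.
  rewrite itv_bndy_bigcup_BRight; apply: ge0_nondecreasing_set_cvg_integral.
  - move=> p q pq; rewrite subsetEset; apply: subset_itvl.
    by rewrite bnd_simp !add0r ler_nat.
  - by move=> i.
  - by move=> i; exact: measurable_funTS.
  - by move=> i t _; rewrite lee_fin sqr_ge0.
apply: (cvge_to_le lim); apply: nearW => n; have n0 : 0 <= 0 + n%:R :> R by rewrite add0r.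
have -> : (\int[mu]_(t in `[0%R, (0 + n%:R)%R]) (b t)%:E)%E =
    (\int[mu]_(t in `[0, 0 + n%:R]) b t)%:E.
  rewrite /Rintegral fineK//; apply: integrable_fin_num => //.
  exact: continuous_integrable.
rewrite lee_fin (le_trans (bound _ n0))// (le_trans (ler_wpM2l k0 (energy0 u)))//.
rewrite exprMn mulrA ler_wpM2r ?sqr_ge0//.
have -> : (k + KE) ^+ 2 = k * KE + (k ^+ 2 + k * KE + KE ^+ 2) by ring.
by rewrite lerDl !addr_ge0 ?sqr_ge0// mulr_ge0// ltW.
Qed.

End Lyapunov.

(** * The closed loop *)

Section ClosedLoop.
Context {R : realType} {H U : hilbertType R}.
Variables (A : dcop H) (S : R -> bop H H) (B : bop U (dual (dom (adjoint A)))).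
Variables (alpha C1 C2 eps T : R).
Hypothesis gS : C0_group S.
Hypothesis genS : group_generator S A.
Hypothesis hE : is_BS_ext S B (BS_ext S B).
Hypothesis eps0 : 0 <= eps.
Hypothesis eps1 : eps < alpha.
Hypothesis C10 : 0 <= C1.
Hypothesis C21 : 1 <= C2.
Hypothesis T0 : 0 < T.
Hypothesis observable : forall (t : R) (phi : dom (adjoint A)), 0 < t ->
  ((nrm (badj (S t) (dval phi)) ^+ 2)%:E <=
    C1%:E * sqL2norm `[0%R, t] (BS S B phi) +
    (C2 * expR (- (alpha * t)) * nrm (dval phi) ^+ 2)%:E)%E.
Hypothesis C2T : C2 <= expR (eps * T).
Notation mu := (@lebesgue_measure R).
Local Notation Sd := (adj_group S).
Local Notation Lf := (Lambda_form S B alpha C1 C2 eps T).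
Local Notation Pf := (Pi_form S B alpha C1 C2 eps T).
Local Notation Pi := (Pi_op S B alpha C1 C2 eps T).
Local Notation Lam := (Lambda_op S B alpha C1 C2 eps T T).
Local Notation As := (lfun (adjoint A)).
Local Notation Bs := (predual_adj B).

Let cSd : strongly_continuous Sd := adj_strongly_continuous gS genS.
Let beta := alpha - eps.
Let c := C1 * expR (alpha * T).

Let beta0 : 0 < beta. Proof. by rewrite subr_gt0. Qed.
Let c0 : 0 <= c. Proof. by rewrite mulr_ge0// expR_ge0. Qed.

Let hPf : hermitian_form Pf :=
  Pi_hermitian C1 C2 gS genS hE eps1 T0.
Let hLf : hermitian_form (Lf T) := Lambda_hermitian C1 C2 T hE eps1 T.


Let obs := obs_density S B alpha eps.
Let adjd := adj_density S alpha eps.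

Let cobs phi psi : continuous (obs phi psi).
Proof. exact: (obs_density_continuous gS genS). Qed.

Let cadjd phi psi : continuous (adjd phi psi).
Proof. exact: (adj_density_continuous gS genS). Qed.

Let obs_orbit phi psi r s :
  obs (dom_orbit gS genS phi r) (dom_orbit gS genS psi r) s =
  expR (- (beta * r)) * obs phi psi (s + r).
Proof.
rewrite /obs /obs_density !BS_group mulrA -expRD [r + s]addrC; congr (expR _ * _).
by rewrite -/beta; ring.
Qed.

Let adjd_orbit phi psi r s :
  adjd (Sd r phi) (Sd r psi) s = expR (- (beta * r)) * adjd phi psi (s + r).
Proof.
have [_ gD _] := adj_group_C0 gS genS.
rewrite /adjd /adj_density -!gD mulrA -expRD; congr (expR _ * _).
by rewrite -/beta; ring.
Qed.

Let Sd0 (chi : dual H) : Sd 0 chi = chi.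
Proof. by have [g0 _ _] := adj_group_C0 gS genS; exact: g0. Qed.

Let BS0 phi : BS S B phi 0 = Bs phi.
Proof. by rewrite (BS_dom_orbit B gS genS); congr Bs; apply: val_inj; exact: Sd0. Qed.

(** After the substitution of [r - t] for the time, [r] enters only through the
    factor [expR (- (beta * r))] and the bounds of the integrals, so that two
    successive primitives [G] and [M] express the form on the orbit. *)
Let Pf_orbit (phi psi : dom (adjoint A)) (G M : R -> R) (r : R) :
  (forall x : R, is_derive x 1 G (obs phi psi x)) ->
  (forall x : R, is_derive x 1 M (c * G x - C2 * adjd (dval phi) (dval psi) x)) ->
  complex.Re (Pf (Sd r (dval phi)) (Sd r (dval psi))) =
  expR (- (beta * r)) * (c * T * G r - (M r - M (r - T))).
Proof.
move=> dG dM; pose m s := c * G s - C2 * adjd (dval phi) (dval psi) s.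
have cG : continuous G.
  by move=> x; apply/differentiable_continuous/derivable1_diffP; exact: ex_derive.
have cm : continuous m.
  move=> x; apply: cvgB; apply: cvgMl_tmp; first exact: cG.
  exact: cadjd.
have cmr : continuous (fun s => m (s + r)).
  move=> x; apply: (@continuous_comp _ _ _ (fun s => s + r) m); last exact: cm.
  by apply: cvgD => //; exact: cvg_cst.
have Lr t : 0 <= t -> complex.Re (Lf t (Sd r (dval phi)) (Sd r (dval psi))) =
    expR (- (beta * r)) * (c * G r - m (- t + r)).
  move=> t0; rewrite -[Sd r (dval phi)]/(dval (dom_orbit gS genS phi r)).
  rewrite -[Sd r (dval psi)]/(dval (dom_orbit gS genS psi r)).
  rewrite (Re_Lambda_dom C1 C2 T gS genS hE eps1)// -/c.
  have -> : adj_density S alpha eps (dval (dom_orbit gS genS phi r))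
      (dval (dom_orbit gS genS psi r)) (- t) =
      expR (- (beta * r)) * adjd (dval phi) (dval psi) (- t + r) by exact: adjd_orbit.
  have -> : \int[mu]_(s in `[- t, 0]) obs_density S B alpha eps
      (dom_orbit gS genS phi r) (dom_orbit gS genS psi r) s =
      expR (- (beta * r)) * (G r - G (- t + r)).
    have tn : - t <= 0 by rewrite oppr_le0.
    have -> : \int[mu]_(s in `[- t, 0]) obs_density S B alpha eps
      (dom_orbit gS genS phi r) (dom_orbit gS genS psi r) s =
      \int[mu]_(s in `[- t, 0]) (expR (- (beta * r)) * obs phi psi (s + r)).
      by apply: eq_Rintegral => s _; exact: obs_orbit.
    rewrite intZ; last first.
      move=> x; apply: (@continuous_comp _ _ _ (fun s => s + r) (obs phi psi)).
        by apply: cvgD => //; exact: cvg_cst.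
      exact: cobs.
    rewrite -(int_shift r (@cobs phi psi) tn) (int_primitive _ (@cobs phi psi) dG).
      by rewrite add0r.
    by rewrite lerD2r.
  by rewrite /m; ring.
rewrite /Pi_form /Cintegral /=.
have -> : \int[mu]_(t in `[0, T]) complex.Re (Lf t (Sd r (dval phi)) (Sd r (dval psi))) =
    \int[mu]_(t in `[0, T]) (expR (- (beta * r)) * (c * G r + - m (- t + r))).
  by apply: eq_Rintegral => t /set_mem /=; rewrite in_itv /= => /andP[t0 _]; exact: Lr.
have cmo : continuous (fun t => m (- t + r)).
  move=> x; apply: (@continuous_comp _ _ _ -%R (fun s => m (s + r))).
    exact: cvgN.
  exact: cmr.
have cN : continuous (fun t => - m (- t + r)) by move=> x; apply: cvgN; exact: cmo.
rewrite intZ; last by move=> x; apply: cvgD; [exact: cvg_cst|exact: cN].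
congr (_ * _); rewrite intD; [|exact: cst_continuous|exact: cN].
rewrite int_cst ?(ltW T0)// subr0 mulrAC; congr (_ + _).
have -> : \int[mu]_(t in `[0, T]) - m (- t + r) = - \int[mu]_(t in `[0, T]) m (- t + r).
  by rewrite -[RHS]mulN1r -intZ//; apply: eq_Rintegral => t _; rewrite mulN1r.
congr (- _); rewrite -(int_opp (f := fun s => m (s + r)) cmr (ltW T0)).
rewrite oppr0 -(int_shift r cm); last by rewrite oppr_le0 ltW.
rewrite (int_primitive _ cm dM) ?add0r; first by rewrite [- T + r]addrC.
by rewrite gerDr oppr_le0 ltW.
Qed.

(** Both sides come from the derivative at [0] of the form along the orbits of
    [phi] and [psi], once through the generator and once through [Pf_orbit]. *)
Lemma Re_riccati (phi psi : dom (adjoint A)) :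
  complex.Re (Pf (As (dval phi)) (dval psi)) + complex.Re (Pf (dval phi) (As (dval psi))) +
    beta * complex.Re (Pf (dval phi) (dval psi)) =
  c * T * complex.Re (ddot (Bs phi) (Bs psi)) +
    C2 * complex.Re (ddot (dval phi) (dval psi)) -
    complex.Re (Lf T (dval phi) (dval psi)).
Proof.
have [G dG] := continuous_primitive (@cobs phi psi).
have cm : continuous (fun s => c * G s - C2 * adjd (dval phi) (dval psi) s).
  move=> x; apply: cvgB; apply: cvgMl_tmp; last exact: cadjd.
  by apply/differentiable_continuous/derivable1_diffP; exact: ex_derive.
have [M dM] := continuous_primitive cm.
pose f r := expR (- beta * r) * (c * T * G r - (M r - M (r - T))).
pose m s := c * G s - C2 * adjd (dval phi) (dval psi) s.
have d0 : is_derive (0 : R) 1 f (- beta * f 0 + (c * T * obs phi psi 0 - (m 0 - m (- T)))).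
  have e1 := is_derive_expR_lin (- beta) 0.
  have e2 : is_derive (0 : R) 1 (fun r => M (r - T)) (m (- T)).
    rewrite -[m (- T)]mulr1; apply: (@is_derive1_comp _ M (fun r => r - T)).
      by rewrite sub0r; exact: dM.
    exact: is_derive_shift.
  have e3 : is_derive (0 : R) 1 (c * T \*: G) (c * T *: obs phi psi 0) by exact: is_deriveZ.
  have e4 := is_deriveM e1 (is_deriveB e3 (is_deriveB (dM 0) e2)).
  apply: (is_derive_eq e4).
  transitivity (expR (- beta * 0) * (c * T * obs phi psi 0 - (m 0 - m (- T))) +
    (c * T * G 0 - (M 0 - M (0 - T))) * (- beta * expR (- beta * 0))); first by [].
  by rewrite /f mulr0 expR0; ring.
have [K [K0 hK]] := Pi_bounded gS genS hE eps1 C10 C21 T0.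
have fE r : complex.Re (Pf (Sd r (dval phi)) (Sd r (dval psi))) = f r.
  by rewrite (Pf_orbit r dG dM) /f mulNr.
have gen (chi : dom (adjoint A)) : (h^-1)%:C *: (Sd (- h) (dval chi) - dval chi)
    @[h --> 0^'+] --> - As (dval chi).
  by apply/(adj_group_generator gS genS); split=> //; exact: domP.
have l1 := form_quotient hPf hK (gen phi) (gen psi).
have l2 := derive_quotient_opp d0.
have f0 : complex.Re (Pf (dval phi) (dval psi)) = f 0.
  by rewrite -fE (Sd0 (dval phi)) (Sd0 (dval psi)).
have l1' : h^-1 * (f (- h) - f 0) @[h --> 0^'+] -->
    complex.Re (Pf (- As (dval phi)) (dval psi)) +
    complex.Re (Pf (dval phi) (- As (dval psi))).
  apply: cvg_eq_fun l1 => h; have fEh := fE (- h).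
  by congr (_ * (_ - _)).
have e : complex.Re (Pf (- As (dval phi)) (dval psi)) +
    complex.Re (Pf (dval phi) (- As (dval psi))) =
    - (- beta * f 0 + (c * T * obs phi psi 0 - (m 0 - m (- T)))).
  exact: (cvg_unique (@norm_hausdorff _ R^o) l1' l2).
have adj0 : adjd (dval phi) (dval psi) 0 = complex.Re (ddot (dval phi) (dval psi)).
  by rewrite /adjd /adj_density mulr0 expR0 mul1r (Sd0 (dval phi)) (Sd0 (dval psi)).
have obs0 : obs phi psi 0 = complex.Re (ddot (Bs phi) (Bs psi)).
  by rewrite /obs /obs_density mulr0 expR0 mul1r !BS0.
have e0 : complex.Re (Lf T (dval phi) (dval psi)) =
    m 0 - m (- T) + C2 * complex.Re (ddot (dval phi) (dval psi)).
  rewrite (Re_Lambda_dom C1 C2 T gS genS hE eps1)//; last exact: ltW.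
  rewrite (int_primitive _ (@cobs phi psi) dG) ?oppr_le0 ?(ltW T0)// -adj0 /m -/c -/adjd.
  by ring.
have n1 : complex.Re (Pf (- As (dval phi)) (dval psi)) =
    - complex.Re (Pf (As (dval phi)) (dval psi)) by rewrite (formNl hPf) Re_opp.
have n2 : complex.Re (Pf (dval phi) (- As (dval psi))) =
    - complex.Re (Pf (dval phi) (As (dval psi))) by rewrite (formNr hPf) Re_opp.
have solve (b k x1 y1 x y P g o o' w L D : R) :
    x1 + y1 = - (- b * g + (k * o - w)) -> x1 = - x -> y1 = - y -> o = o' ->
    L = w + C2 * D -> P = g -> x + y + b * P = k * o' + C2 * D - L.
  by move=> h e1 e2 <- -> ->; rewrite -[x]opprK -[y]opprK -e1 -e2 -opprD h; ring.
exact: solve e n1 n2 obs0 e0 f0.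
Qed.

(** Up to sign, the imaginary part is the real part for ['i *: psi]. *)
Lemma riccati (phi psi : dom (adjoint A)) :
  Pf (As (dval phi)) (dval psi) + Pf (dval phi) (As (dval psi)) +
    beta%:C * Pf (dval phi) (dval psi) =
  (c * T)%:C * ddot (Bs phi) (Bs psi) + C2%:C * ddot (dval phi) (dval psi) -
    Lf T (dval phi) (dval psi).
Proof.
apply: complex_eq_Re.
  by rewrite !Re_add !Re_opp !Re_scale; exact: Re_riccati.
have Bi : Bs ('i *: psi) = 'i *: Bs psi.
  by apply: bop_ext => u; rewrite /predual_adj /= -[LHS]/(B u ('i *: psi)) bop_scale.
have := Re_riccati phi ('i *: psi); rewrite Bi dvalZ dom_funZ.
rewrite !(formZr hPf) (formZr hLf) !(formZr ddot_hermitian) -!Re_scale -Re_opp -!Re_add.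
move=> e; transitivity (complex.Re ('i * Pf (As (dval phi)) (dval psi) +
    'i * Pf (dval phi) (As (dval psi)) + beta%:C * ('i * Pf (dval phi) (dval psi)))).
  by apply: (congr1 (@complex.Re R)); rewrite !mulrDr (mulrCA 'i).
rewrite e; apply: (congr1 (@complex.Re R)).
have solve (i a b x y z : R[i]) : a * (i * x) + b * (i * y) - i * z = i * (a * x + b * y - z).
  by ring.
exact: solve.
Qed.

Let PiP (phi psi : dual H) : psi (Pi phi) = Pf phi psi.
Proof. exact: Pi_opP. Qed.

Let KPi : R := projT1 (cid (Pi_bounded gS genS hE eps1 C10 C21 T0)).
Let KPi0 : 0 < KPi. Proof. by rewrite /KPi; case: cid => ? []. Qed.
Let Pf_le phi psi : nrm (Pf phi psi : R[i]^o) <= KPi * (nrm phi * nrm psi).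
Proof. by rewrite /KPi; case: cid => ? []. Qed.

Let Pf_ge phi : T * nrm phi ^+ 2 <= complex.Re (Pf phi phi).
Proof. exact: Pi_ge. Qed.

Let Pinv : H -> dual H := 'pinv_(fun=> 0) setT Pi.
Let Pi_lin (a : R[i]) f g : Pi (a *: f + g) = Num.conj a *: Pi f + Pi g.
Proof. exact: form_op_lin hPf PiP a f g. Qed.
Let nrm_Pi f : nrm (Pi f) <= KPi * nrm f.
Proof. exact: nrm_form_op KPi0 Pf_le PiP f. Qed.
Let PiK phi : Pinv (Pi phi) = phi.
Proof. exact: form_opK hPf T0 Pf_ge PiP phi. Qed.
Let PinvK x : Pi (Pinv x) = x.
Proof. exact: form_op_invK hPf Pf_le T0 Pf_ge PiP x. Qed.
Let Pinv_lin (a : R[i]) x y : Pinv (a *: x + y) = Num.conj a *: Pinv x + Pinv y.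
Proof. exact: form_op_inv_lin hPf Pf_le T0 Pf_ge PiP a x y. Qed.
Let nrm_Pinv x : nrm (Pinv x) <= T^-1 * nrm x.
Proof. exact: nrm_form_op_inv hPf Pf_le T0 Pf_ge PiP x. Qed.

(** [expR (- (beta * t)) * S^* (- t)] transported to [H] by [Pi]: conjugating a
    linear operator by a conjugate-linear bijection gives a linear operator. *)
Let rot (t : R) (x : H) : H := Pi ((expR (- (beta * t)))%:C *: Sd (- t) (Pinv x)).

Let rot_subproof t : rot t \in @bounded_linear R H H.
Proof.
apply: is_bounded_linear_bop; split=> [a x y|].
  rewrite /rot Pinv_lin bop_lin scalerDr scalerA mulrC -scalerA Pi_lin conjCK.
  by [].
exists (KPi * (expR (- (beta * t)) * (nrm (Sd (- t)) * T^-1))) => x.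
rewrite (le_trans (nrm_Pi _))// -!mulrA (ler_wpM2l (ltW KPi0))//.
rewrite nrmRZ gtr0_norm ?expR_gt0// ler_wpM2l ?expR_ge0//.
by rewrite (le_trans (nrm_bop _ _))// ler_wpM2l ?nrm_ge0// nrm_Pinv.
Qed.

Definition conj_group (t : R) : bop H H := Bop (rot_subproof t).

Let rot_quotient (phi chi : dual H) :
  (h^-1)%:C *: ((expR (- (beta * h)))%:C *: Sd (- h) phi - phi) @[h --> 0^'+] --> chi <->
  (h^-1)%:C *: (Sd (- h) phi - phi) @[h --> 0^'+] --> chi + beta%:C *: phi.
Proof.
have ce : h^-1 * (expR (- beta * (0 + h)) - expR (- beta * 0)) @[h --> 0^'+] --> - beta.
  have := derive_quotient_right (is_derive_expR_lin (- beta) 0).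
  by rewrite mulr0 expR0 mulr1.
have cS : Sd (- h) phi @[h --> 0^'+] --> phi.
  rewrite -[X in _ --> X](Sd0 phi); apply: cvg_at_right_filter.
  have h : Sd (- z) phi @[z --> (0 : R)] --> Sd (- 0) phi.
    exact: (strongly_continuous_opp cSd).1.
  by rewrite oppr0 in h.
have cE : (h^-1 * (expR (- beta * (0 + h)) - expR (- beta * 0)))%:C *: Sd (- h) phi
    @[h --> 0^'+] --> (- beta)%:C *: phi by exact: cvg_realZ ce cS.
have eE h : (h^-1)%:C *: ((expR (- (beta * h)))%:C *: Sd (- h) phi - phi) =
  (h^-1)%:C *: (Sd (- h) phi - phi) +
  (h^-1 * (expR (- beta * (0 + h)) - expR (- beta * 0)))%:C *: Sd (- h) phi.
  rewrite mulr0 expR0 add0r mulNr rmorphM -scalerA -scalerDr; congr (_ *: _).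
  by rewrite rmorphB scalerBl scale1r [RHS]addrC addrA subrK.
split=> h1.
  have -> : chi + beta%:C *: phi = chi - (- beta)%:C *: phi.
    by rewrite rmorphN scaleNr opprK.
  by apply: cvg_eq_fun (cvgB h1 cE) => h; rewrite -[LHS]/(_ - _) eE addrK.
have -> : chi = chi + beta%:C *: phi + (- beta)%:C *: phi.
  by rewrite rmorphN scaleNr addrK.
by apply: cvg_eq_fun (cvgD h1 cE) => h; rewrite -[LHS]/(_ + _) eE.
Qed.

Lemma conj_group_C0 : C0_group conj_group.
Proof.
have [g0 gD gc] := adj_group_C0 gS genS.
split=> [x|s t x|x].
- by rewrite /conj_group /= /rot mulr0 oppr0 expR0 scale1r Sd0 PinvK.
- rewrite /conj_group /= /rot PiK bop_scale scalerA -rmorphM -expRD -gD.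
  by rewrite mulrDr !opprD.
- rewrite -[X in _ --> X](PinvK x).
  apply: (cvg_conj_lin Pi_lin nrm_Pi); rewrite -[X in _ --> X]scale1r.
  apply: (@cvg_realZ _ _ _ _ _ _ _ 1).
    rewrite -expR0 -[X in expR X](_ : - (beta * 0) = 0); last by rewrite mulr0 oppr0.
    apply: (@continuous_comp _ _ _ (fun t => - (beta * t)) expR).
      by apply: cvgN; exact: cvgMl_tmp.
    exact: continuous_expR.
  have h : Sd (- z) (Pinv x) @[z --> (0 : R)] --> Sd (- 0) (Pinv x).
    exact: (strongly_continuous_opp cSd).1.
  by rewrite oppr0 Sd0 in h.
Qed.

Let LamP (phi psi : dual H) : psi (Lam phi) = Lf T phi psi.
Proof. by apply: Lambda_opP => //; rewrite lexx ltW. Qed.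

Let Lam_lin (a : R[i]) f g : Lam (a *: f + g) = Num.conj a *: Lam f + Lam g.
Proof. exact: form_op_lin hLf LamP a f g. Qed.

Let Lam_bounded : exists M : R, 0 < M /\ forall phi, nrm (Lam phi) <= M * nrm phi.
Proof.
have [M hM] := Lambda_bounded T gS genS hE eps1 C10 C21.
have M0 : 0 < `|2 * M| + 1 by rewrite ltr_wpDl.
exists (`|2 * M| + 1); split=> // phi; apply: nrm_dual_le => [|psi].
  by rewrite mulr_ge0 ?nrm_ge0// ltW.
rewrite LamP (le_trans (hM T _ _ _)) ?lexx ?(ltW T0)// -[leRHS]mulrA.
rewrite ler_wpM2r ?mulr_ge0 ?nrm_ge0//.
by rewrite (le_trans (ler_norm _))// lerDl.
Qed.

(** The bounded part of the closed-loop generator, namely the terms of the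
    Riccati equation that involve neither [A^*] nor [B^*]. *)
Let corr (x : H) : H := C2%:C *: riesz (Pinv x) - Lam (Pinv x).

Let corr_subproof : corr \in @bounded_linear R H H.
Proof.
apply: is_bounded_linear_bop; split=> [a x y|].
  rewrite /corr Pinv_lin riesz_lin Lam_lin conjCK scalerDr scalerA mulrC -scalerA.
  have d (w : R[i]) (p q r s : H) : w *: p + q - (w *: r + s) = w *: (p - r) + (q - s).
    by rewrite scalerBr opprD addrACA.
  exact: d.
have [M [M0 hM]] := Lam_bounded.
exists ((C2 + M) * T^-1) => x.
rewrite (le_trans (nrmB _ _))// nrmRZ ger0_norm ?(le_trans ler01)// nrm_riesz.
rewrite -mulrA (le_trans (lerD (lexx _) (hM _)))// -mulrDl ler_wpM2l ?nrm_Pinv//.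
by rewrite addr_ge0 ?(ltW M0)// (le_trans ler01).
Qed.

Definition gen_correction : bop H H := Bop corr_subproof.

Local Notation SS := (perturbed_semigroup gen_correction conj_group_C0).
Local Notation Kd := (Kdom S B alpha C1 C2 eps T).

Let KdP x : Kd x <-> ldom (adjoint A) (Pinv x).
Proof.
split=> [[phi Aphi <-]|Ax]; first by rewrite PiK.
by exists (Pinv x) => //; exact: PinvK.
Qed.

Let gen_fun (x : H) : H := Pi (- As (Pinv x) - beta%:C *: Pinv x) + corr x.

Let gen0 : Kd 0.
Proof. by apply/KdP; rewrite (conj_lin0 Pinv_lin); exact: ldom0. Qed.

Let gen_lin (a : R[i]) x y : Kd x -> Kd y -> Kd (a *: x + y).
Proof. by move=> /KdP Ax /KdP Ay; apply/KdP; rewrite Pinv_lin; exact: ldom_lin. Qed.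

Let gen_fun_lin (a : R[i]) x y : Kd x -> Kd y ->
  gen_fun (a *: x + y) = a *: gen_fun x + gen_fun y.
Proof.
move=> /KdP Ax /KdP Ay; rewrite /gen_fun -[corr]/(bop_fun gen_correction) bop_lin.
rewrite Pinv_lin (lfun_lin _ Ax Ay).
have e (w b : R[i]) (u v p q : dual H) : - (w *: u + v) - b *: (w *: p + q) =
    w *: (- u - b *: p) + (- v - b *: q).
  rewrite scalerBr scalerN scalerDr !scalerA [w * b]mulrC !opprD.
  by rewrite addrACA.
have d (w : R[i]) (p q r s : H) : w *: p + q + (w *: r + s) = w *: (p + r) + (q + s).
  by rewrite [in RHS]scalerDr addrACA.
rewrite e -[X in X *: (Pi _ + _)]conjCK.
have := Pi_lin (Num.conj a) (- As (Pinv x) - beta%:C *: Pinv x)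
  (- As (Pinv y) - beta%:C *: Pinv y).
by move=> ->; rewrite conjCK; exact: d.
Qed.

Definition closed_gen : lop H := @Lop R H Kd gen_fun gen0 gen_lin gen_fun_lin.

Lemma closed_semigroup_C0 : C0_semigroup SS.
Proof. exact: perturbed_C0. Qed.

(** The quotients of [conj_group] at [x] are the images by [Pi] of those of
    [expR (- (beta * t)) * S^* (- t)] at [Pi^-1 x], and [Pi] is a homeomorphism;
    so its generator is [Pi (- A^* - beta) Pi^-1] with the exact domain. *)
Lemma closed_generator : semigroup_generator SS closed_gen.
Proof.
move=> x y.
have e1 : (h^-1)%:C *: (conj_group h x - x) @[h --> 0^'+] --> y - gen_correction x <->
   (h^-1)%:C *: ((expR (- (beta * h)))%:C *: Sd (- h) (Pinv x) - Pinv x) @[h --> 0^'+]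
     --> Pinv (y - gen_correction x).
  split=> h1.
    apply: cvg_eq_fun (cvg_conj_lin Pinv_lin nrm_Pinv h1) => h.
    by rewrite (conj_linZ Pinv_lin) (conj_linB Pinv_lin) PiK.
  rewrite -[X in _ --> X](PinvK (y - gen_correction x)).
  apply: cvg_eq_fun (cvg_conj_lin Pi_lin nrm_Pi h1) => h.
  by rewrite (conj_linZ Pi_lin) (conj_linB Pi_lin) PinvK.
rewrite (perturbed_generator gen_correction conj_group_C0 x y) e1 rot_quotient.
have e2 : Pinv (y - gen_correction x) + beta%:C *: Pinv x =
  - (- (Pinv (y - gen_correction x) + beta%:C *: Pinv x)) by rewrite opprK.
rewrite e2 -(adj_group_generator gS genS) -[ldom closed_gen x]/(Kd x).
rewrite -[lfun closed_gen x]/(gen_fun x) /gen_fun -[corr]/(bop_fun gen_correction).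
split=> [[/KdP Ax <-]|[Ax e]]; split=> //.
- by rewrite addrK PiK addrNK opprK.
- exact/KdP.
- by rewrite e opprK addrK PinvK subrK.
Qed.

Let kappa := T * C1 * expR (alpha * T).
Let kappaE : kappa = c * T. Proof. by rewrite /kappa /c; ring. Qed.
Let kappa0 : 0 <= kappa. Proof. by rewrite kappaE mulr_ge0// ltW. Qed.

Let Pdom (u : dom closed_gen) : dom (adjoint A) := Dom (mem_set ((KdP (dval u)).1 (domP u))).

Let closed_fun (u : dom closed_gen) : U := Kfun S B alpha C1 C2 eps T (dval u).

Let closed_funE u : closed_fun u = - (kappa%:C *: riesz (Bs (Pdom u))).
Proof. by rewrite /closed_fun /Kfun -[X in dapp _ X]/(dval (Pdom u)) dappE. Qed.

(** [B^*] is bounded in the graph norm of [A^*], and [A^* phi] is recovered from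
    the closed-loop generator at [Pi phi] up to bounded terms. *)
Let closed_fun_subproof : closed_fun \in @bounded_linear R (dom closed_gen) U.
Proof.
apply: is_bounded_linear_bop; split=> [a u v|].
  rewrite !closed_funE; have -> : Pdom (a *: u + v) = Num.conj a *: Pdom u + Pdom v.
    by apply: val_inj; exact: Pinv_lin.
  rewrite predual_adj_lin riesz_lin conjCK scalerDr opprD scalerA mulrC -scalerA.
  by rewrite scalerN.
exists (kappa * (nrm B * (T^-1 + T^-1 * (1 + nrm gen_correction) + beta * T^-1))) => u.
rewrite closed_funE nrmN nrmRZ ger0_norm// nrm_riesz -[leRHS]mulrA (ler_wpM2l kappa0)//.
rewrite (le_trans (nrm_predual_adj _ _))// -[leRHS]mulrA ler_wpM2l ?nrm_ge0//.
rewrite (le_trans (nrm_graph_le _))//.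
have iT : 0 <= T^-1 by rewrite invr_ge0 ltW.
have xu : nrm (dval u) <= nrm u by exact: nrm_dval_le.
have n1 : nrm (dval (Pdom u)) <= T^-1 * nrm u.
  by rewrite (le_trans (nrm_Pinv _))// ler_wpM2l.
have AsE : As (dval (Pdom u)) =
    - (beta%:C *: dval (Pdom u)) - Pinv (lfun closed_gen (dval u) - gen_correction (dval u)).
  rewrite -[lfun closed_gen _]/(gen_fun _) /gen_fun -[corr]/(bop_fun gen_correction).
  by rewrite addrK PiK -[Pinv (dval u)]/(dval (Pdom u)) opprB opprK addrA addNr add0r.
have n2 : nrm (As (dval (Pdom u))) <=
    beta * (T^-1 * nrm u) + T^-1 * (nrm u + nrm gen_correction * nrm u).
  rewrite AsE (le_trans (nrmB _ _))// nrmN nrmRZ gtr0_norm//; apply: lerD.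
    by rewrite ler_wpM2l// ltW.
  rewrite (le_trans (nrm_Pinv _))// ler_wpM2l// (le_trans (nrmB _ _))//.
  rewrite lerD ?nrm_lfun_le// (le_trans (nrm_bop _ _))// ler_wpM2l ?nrm_ge0//.
apply: (le_trans (lerD n1 n2)); rewrite le_eqVlt; apply/orP; left; apply/eqP.
by ring.
Qed.

Definition closed_feedback : bop (dom closed_gen) U := Bop closed_fun_subproof.

Let gen_form (u : dom closed_gen) (psi : dual H) : psi (lfun closed_gen (dval u)) =
  - Pf (As (dval (Pdom u))) psi - beta%:C * Pf (dval (Pdom u)) psi +
  C2%:C * ddot (dval (Pdom u)) psi - Lf T (dval (Pdom u)) psi.
Proof.
rewrite -[lfun closed_gen _]/(gen_fun _) /gen_fun bop_add /corr bop_sub bop_scale.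
rewrite PiP LamP -[Pinv (dval u)]/(dval (Pdom u)) (formBl hPf) (formNl hPf).
have -> : Pf (beta%:C *: dval (Pdom u)) psi = beta%:C * Pf (dval (Pdom u)) psi.
  rewrite (form_conj hPf) (formZr hPf) rmorphM /= -(form_conj hPf); congr (_ * _).
  by apply/eqP; rewrite eq_complex /= oppr0 !eqxx.
by rewrite addrA.
Qed.

(** Tested on [psi] in the domain of [A^*], this is the Riccati equation: the
    term [Pf phi (A^* psi)] is the extension of [A] at [Pi phi], and the term in
    [B^*] is the feedback. *)
Lemma closed_equation (u : dom closed_gen) :
  dom_embed A (lfun closed_gen (dval u)) =
  lop_ext A (dval u) + B (closed_feedback u).
Proof.
apply: bop_ext => psi; rewrite -[LHS]/(dval psi (lfun closed_gen (dval u))) gen_form.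
rewrite bopDE -[lop_ext A _ psi]/(As (dval psi) (dval u)).
have -> : As (dval psi) (dval u) = Pf (dval (Pdom u)) (As (dval psi)).
  by rewrite -PiP PinvK.
have -> : B (closed_feedback u) psi = - ((c * T)%:C * ddot (Bs (Pdom u)) (Bs psi)).
  rewrite -[closed_feedback u]/(closed_fun u) closed_funE kappaE.
  rewrite -[LHS]/(Bs psi (- ((c * T)%:C *: riesz (Bs (Pdom u))))).
  by rewrite -scaleNr bop_scale scaleNr.
have := riccati (Pdom u) psi.
move: (Pf (As _) _) (Pf _ (As _)) (beta%:C * _) ((c * T)%:C * _) (C2%:C * _) (Lf _ _ _).
move=> p1 p2 b k d l e.
have -> : - p1 - b + d - l = p2 - (p1 + p2 + b) + d - l by ring.
by rewrite e; ring.
Qed.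

(** The Riccati equation with [psi = phi] leaves the terms
    [C2 * |phi|^2 - Lf T phi phi], nonpositive because [C2 <= expR (eps * T)]. *)
Let dissipation (u : dom closed_gen) :
  complex.Re (Pf (Pinv (lfun closed_gen (dval u))) (Pinv (dval u))) +
    complex.Re (Pf (Pinv (dval u)) (Pinv (lfun closed_gen (dval u)))) <=
  - beta * complex.Re (Pf (Pinv (dval u)) (Pinv (dval u))) -
    kappa * nrm (Bs (Pdom u)) ^+ 2.
Proof.
rewrite (form_conj hPf (Pinv (dval u)) (Pinv (lfun _ _))) Re_conj -PiP PinvK.
rewrite -[Pinv (dval u)]/(dval (Pdom u)) gen_form.
have := Re_riccati (Pdom u) (Pdom u).
rewrite (form_conj hPf _ (As _)) Re_conj !ddotxx.
have : C2 * nrm (dval (Pdom u)) ^+ 2 <= complex.Re (Lf T (dval (Pdom u)) (dval (Pdom u))).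
  have TT : 0 <= T <= T by rewrite lexx ltW.
  apply: le_trans (Lambda_ge gS genS hE eps0 eps1 C10 C21 observable _ TT).
  by rewrite ler_wpM2r ?sqr_ge0.
move: (Lf T (dval (Pdom u)) (dval (Pdom u))) => L.
rewrite !Re_add !Re_opp !Re_scale ddotxx -kappaE.
have solve (b p q k d l : R) : d <= l -> p + p + b * q = k + d - l ->
    - p - b * q + d - l + (- p - b * q + d - l) <= - b * q - k.
  move=> h1 h2; have -> : - p - b * q + d - l + (- p - b * q + d - l) =
    - (p + p + b * q) - b * q + 2 * (d - l) by ring.
  have -> : - (p + p + b * q) - b * q + 2 * (d - l) = - b * q - k + (d - l).
    by rewrite h2; ring.
  by rewrite gerDl subr_le0.
by move=> h1 h2; exact: solve h1 h2.
Qed.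

(** The energy, as a form on [H]; the arguments are exchanged because [Pi^-1] is
    conjugate-linear and forms are linear in the second argument. *)
Let form_H (x y : H) : R[i] := Pf (Pinv y) (Pinv x).

Let form_H_hermitian : hermitian_form form_H.
Proof.
split=> [a f g h|f g]; last exact: (form_conj hPf).
by rewrite /form_H Pinv_lin (form_linl hPf) conjCK.
Qed.

Let form_H_le x y : nrm (form_H x y : R[i]^o) <= KPi * T^-1 ^+ 2 * (nrm x * nrm y).
Proof.
rewrite (le_trans (Pf_le _ _))// -mulrA (ler_wpM2l (ltW KPi0))//.
rewrite (le_trans (ler_pM (nrm_ge0 _) (nrm_ge0 _) (nrm_Pinv y) (nrm_Pinv x)))//.
by rewrite mulrACA [nrm y * _]mulrC.
Qed.

Let form_H_ge x : T / KPi ^+ 2 * nrm x ^+ 2 <= complex.Re (form_H x x).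
Proof.
apply: le_trans (Pf_ge _); rewrite -mulrA (ler_wpM2l (ltW T0))// ler_pdivrMl ?exprn_gt0//.
rewrite -exprMn ler_pXn2r ?nnegrE ?nrm_ge0 ?(mulr_ge0 (ltW KPi0)) ?nrm_ge0//.
by rewrite -[X in nrm X <= _](PinvK x).
Qed.

Let closed_gen_dense x (e : R) : 0 < e -> exists y, ldom closed_gen y /\ nrm (x - y) < e.
Proof.
move=> e0; have [g [Ag xg]] := adj_dom_dense gS genS (Pinv x) (divr_gt0 e0 KPi0).
exists (Pi g); split; first by exists g.
rewrite -[X in nrm (X - _)](PinvK x) -(conj_linB Pi_lin) (le_lt_trans (nrm_Pi _))//.
by rewrite mulrC -ltr_pdivlMr.
Qed.

Let form_HC (x y : H) : complex.Re (form_H x y) + complex.Re (form_H y x) =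
  complex.Re (Pf (Pinv x) (Pinv y)) + complex.Re (Pf (Pinv y) (Pinv x)).
Proof. by rewrite /form_H; exact: addrC. Qed.

Let form_H_dissipation (u : dom closed_gen) :
  complex.Re (form_H (lfun closed_gen (dval u)) (dval u)) +
  complex.Re (form_H (dval u) (lfun closed_gen (dval u))) <=
  - beta * complex.Re (form_H (dval u) (dval u)).
Proof.
rewrite form_HC (le_trans (dissipation u))// gerBl.
exact: (mulr_ge0 kappa0 (sqr_ge0 _)).
Qed.

Let form_H_observation (u : dom closed_gen) : nrm (closed_feedback u) ^+ 2 <=
  - kappa * (complex.Re (form_H (lfun closed_gen (dval u)) (dval u)) +
    complex.Re (form_H (dval u) (lfun closed_gen (dval u)))).
Proof.
rewrite -[closed_feedback u]/(closed_fun u) closed_funE nrmN nrmRZ ger0_norm// nrm_riesz.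
rewrite form_HC mulNr -mulrN exprMn expr2 -mulrA (ler_wpM2l kappa0)// lerNr.
rewrite (le_trans (dissipation u))// gerDr mulNr oppr_le0.
apply: (mulr_ge0 (ltW beta0)); apply: le_trans (Pf_ge _).
exact: (mulr_ge0 (ltW T0) (sqr_ge0 _)).
Qed.

Lemma closed_loop_stabilizing : stabilizing_feedback B Kd
  (Kfun S B alpha C1 C2 eps T) (2^-1 * (alpha - eps)).
Proof.
split; first by rewrite mulr_gt0 ?invr_gt0.
have KE0 : 0 < KPi * T^-1 ^+ 2 by rewrite mulr_gt0 ?exprn_gt0 ?invr_gt0.
have m0 : 0 < T / KPi ^+ 2 by rewrite divr_gt0 ?exprn_gt0.
exists SS, closed_gen, closed_feedback; split; split.
- exact: closed_semigroup_C0.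
- exact: closed_generator.
- by [].
- by [].
- exact: (lyapunov_decay closed_semigroup_C0
    (@perturbed_continuous _ _ _ gen_correction conj_group_C0) closed_generator
    closed_gen_dense form_H_hermitian KE0 form_H_le m0 form_H_ge form_H_dissipation).
- exact: closed_equation.
- exact: (lyapunov_L2 closed_semigroup_C0
    (@perturbed_continuous _ _ _ gen_correction conj_group_C0) closed_generator
    form_H_hermitian KE0 form_H_le m0 form_H_ge kappa0 form_H_observation).
Qed.

End ClosedLoop.

Theorem theorem3p1 (R : realType) (H U : hilbertType R)
    (A : dcop H) (Sg : R -> bop H H) (B : bop U (dual (dom (adjoint A))))
    (alpha C1 C2 : R) :
  C0_group Sg -> group_generator Sg A ->
  (forall T : R, 0 < T -> exists2 C : R, 0 < C &
    forall phi : dom (adjoint A),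
      (sqL2norm `[0%R, T] (BS Sg B phi) <= (C * nrm (dval phi) ^+ 2)%:E)%E) ->
  0 < alpha -> 0 <= C1 -> 1 <= C2 ->
  (forall (t : R) (phi : dom (adjoint A)), 0 < t ->
    ((nrm (badj (Sg t) (dval phi)) ^+ 2)%:E <=
      C1%:E * sqL2norm `[0%R, t] (BS Sg B phi) +
      (C2 * expR (- (alpha * t)) * nrm (dval phi) ^+ 2)%:E)%E) ->
  forall eps T : R, 0 <= eps < alpha -> 0 < T ->
    (1 < C2 -> 0 < eps < alpha /\ eps^-1 * ln C2 <= T) ->
    stabilizing_feedback B
      (Kdom Sg B alpha C1 C2 eps T) (Kfun Sg B alpha C1 C2 eps T)
      (2^-1 * (alpha - eps)).
Proof.
move=> gS genS adm alpha0 C10 C21 observable eps T /andP[eps0 eps1] T0 hC2.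
have C2T : C2 <= expR (eps * T).
  move: (C21); rewrite le_eqVlt => /predU1P[<-|C2gt1].
    by rewrite -expR0 ler_expR mulr_ge0// ltW.
  have [/andP[eps_gt0 _] lnT] := hC2 C2gt1.
  rewrite -ler_ln ?posrE ?expR_gt0 ?(lt_trans ltr01 C2gt1)//.
  by rewrite expRK -ler_pdivrMl.
exact: closed_loop_stabilizing gS genS (BS_extP gS genS adm) eps0 eps1 C10 C21 T0
  observable C2T.
Qed.
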